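(* Assume that there exists $\alpha>0$ such that, for all integers $s\ge1$, $$P^n_{PL}\Big(\Big\{\lambda\vdash n:\ \max_{\mu\subseteq\lambda,\ |\mu|=n-s}\frac{\dim\mu}{\dim\lambda}>n^{-\alpha s}\Big\}\Big)\ \longrightarrow\ 0\qquad(n\to\infty).$$ Let $\sigma_1,\sigma_2,\ldots$ be fixed permutations (with $\sigma_i\in S_{r_i}$) of cycle types $\rho_1,\rho_2,\ldots$, let $u_1,u_2,\ldots\in[0,1]$, let $\{\xi_k\}_{k\ge2}$ be independent standard Gaussian variables, and let $\lambda\vdash n$ be Plancherel distributed. Then, as $n\to\infty$, $$\Big\{n^{\frac{\mathrm{wt}(\rho_i)}2}PT^\lambda_{u_i}(\sigma_i)\Big\}_{i\ge1}\ \xrightarrow{d}\ \Big\{u_i\prod_{k\ge2}k^{m_k(\rho_i)/2}\,\mathcal H_{m_k(\rho_i)}(\xi_k)\Big\}_{i\ge1}$$ jointly (convergence of all finite-dimensional joint distributions).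
   Context: Partitions $\lambda\vdash n$ are identified with Young diagrams in English notation (row 1 on top); the box in row $b$ and column $a$ has content $a-b$. $\mu\subseteq\lambda$ means that $\mu$ is a partition obtained from $\lambda$ by removing boxes. $\mathrm{SYT}(\lambda)$ is the set of standard Young tableaux of shape $\lambda$ and $\dim\lambda=|\mathrm{SYT}(\lambda)|$. For $T\in\mathrm{SYT}(\lambda)$ let $c_k(T)$ be the content of the box containing $k$, and $d_k(T):=c_{k+1}(T)-c_k(T)$. If $k,k+1$ lie in different rows and different columns of $T$, $(k,k+1)T$ is the standard tableau obtained by exchanging them. The representation $\pi^\lambda$ of $S_n$ has matrices with rows and columns indexed by $\mathrm{SYT}(\lambda)$, determined by: $\pi^\lambda((k,k+1))_{T,S}=1/d_k(T)$ if $S=T$; $=\sqrt{1-1/d_k(T)^2}$ if $S=(k,k+1)T$; $=0$ otherwise; extended multiplicatively to $S_n$ (permutations composed right to left). For $r\le n$, $S_r\subset S_n$ is the subgroup fixing $r+1,\ldots,n$. Last letter order on $\mathrm{SYT}(\lambda)$: for $T\ne S$, let $k$ be the largest entry lying in different rows in $T$ and $S$; then $T<S$ iff $k$ lies in a lower row (larger row index) in $T$ than in $S$. Write $T_1<T_2<\dots$ for the tableaux in this order and $\pi^\lambda(\sigma)_{i,j}=\pi^\lambda(\sigma)_{T_i,T_j}$. Partial trace: $PT^\lambda_u(\sigma):=\sum_{i\le u\dim\lambda}\pi^\lambda(\sigma)_{i,i}/\dim\lambda$. The Plancherel measure $P^n_{PL}$ gives $\lambda\vdash n$ probability $(\dim\lambda)^2/n!$.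 $m_k(\rho)$ is the number of parts of $\rho$ equal to $k$ and $\mathrm{wt}(\rho)=|\rho|-m_1(\rho)$. $\mathcal H_m$ are the Hermite polynomials given by $x\mathcal H_m(x)=\mathcal H_{m+1}(x)+m\mathcal H_{m-1}(x)$, $\mathcal H_0=1$, $\mathcal H_1(x)=x$. *)

(* Defs.v *)
From HB Require Import structures.
From mathcomp Require Import all_boot all_order all_algebra all_fingroup.
From mathcomp Require Import all_classical all_reals all_analysis.

Set Implicit Arguments.
Unset Strict Implicit.
Unset Printing Implicit Defensive.

Import Order.TTheory GRing.Theory Num.Theory.
Import numFieldNormedType.Exports.

Local Open Scope classical_set_scope.
Local Open Scope ring_scope.

(* Rows, columns and tableau entries are numbered from 0: the entry k + 1 of a
   tableau of size n is represented by the ordinal k : 'I_n. *)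

(* A partition of n is the weakly decreasing n-tuple of its parts, padded with
   zeros; this makes the partitions of n a finite type. *)
Record intpart (n : nat) := IntPart {
  parts :> n.-tuple 'I_n.+1;
  _ : sorted geq (map val parts) && (sumn (map val parts) == n) }.

HB.instance Definition _ n := [isSub for @parts n].
HB.instance Definition _ n := [Finite of intpart n by <:].

Definition part n (lam : intpart n) (b : nat) : nat := nth 0%N (map val lam) b.

Definition part_sub m n (mu : intpart m) (lam : intpart n) : bool :=
  [forall b : 'I_m, (part mu b <= part lam b)%N].

(* A box is a pair (row, column). *)
Definition in_diagram n (lam : intpart n) (x : 'I_n * 'I_n) : bool :=
  (x.2 < part lam x.1)%N.

Definition content n (x : 'I_n * 'I_n) : int := x.2%:Z - x.1%:Z.

(* A filling is given by the function sending each entry to its box; since lam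
   has n boxes, an injective such function is a bijection onto the diagram. *)
Definition standard n (lam : intpart n) (T : {ffun 'I_n -> 'I_n * 'I_n}) : bool :=
  [&& injectiveb T,
      [forall k, in_diagram lam (T k)],
      [forall k, forall l, ((T k).1 == (T l).1) && ((T k).2 < (T l).2)%N
                             ==> (k < l)%N] &
      [forall k, forall l, ((T k).2 == (T l).2) && ((T k).1 < (T l).1)%N
                             ==> (k < l)%N]].

Record syt n (lam : intpart n) := Syt {
  boxof :> {ffun 'I_n -> 'I_n * 'I_n};
  _ : standard lam boxof }.

HB.instance Definition _ n (lam : intpart n) := [isSub for @boxof n lam].
HB.instance Definition _ n (lam : intpart n) := [Finite of syt lam by <:].

Definition dim n (lam : intpart n) : nat := #|{: syt lam}|.

Definition ll_lt n (lam : intpart n) (T S : syt lam) : bool :=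
  [exists k, ((S k).1 < (T k).1)%N &&
    [forall l : 'I_n, (k < l)%N ==> ((T l).1 == (S l).1)]].

Definition ll_le n (lam : intpart n) (T S : syt lam) : bool :=
  (T == S) || ll_lt T S.

Definition syt_enum n (lam : intpart n) : (dim lam).-tuple (syt lam) :=
  sort_tuple (@ll_le n lam) (enum_tuple {: syt lam}).

(* Adjacent transpositions of 'S_n are indexed by 'I_n.-1. *)
Lemma ltn_pred_succ n (k : 'I_n.-1) : (k.+1 < n)%N.
Proof. by case: n k => [[]|n k] //=; rewrite ltnS ltn_ord. Qed.

Definition lowI n (k : 'I_n.-1) : 'I_n := widen_ord (leq_pred n) k.
Definition highI n (k : 'I_n.-1) : 'I_n := Ordinal (ltn_pred_succ k).

Definition adj n (k : 'I_n.-1) : 'S_n := tperm (lowI k) (highI k).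

(* The permutation adj k1 o adj k2 o ... for w = [:: k1; k2; ...], composed
   from right to left; in 'S_n, (s * t) x = t (s x). *)
Definition adj_word n (w : seq 'I_n.-1) : 'S_n :=
  foldr (fun k s => (s * adj k)%g) 1%g w.

Lemma adj_word_cat n (v w : seq 'I_n.-1) :
  adj_word (v ++ w) = (adj_word w * adj_word v)%g.
Proof.
by elim: v => [|k v IH] /=; rewrite ?mulg1 // IH mulgA.
Qed.

Lemma adj_word_tperm n (d : nat) (i j : 'I_n) :
  (j = i + d :> nat)%N -> exists w : seq 'I_n.-1, adj_word w = tperm i j.
Proof.
elim: d i j => [|d IH] i j ij.
  have -> : j = i by apply/val_inj; rewrite /= ij addn0.
  by exists [::]; rewrite tperm1.
have kn : (i + d < n.-1)%N by rewrite ltn_predRL -addnS -ij.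
have [k kE] : exists k : 'I_n.-1, val k = (i + d)%N by exists (Ordinal kn).
have kj : highI k = j by apply/val_inj; rewrite /= kE ij addnS.
case: d IH ij kn kE => [|d] IH ij kn kE.
  have ki : lowI k = i by apply/val_inj; rewrite /= kE addn0.
  by exists [:: k]; rewrite /= mul1g /adj kj ki.
have [w wE] := IH i (lowI k) kE.
exists ([:: k] ++ w ++ [:: k]).
have adjV : (adj k)^-1%g = adj k by exact: tpermV.
have ne1 : highI k != i.
  apply/eqP => /(congr1 val) /= /eqP.
  by rewrite kE -addnS -[X in _ == X]addn0 eqn_add2l.
have ne2 : lowI k != i.
  by apply/eqP => /(congr1 val) /= /eqP; rewrite kE -[X in _ == X]addn0 eqn_add2l.
rewrite !adj_word_cat wE /= !mul1g -mulgA -{1}adjV -conjgE tpermJ.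
by rewrite /adj tpermL tpermD // kj.
Qed.

Lemma adj_wordP n (s : 'S_n) : exists w : seq 'I_n.-1, adj_word w == s.
Proof.
have [ts -> _] := prod_tpermP s.
elim/big_rec: _ => [|[i j] t _ [w /eqP <-]]; first by exists [::].
have [v ->] : exists v : seq 'I_n.-1, tperm (i, j).1 (i, j).2 = adj_word v.
  case: (leqP i j) => [ij|/ltnW ij] /=.
    by have [|v <-] := @adj_word_tperm n (j - i) i j; [rewrite subnKC | exists v].
  rewrite tpermC.
  by have [|v <-] := @adj_word_tperm n (i - j) j i; [rewrite subnKC | exists v].
by exists (w ++ v); rewrite adj_word_cat.
Qed.

Section YoungOrthogonalForm.
Context {R : realType}.

Definition axdist n (lam : intpart n) (T : syt lam) (k : 'I_n.-1) : int :=
  content (T (highI k)) - content (T (lowI k)).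

(* If k and k + 1 share a row or a column of T, exchanging them does not yield
   a standard tableau, so no S meets the second condition. *)
Definition young_entry n (lam : intpart n) (k : 'I_n.-1) (T S : syt lam) : R :=
  if S == T then ((axdist T k)%:~R)^-1
  else if val S == [ffun i => T (adj k i)] then
    Num.sqrt (1 - ((axdist T k)%:~R ^+ 2)^-1)
  else 0.

Definition young_gen n (lam : intpart n) (k : 'I_n.-1) : 'M[R]_(dim lam) :=
  \matrix_(i, j) young_entry k (tnth (syt_enum lam) i) (tnth (syt_enum lam) j).

(* The multiplicative extension: since the matrices young_gen satisfy the
   Coxeter relations, the product does not depend on the word chosen for s. *)
Definition young_rep n (lam : intpart n) (s : 'S_n) : 'M[R]_(dim lam) :=
  foldr (fun k A => young_gen lam k *m A) 1%:M (xchoose (adj_wordP s)).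

Definition partial_trace n (lam : intpart n) (u : R) (s : 'S_n) : R :=
  \sum_(i < dim lam | (i.+1%:R : R) <= u * (dim lam)%:R)
    young_rep lam s i i / (dim lam)%:R.

End YoungOrthogonalForm.

(* The image of s : 'S_r in 'S_n, fixing the points r, ..., n - 1, for r <= n;
   when n < r the value is irrelevant. *)
Definition extend_fun r n (s : 'S_r) (i : 'I_n) : 'I_n :=
  if insub (val i) is Some j then insubd i (val (s j)) else i.

Definition extend r n (s : 'S_r) : 'S_n :=
  insubd (1%g : 'S_n) [ffun i => extend_fun s i].

Lemma extendE r n (s : 'S_r) (i : 'I_n) : (r <= n)%N ->
  extend n s i = extend_fun s i.
Proof.
move=> rn; pose f : {ffun 'I_n -> 'I_n} := [ffun i => extend_fun s i].
have fE j : val (f j) = if insub (val j) is Some k then val (s k) else val j.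
  rewrite ffunE /extend_fun; case: insubP => [k kr kE|//].
  by rewrite val_insubd (leq_trans (ltn_ord _) rn).
have f_inj : injectiveb f.
  apply/injectiveP => a b /(congr1 val); rewrite !fE.
  case: insubP => [k kr kE|ar]; case: insubP => [l lr lE|br].
  - move=> /val_inj /perm_inj kl; apply: val_inj.
    by rewrite -[LHS]kE -[RHS]lE kl.
  - by move=> E; rewrite -E ltn_ord in br.
  - by move=> E; rewrite E ltn_ord in ar.
  - exact: val_inj.
by rewrite -pvalE /extend val_insubd f_inj ffunE.
Qed.

Definition cycle_type r (s : 'S_r) : seq nat :=
  sort geq [seq #|pred_of_set c| | c <- enum (porbits s)].

Definition multiplicity (k : nat) (rho : seq nat) : nat := count_mem k rho.

Definition wt (rho : seq nat) : nat := (sumn rho - multiplicity 1 rho)%N.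

Section Probability.
Context {R : realType}.

Fixpoint hermite (m : nat) : {poly R} :=
  match m with
  | 0%N => 1
  | 1%N => 'X
  | (m'.+1 as p).+1 => 'X * hermite p - (p%:R : R) *: hermite m'
  end.

Definition plancherel n (lam : intpart n) : R := (dim lam)%:R ^+ 2 / (n`!)%:R.

Definition plancherel_prob n (A : pred (intpart n)) : R :=
  \sum_(lam | A lam) plancherel lam.

(* The ratios are nonnegative, so starting the maximum at 0 is harmless. When
   n < s, truncated subtraction makes n - s equal to 0, which does not affect
   limits as n tends to infinity. *)
Definition max_dim_ratio (s : nat) n (lam : intpart n) : R :=
  \big[Num.max/0]_(mu : intpart (n - s) | part_sub mu lam)
    ((dim mu)%:R / (dim lam)%:R).

Definition mutually_independent d (T : measurableType d) (P : probability T R)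
    (D : set nat) (X : nat -> {RV P >-> R}) : Prop :=
  forall (J : seq nat), uniq J -> [set` J] `<=` D ->
  forall A : nat -> set R, (forall k, measurable (A k)) ->
  P (\bigcap_(k in [set` J]) (X k @^-1` A k)) =
    (\prod_(k <- J) P (X k @^-1` A k))%E.

Definition standard_gaussian d (T : measurableType d) (P : probability T R)
    (X : {RV P >-> R}) : Prop :=
  forall A : set R, measurable A -> distribution P X A = normal_prob 0 1 A.

(* Convergence in distribution, as n tends to infinity, of X n lam with lam a
   Plancherel random partition of n, to the random vector Y. *)
Definition plancherel_cvg_law m (X : forall n, intpart n -> 'rV[R]_m)
    d (T : measurableType d) (P : probability T R) (Y : T -> 'rV[R]_m) : Prop :=
  forall f : 'rV[R]_m -> R, continuous f -> (exists M : R, forall x, `|f x| <= M) ->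
  (fun n => \sum_(lam : intpart n) plancherel lam * f (X n lam)) @ \oo
    --> (\int[P]_w f (Y w))%R.

Definition plancherel_cvg_findim (X : nat -> forall n, intpart n -> R)
    d (T : measurableType d) (P : probability T R) (Y : nat -> T -> R) : Prop :=
  forall m (idx : 'I_m -> nat),
  plancherel_cvg_law (fun n lam => \row_j X (idx j) n lam)
    P (fun w => \row_j Y (idx j) w).

End Probability.

(* Main.v *)
(* Let chi(s) be the normalized character of lambda at s and X_s = n^(w/2) chi(s),
   where w is the number of points moved by s.  Column orthogonality gives
   E chi(s) = [s = 1] under the Plancherel measure, and chi(g) chi(h) is the
   average of chi(g h^x) over the conjugating permutation x.  Sorting x by the
   overlap of the supports, only two cases matter when g is a k-cycle: no overlap,
   or g cancels one of the k-cycles of h^x.  This is the Hermite recurrence, so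
   X_s is close in mean square to the product of the k^(m/2) H_m(V_k), where s has
   m k-cycles and V_k = X_(k-cycle) / sqrt k, and the joint moments of the V_k tend
   to those of independent standard Gaussians.  Gaussian laws are determined by
   their moments: trigonometric polynomials, and then indicators of half-lines, are
   sandwiched between polynomials whose difference has small Gaussian mean.
   For the partial trace, the tableaux that agree on the last q entries are
   consecutive in the last letter order, and their number divided by dim lambda is
   at most the ratio controlled by the hypothesis.  By Schur's lemma the trace of
   s over such a block is governed by the centre of the algebra of S_(n - q); the
   mean square over blocks of the normalized block traces equals the probability
   that a random element of S_(n - q) conjugates s to its inverse.  Hence the block
   traces are within o(n^(-w/2)) of chi(s) in mean square, and n^(w/2) PT_u(s) is
   close to u X_s in probability. *)

Require Import Defs.
From HB Require Import structures.
From mathcomp Require Import all_boot all_order all_algebra all_fingroup.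
From mathcomp Require Import all_classical all_reals all_analysis.
From mathcomp Require Import measurable_realfun.
From mathcomp Require Import zify ring lra.

Set Implicit Arguments.
Unset Strict Implicit.
Unset Printing Implicit Defensive.

Import Order.TTheory GRing.Theory Num.Theory.
Import numFieldNormedType.Exports.

Local Open Scope ring_scope.

(** * Young's orthogonal form *)

(** [young_rep] picks an arbitrary word for each permutation, so everything rests on showing that
    the choice is immaterial. The normal form behind this also shows that permutations of S_m act
    through the generators of S_m, which produces the blocks. Schur's lemma is obtained without a
    theory of irreducible modules: the content matrices are the Jucys-Murphy elements, polynomials
    in the generators, and contents determine a tableau. Limits are taken in a calculus of finite
    combinations of the X_s. If the coefficients tend to 0, so does the mean, since the mean of X_s
    is [s = 1]; and multiplying by any X_s preserves such errors. The number q of removed entries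
    satisfies alpha q >= w/2 + 1, so that one block is negligible even after scaling by n^(w/2).
    After scaling, the mean squares at levels n - q and n have the same limit, hence the variance of
    the block traces vanishes by subtraction. Since the V_k are unbounded, test functions are
    controlled on a large box, and the mass outside it is bounded separately. *)

Section Tableaux.
Variables (n : nat) (lam : intpart n).
Implicit Types (T S : syt lam) (k l : 'I_n).

Lemma part_anti (b c : nat) : (b <= c)%N -> (part lam c <= part lam b)%N.
Proof.
move=> bc; have /andP[srt _] := valP lam; rewrite /part.
have [cn|nc] := ltnP c (size (map val lam)); last by rewrite nth_default.
apply: (sorted_leq_nth _ _ 0%N srt) => //.
- by move=> x y z /= yx zy; exact: leq_trans yx.
- by move=> x /=.
- by rewrite inE; exact: leq_ltn_trans cn.
Qed.

Lemma sum_part : (\sum_(b < n) part lam b)%N = n.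
Proof.
have /andP[_ /eqP st] := valP lam; rewrite /part -[RHS]st.
rewrite sumnE big_map big_tuple; apply: eq_bigr => i _.
by rewrite (nth_map ord0) ?size_tuple // -tnth_nth.
Qed.

Lemma part_le (b : nat) : (part lam b <= n)%N.
Proof.
rewrite /part; have [bn|nb] := ltnP b (size (map val lam)); last by rewrite nth_default.
by rewrite size_map in bn; rewrite (nth_map ord0) // -ltnS ltn_ord.
Qed.

Lemma card_diagram : #|[pred x | in_diagram lam x]| = n.
Proof.
rewrite -sum1_card /= -[RHS]sum_part.
rewrite (eq_bigl (fun x : 'I_n * 'I_n => true && (x.2 < part lam x.1)%N)) //.
rewrite -(pair_big_dep xpredT (fun b a : 'I_n => (a < part lam b)%N) (fun _ _ => 1%N)) /=.
apply: eq_bigr => b _.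
rewrite (eq_bigl (fun a : 'I_n => (a < part lam b)%N)) //.
by rewrite -(big_ord_widen n (fun=> 1%N)) ?part_le // sum1_card card_ord.
Qed.

Lemma syt_inj T : injective T.
Proof. by case: T => t /= /and4P[/injectiveP]. Qed.

Lemma syt_diagram T k : in_diagram lam (T k).
Proof. by case: T => t /= /and4P[_ /forallP]. Qed.

Lemma syt_row T k l : (T k).1 = (T l).1 -> ((T k).2 < (T l).2)%N -> (k < l)%N.
Proof.
case: T => t /= /and4P[_ _ /forallP /(_ k)/forallP/(_ l) /implyP H _] e h.
by apply: H; rewrite e eqxx.
Qed.

Lemma syt_col T k l : (T k).2 = (T l).2 -> ((T k).1 < (T l).1)%N -> (k < l)%N.
Proof.
case: T => t /= /and4P[_ _ _ /forallP /(_ k)/forallP/(_ l) /implyP H] e h.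
by apply: H; rewrite e eqxx.
Qed.

Lemma syt_onto T (x : 'I_n * 'I_n) : in_diagram lam x -> exists k : 'I_n, T k = x.
Proof.
move=> dx.
have sub : [set T k | k in 'I_n] = [set x | in_diagram lam x].
  apply/eqP; rewrite eqEcard; apply/andP; split.
    by apply/fintype.subsetP => _ /imsetP[k _ ->]; rewrite inE syt_diagram.
  by rewrite card_imset ?card_ord ?cardsE ?card_diagram //; exact: syt_inj.
have : x \in [set T k | k in 'I_n] by rewrite sub inE.
by case/imsetP => k _ ->; exists k.
Qed.

(** The box in the row of k and the column of l belongs to the diagram because row lengths decrease;
    its entry is at least k along the row and at most l along the column. *)
Lemma syt_le T k l :
  ((T k).1 <= (T l).1)%N -> ((T k).2 <= (T l).2)%N -> (k <= l)%N.
Proof.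
move=> h1 h2.
have [m Tm] : exists m : 'I_n, T m = ((T k).1, (T l).2).
  apply: syt_onto; rewrite /in_diagram /=.
  by have := syt_diagram T l; rewrite /in_diagram => /leq_trans; apply; exact: part_anti.
have km : (k <= m)%N.
  move: h2; rewrite leq_eqVlt => /orP[/eqP e|lt].
    have -> // : k = m; apply: (@syt_inj T); rewrite Tm [LHS]surjective_pairing.
    by congr pair; exact: val_inj.
  by apply/ltnW/(@syt_row T); rewrite Tm.
have ml : (m <= l)%N.
  move: h1; rewrite leq_eqVlt => /orP[/eqP e|lt].
    have -> // : m = l; apply: (@syt_inj T); rewrite Tm [RHS]surjective_pairing.
    by congr pair; exact: val_inj.
  by apply/ltnW/(@syt_col T); rewrite Tm.
exact: leq_trans ml.
Qed.

Lemma syt_eq2 T k l : (T k).1 = (T l).1 :> nat -> (T k).2 = (T l).2 :> nat -> k = l.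
Proof.
move=> e1 e2; apply: (@syt_inj T); rewrite [LHS]surjective_pairing [RHS]surjective_pairing.
by congr pair; exact: val_inj.
Qed.

(* Two entries on one diagonal have both remaining corners of a 2 x 2 square
   between them. *)
Lemma syt_content_far T k l : (k < l)%N -> Defs.content (T k) = Defs.content (T l) -> (k.+2 < l)%N.
Proof.
move=> kl; rewrite /Defs.content => ce.
have ne : ~~ ((T l).1 <= (T k).1)%N.
  apply/negP => h; have : (l <= k)%N by apply: (@syt_le T) => //; lia.
  by lia.
have r1 := ltn_ord (T l).1; have r2 := ltn_ord (T l).2.
have dl := syt_diagram T l; rewrite /in_diagram in dl.
(* The default of [insubd] is not reached: equal contents put l strictly below and strictly to the
   right of k, so the successor stays below n. *)
have [m Tm] : exists m : 'I_n, T m = ((T k).1, insubd (T l).2 ((T k).2.+1)).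
  apply: syt_onto; rewrite /in_diagram /= val_insubd.
  by have := @part_anti (T k).1 (T l).1; case: ifP => ?; lia.
have [m' Tm'] : exists m : 'I_n, T m = (insubd (T l).1 ((T k).1.+1), (T k).2).
  apply: syt_onto; rewrite /in_diagram /= val_insubd.
  case: ifP => lt; last by lia.
  by have := @part_anti (T k).1.+1 (T l).1; lia.
have v1 : (T m).1 = (T k).1 by rewrite Tm.
have v2 : (T m).2 = (T k).2.+1 :> nat by rewrite Tm /= val_insubd; case: ifP => //; lia.
have w1 : (T m').1 = (T k).1.+1 :> nat by rewrite Tm' /= val_insubd; case: ifP => //; lia.
have w2 : (T m').2 = (T k).2 by rewrite Tm'.
have km : (k < m)%N by apply: (@syt_row T); rewrite ?v1 // v2.
have km' : (k < m')%N by apply: (@syt_col T); rewrite ?w2 // w1.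
have ml : (m <= l)%N by apply: (@syt_le T); rewrite ?v1 ?v2; lia.
have ml' : (m' <= l)%N by apply: (@syt_le T); rewrite ?w1 ?w2; lia.
have neml : m != l :> nat by apply/eqP => /val_inj e; move: v1; rewrite e => /(congr1 val) /=; lia.
have neml' : m' != l :> nat by apply/eqP => /val_inj e; move: w2; rewrite e => /(congr1 val) /=; lia.
have nemm : m != m' :> nat by apply/eqP => /val_inj e; move: w1; rewrite -e v1; lia.
by lia.
Qed.

Lemma axdist_neq0 T (k : 'I_n.-1) : axdist T k != 0.
Proof.
rewrite /axdist subr_eq0; apply/eqP => e.
by have := @syt_content_far T (lowI k) (highI k) _ (esym e) => /=; lia.
Qed.

Definition swap (F : {ffun 'I_n -> 'I_n * 'I_n}) (k : 'I_n.-1) :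
  {ffun 'I_n -> 'I_n * 'I_n} := [ffun i => F (adj k i)].

Lemma adjE (k : 'I_n.-1) (i : 'I_n) :
  adj k i = (if i == k :> nat then k.+1 else if i == k.+1 :> nat then nat_of_ord k else i) :> nat.
Proof.
rewrite /adj; case: tpermP => [->|->|/eqP h1 /eqP h2] /=; first by rewrite eqxx.
  by rewrite gtn_eqF // eqxx.
have -> : (i == k :> nat) = false.
  by apply/negbTE; apply: contra h1 => /eqP e; apply/eqP/val_inj.
suff -> : (i == k.+1 :> nat) = false by [].
by apply/negbTE; apply: contra h2 => /eqP e; apply/eqP/val_inj.
Qed.

(** Exchanging k and k + 1 can only break the order between these two entries, when they share a row
    or a column. The box next to that of k in this line then has an entry above k and at most k + 1,
    so the two boxes are adjacent and the axial distance is 1 or -1. *)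
Lemma swap_standard T (k : 'I_n.-1) :
  `|axdist T k| != 1 -> standard lam (swap T k).
Proof.
move=> d1.
have key (i j : 'I_n) : (T i).1 = (T j).1 \/ (T i).2 = (T j).2 -> (i < j)%N ->
    ~~ ((i == lowI k) && (j == highI k)).
  move=> rc ij; apply/negP => /andP[/eqP ei /eqP ej]; subst i j.
  move/negP: d1; apply; apply/eqP; rewrite /axdist /Defs.content.
  have kk : val (lowI k) = k by [].
  have kk' : val (highI k) = k.+1 by [].
  case: rc => e.
  - have lt : ((T (lowI k)).2 < (T (highI k)).2)%N.
      rewrite ltnNge; apply/negP => h.
      by have := @syt_le T (highI k) (lowI k); rewrite e /= => /(_ (leqnn _) h); lia.
    have d2 := syt_diagram T (highI k); rewrite /in_diagram -e in d2.
    have b2 := ltn_ord (T (highI k)).2.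
    have [m Tm] : exists m : 'I_n, T m = ((T (lowI k)).1, insubd (T (highI k)).2 ((T (lowI k)).2.+1)).
      by apply: syt_onto; rewrite /in_diagram /= val_insubd; case: ifP; lia.
    have v2 : (T m).2 = (T (lowI k)).2.+1 :> nat by rewrite Tm /= val_insubd; case: ifP => //; lia.
    have lm : (lowI k < m)%N by apply: (@syt_row T); rewrite ?Tm // -Tm v2.
    have mh : (m <= highI k)%N by apply: (@syt_le T); rewrite ?v2 // Tm e.
    have em : m = highI k by apply: val_inj => /=; move: lm mh => /=; lia.
    by move: v2; rewrite em e => ->; lia.
  - have lt : ((T (lowI k)).1 < (T (highI k)).1)%N.
      rewrite ltnNge; apply/negP => h.
      by have := @syt_le T (highI k) (lowI k) h; rewrite e /= => /(_ (leqnn _)); lia.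
    have d2 := syt_diagram T (highI k); rewrite /in_diagram -e in d2.
    have b2 := ltn_ord (T (highI k)).1.
    have [m Tm] : exists m : 'I_n, T m = (insubd (T (highI k)).1 ((T (lowI k)).1.+1), (T (lowI k)).2).
      apply: syt_onto; rewrite /in_diagram /= val_insubd; case: ifP => // _.
      exact: leq_trans d2 (part_anti lt).
    have v2 : (T m).1 = (T (lowI k)).1.+1 :> nat by rewrite Tm /= val_insubd; case: ifP => //; lia.
    have lm : (lowI k < m)%N by apply: (@syt_col T); rewrite ?Tm // -Tm v2.
    have mh : (m <= highI k)%N by apply: (@syt_le T); rewrite ?v2 // Tm e.
    have em : m = highI k by apply: val_inj => /=; move: lm mh => /=; lia.
    by move: v2; rewrite em e => ->; lia.
have mono (i j : 'I_n) : (i < j)%N -> ~~ ((i == lowI k) && (j == highI k)) ->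
    (adj k i < adj k j)%N.
  move=> ij /negP ne.
  have {}ne : ~ (i = k :> nat /\ j = k.+1 :> nat).
    by case=> ei ej; apply: ne; apply/andP; split; apply/eqP/val_inj.
  rewrite (adjE k i) (adjE k j).
  by move: ne; rewrite /=; do ?[case: ifP => /eqP ?]; lia.
have monoV (i j : 'I_n) : (T (adj k i)).1 = (T (adj k j)).1 \/ (T (adj k i)).2 = (T (adj k j)).2 ->
    (adj k i < adj k j)%N -> (i < j)%N.
  move=> /key ke lt; have := mono _ _ lt (ke lt).
  by rewrite /adj !tpermK.
apply/and4P; split.
- by apply/injectiveP => i j; rewrite !ffunE => /syt_inj /perm_inj.
- by apply/forallP => i; rewrite ffunE syt_diagram.
- apply/forallP => i; apply/forallP => j; apply/implyP; rewrite !ffunE => /andP[/eqP e lt].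
  by apply: monoV; [left | exact: (syt_row e lt)].
- apply/forallP => i; apply/forallP => j; apply/implyP; rewrite !ffunE => /andP[/eqP e lt].
  by apply: monoV; [right | exact: (syt_col e lt)].
Qed.

(** Two boxes whose contents differ by 1 are weakly comparable in rows and columns simultaneously,
    so every standard filling prescribes which of them holds the smaller entry; T and its exchange
    would disagree on this. *)
Lemma swap_axdist T (k : 'I_n.-1) : standard lam (swap T k) -> `|axdist T k| != 1.
Proof.
move=> st; pose S := Syt st; apply/negP => /eqP d1.
have kk : val (lowI k) = k by [].
have kk' : val (highI k) = k.+1 by [].
have e1 : S (lowI k) = T (highI k) by rewrite /= ffunE /adj tpermL.
have e2 : S (highI k) = T (lowI k) by rewrite /= ffunE /adj tpermR.
have h1 := @syt_le T (highI k) (lowI k).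
have h2 := @syt_le S (highI k) (lowI k).
rewrite e1 e2 in h2.
have {}h1 : ~~ (((T (highI k)).1 <= (T (lowI k)).1) && ((T (highI k)).2 <= (T (lowI k)).2))%N.
  by apply/negP => /andP[a b]; have := h1 a b; rewrite kk kk'; lia.
have {}h2 : ~~ (((T (lowI k)).1 <= (T (highI k)).1) && ((T (lowI k)).2 <= (T (highI k)).2))%N.
  by apply/negP => /andP[a b]; have := h2 a b; rewrite kk kk'; lia.
have {d1} [d1|d1] : axdist T k = 1 \/ axdist T k = -1 by move: d1; clear; lia.
  by move: d1 h1 h2; rewrite /axdist /Defs.content; clear; lia.
by move: d1 h1 h2; rewrite /axdist /Defs.content; clear; lia.
Qed.

Lemma swapK (F : {ffun 'I_n -> 'I_n * 'I_n}) (k : 'I_n.-1) : swap (swap F k) k = F.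
Proof. by apply/ffunP => i; rewrite !ffunE /adj tpermK. Qed.

End Tableaux.

(** * Normal form of words in the Coxeter generators *)

Section Coxeter.
Variables (N : nat) (E : seq nat -> seq nat -> Prop).
Hypothesis Erefl : forall w, E w w.
Hypothesis Etrans : forall u v w, E u v -> E v w -> E u w.
Hypothesis Ecat : forall u u' v v', E u u' -> E v v' -> E (u ++ v) (u' ++ v').
Hypothesis Einv : forall k, (k < N)%N -> E [:: k; k] [::].
Hypothesis Ecomm : forall k l, (k < N)%N -> (l < N)%N -> (k.+1 < l)%N || (l.+1 < k)%N ->
  E [:: k; l] [:: l; k].
Hypothesis Ebraid : forall k, (k.+1 < N)%N -> E [:: k; k.+1; k] [:: k.+1; k; k.+1].
Hypothesis Ebraid' : forall k, (k.+1 < N)%N -> E [:: k.+1; k; k.+1] [:: k; k.+1; k].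

Definition down (m j : nat) : seq nat := rev (iota j (m - j)).

Lemma downn m : down m m = [::]. Proof. by rewrite /down subnn. Qed.

Lemma down_rcons m j : (j < m)%N -> down m j = rcons (down m j.+1) j.
Proof. by move=> jm; rewrite /down subnS -{1}(@prednK (m - j)) ?subn_gt0 //= rev_cons. Qed.

Lemma down_cat m i j : (j <= i)%N -> (i <= m)%N -> down m j = down m i ++ down i j.
Proof.
move=> ji im; rewrite /down -rev_cat -{2}(subnKC ji).
by rewrite -iotaD; congr (rev (iota _ _)); lia.
Qed.

Lemma mem_down m j i : (i \in down m j) = (j <= i < m)%N.
Proof. by rewrite mem_rev mem_iota; lia. Qed.

Lemma E_commute i w : (i < N)%N ->
  {in w, forall k, (k < N)%N && ((k.+1 < i) || (i.+1 < k))%N} ->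
  E (rcons w i) (i :: w).
Proof.
move=> iN; elim: w => [|k w IH] h /=; first exact: Erefl.
have {}IH : E (rcons w i) (i :: w).
  by apply: IH => x xw; apply: h; rewrite inE xw orbT.
have /andP[kN ki] := h k (mem_head _ _).
apply: (Etrans (Ecat (Erefl [:: k]) IH)).
exact: (@Ecat [:: k; i] [:: i; k] w w (Ecomm kN iN ki) (Erefl w)).
Qed.

(** The descending runs are coset representatives of S_m in S_(m+1). A letter i appended to the run
    from m - 1 down to j commutes to the front if i < j - 1, lengthens the run if i = j - 1, and
    cancels its end if i = j. If i > j, a braid move lets it pass through the run, and it comes out
    on the left as i - 1. *)
Lemma coxeter_nf m w : (m <= N)%N -> all (fun k => k < m)%N w ->
  exists w' j, [/\ all (fun k => k < m.-1)%N w', (j <= m)%N & E w (w' ++ down m j)].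
Proof.
case: m => [|m] mN.
  by case: w => // _; exists [::], 0%N; split => //; exact: Erefl.
elim/last_ind: w => [|w i IH].
  by move=> _; exists [::], m.+1; split => //; rewrite downn; exact: Erefl.
rewrite all_rcons => /andP[im /IH[w' [j [w'm jm Ew]]]].
have {}Ew : E (rcons w i) (w' ++ rcons (down m.+1 j) i).
  by rewrite -!cats1 catA; exact: Ecat.
suff [v [j' [vm j'm Ev]]] : exists v j', [/\ all (fun k => k < m)%N v, (j' <= m.+1)%N &
    E (rcons (down m.+1 j) i) (v ++ down m.+1 j')].
  exists (w' ++ v), j'; split => //; first by rewrite all_cat w'm.
  by rewrite -catA; exact: Etrans Ew (Ecat (Erefl _) Ev).
have [lt|] := ltnP i.+1 j.
  exists [:: i], j; split => //=; first by rewrite andbT; lia.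
  by apply: E_commute => [|k]; rewrite ?mem_down; lia.
rewrite leq_eqVlt => /orP[/eqP e|].
  exists [::], i; split => //=; first by lia.
  by rewrite e -down_rcons //; exact: Erefl.
rewrite ltnS leq_eqVlt => /orP[/eqP e|ji].
  exists [::], j.+1; split => //=; first by lia.
  rewrite down_rcons -?e -?cats1; last by lia.
  rewrite -catA -[X in E _ X]cats0; apply: Ecat => //=; apply: Einv; lia.
case: i im ji {Ew} => // i im ji; exists [:: i], j; split => //=; first by rewrite andbT.
rewrite ltnS in ji.
have dE : down m.+1 j = down m.+1 i.+2 ++ [:: i.+1; i] ++ down i j.
  rewrite (@down_cat m.+1 i.+2) //; last by lia.
  rewrite (@down_cat i.+2 i) //; last by lia.
  suff -> : down i.+2 i = [:: i.+1; i] by [].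
  by rewrite /down (_ : i.+2 - i = 2)%N //; lia.
rewrite dE -cats1 -!catA.
apply: (@Etrans _ (down m.+1 i.+2 ++ [:: i.+1; i; i.+1] ++ down i j)).
  apply: Ecat => //; apply: (@Ecat [:: i.+1; i] [:: i.+1; i]) => //.
  by rewrite cats1; apply: E_commute => [|k]; rewrite ?mem_down; lia.
apply: (@Etrans _ (down m.+1 i.+2 ++ [:: i; i.+1; i] ++ down i j)).
  apply: Ecat => //; apply: Ecat => //; apply: Ebraid'; lia.
rewrite [X in E X _](_ : _ = rcons (down m.+1 i.+2) i ++ [:: i.+1; i] ++ down i j); last first.
  by rewrite -cats1 -!catA.
apply: (@Ecat _ (i :: down m.+1 i.+2)) => //.
by apply: E_commute => [|k]; rewrite ?mem_down; lia.
Qed.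

End Coxeter.

(** * Coxeter relations for Young's orthogonal form *)

Section YoungForm.
Variables (R : realType) (n : nat) (lam : intpart n).
Local Notation filling := {ffun 'I_n -> 'I_n * 'I_n}.
Implicit Types (T S : syt lam) (k l : 'I_n.-1) (F : filling) (v : filling -> R).

Lemma syt_enum_mem T : T \in tval (syt_enum lam).
Proof. by rewrite /= mem_sort mem_enum. Qed.

Lemma syt_idx_subproof T : (index T (syt_enum lam) < Defs.dim lam)%N.
Proof. by rewrite -[X in (_ < X)%N](size_tuple (syt_enum lam)) index_mem syt_enum_mem. Qed.

Definition syt_idx T : 'I_(Defs.dim lam) := Ordinal (syt_idx_subproof T).

Lemma syt_idxK T : tnth (syt_enum lam) (syt_idx T) = T.
Proof. by rewrite (tnth_nth T) nth_index // syt_enum_mem. Qed.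

Lemma tnth_syt_idx i : syt_idx (tnth (syt_enum lam) i) = i.
Proof.
apply: val_inj; rewrite /= (tnth_nth (tnth (syt_enum lam) i)) index_uniq //.
  by rewrite size_tuple.
by rewrite sort_uniq enum_uniq.
Qed.

Lemma sum_syt (V : nmodType) (f : 'I_(Defs.dim lam) -> V) :
  \sum_i f i = \sum_T f (syt_idx T).
Proof.
apply: (reindex syt_idx); exists (tnth (syt_enum lam)) => i _.
  exact: syt_idxK.
exact: tnth_syt_idx.
Qed.

Definition cont F (i : 'I_n) : int := Defs.content (F i).

Definition invax F k : R := ((cont F (highI k) - cont F (lowI k))%:~R)^-1.

(* The Young orthogonal form acting on functions of arbitrary fillings; on
   standard fillings only its values on standard fillings matter. *)
Definition op k v F : R :=
  invax F k * v F + Num.sqrt (1 - invax F k ^+ 2) * v (swap F k).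

Lemma swap_neq T k : swap T k != T.
Proof.
apply/eqP => /ffunP/(_ (lowI k)); rewrite ffunE /adj tpermL => /syt_inj /(congr1 val) /=.
by lia.
Qed.

Definition extend_col p (M : 'M[R]_(Defs.dim lam, p)) j F : R :=
  if insub F is Some T then M (syt_idx T) j else 0.

Lemma extend_colE p (M : 'M[R]_(Defs.dim lam, p)) j T : extend_col M j T = M (syt_idx T) j.
Proof. by rewrite /extend_col valK. Qed.

Lemma young_gen_mul k p (M : 'M[R]_(Defs.dim lam, p)) T j :
  (young_gen lam k *m M) (syt_idx T) j = op k (extend_col M j) T.
Proof.
rewrite mxE sum_syt (bigD1 T) //= mxE !syt_idxK /young_entry eqxx /op extend_colE.
congr (_ + _).
have e S : S != T -> young_gen lam k (syt_idx T) (syt_idx S) =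
    if val S == swap T k then Num.sqrt (1 - invax T k ^+ 2) else 0.
  by move=> nST; rewrite mxE !syt_idxK /young_entry (negPf nST) exprVn.
rewrite (eq_bigr (fun S => (if val S == swap T k then Num.sqrt (1 - invax T k ^+ 2)
  else 0) * M (syt_idx S) j)); last by move=> S /e ->.
case st : (standard lam (swap T k)); last first.
  rewrite /extend_col insubF // mulr0 big1 // => S _.
  by case: eqP => [e'|_]; rewrite ?mul0r //; move: (valP S); rewrite e' /= st.
rewrite -[swap T k]/(val (Syt st)) extend_colE (bigD1 (Syt st)) /=; last first.
  by apply: contraNneq (swap_neq T k) => e'; rewrite -[swap T k]/(val (Syt st)) e'.
rewrite eqxx big1 ?addr0 // => S /andP[_ /eqP ne].
by case: eqP => [e'|]; rewrite ?mul0r //; case: ne; apply: val_inj.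
Qed.

Lemma invax_axdist T k : invax T k = ((axdist T k)%:~R)^-1.
Proof. by []. Qed.

(** If the exchanged filling is not standard, the axial distance is 1 or -1 and the coefficient
    under the square root vanishes; values at non-standard fillings therefore never enter. *)
Lemma op_ext k v w T : (forall S, v (val S) = w (val S)) -> op k v T = op k w T.
Proof.
move=> vw; rewrite /op (vw T).
case st : (standard lam (swap T k)); first by rewrite -[swap T k]/(val (Syt st)) (vw (Syt st)).
have /eqP d1 : `|axdist T k| == 1.
  by apply/negPn/negP => /swap_standard; rewrite st.
suff -> : invax T k ^+ 2 = 1 by rewrite subrr sqrtr0 !mul0r.
by rewrite invax_axdist exprVn -rmorphXn -(real_normK (num_real _)) d1 expr1n invr1.
Qed.

Definition invdiff (a b : int) : R := ((b - a)%:~R)^-1.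

Lemma invdiffC a b : invdiff b a = - invdiff a b.
Proof. by rewrite /invdiff -opprB rmorphN /= invrN. Qed.

Lemma sqr_sqrt_invdiff a b : a != b ->
  Num.sqrt (1 - invdiff a b ^+ 2) * Num.sqrt (1 - invdiff a b ^+ 2) = 1 - invdiff a b ^+ 2.
Proof.
move=> ab; rewrite -expr2 sqr_sqrtr // subr_ge0 /invdiff exprVn invf_le1.
  rewrite -rmorphXn /= -[1]/(1%:~R : R) ler_int.
  have : b - a != 0 by rewrite subr_eq0 eq_sym.
  by move: (b - a) => c; nia.
by rewrite exprn_even_gt0 //= intr_eq0 subr_eq0 eq_sym.
Qed.

(** The axial distances add up, c - a = (c - b) + (b - a). This identity between their inverses is
    what makes the braid relation hold. *)
Lemma invdiff_triangle a b c : a != b -> b != c -> a != c ->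
  invdiff a b * invdiff b c = invdiff a c * (invdiff a b + invdiff b c).
Proof.
move=> ab bc ac; rewrite /invdiff.
have -> : c - a = (c - b) + (b - a) by rewrite addrA subrK.
have h1 : (b - a)%:~R != 0 :> R by rewrite intr_eq0 subr_eq0 eq_sym.
have h2 : (c - b)%:~R != 0 :> R by rewrite intr_eq0 subr_eq0 eq_sym.
have : ((c - b) + (b - a))%:~R != 0 :> R by rewrite intr_eq0 addrA subrK subr_eq0 eq_sym.
rewrite rmorphD /=; move: h1 h2.
have key (x y : R) : x != 0 -> y != 0 -> y + x != 0 ->
    x^-1 * y^-1 = (y + x)^-1 * (x^-1 + y^-1).
  by move=> x0 y0 xy0; field; rewrite xy0 x0 y0.
exact: key.
Qed.

Lemma invaxE F k : invax F k = invdiff (cont F (lowI k)) (cont F (highI k)).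
Proof. by []. Qed.

Lemma cont_swap F k i : cont (swap F k) i = cont F (adj k i).
Proof. by rewrite /cont ffunE. Qed.

Lemma invax_swap F k : invax (swap F k) k = - invax F k.
Proof. by rewrite !invaxE !cont_swap /adj tpermL tpermR invdiffC. Qed.

Lemma opK v k F : cont F (lowI k) != cont F (highI k) -> op k (op k v) F = v F.
Proof.
move=> ne; rewrite /op invax_swap swapK sqrrN.
have := sqr_sqrt_invdiff ne; rewrite -invaxE.
set x := invax F k; set e := Num.sqrt _ => ee.
transitivity (x ^+ 2 * v F + (e * e) * v F); first by ring.
by rewrite ee; ring.
Qed.

Lemma adj_id k (i : 'I_n) : i != lowI k -> i != highI k -> adj k i = i.
Proof. by move=> h1 h2; rewrite /adj tpermD // eq_sym. Qed.

Lemma neq_nat (i j : 'I_n) : (i != j) = (val i != val j).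
Proof. by []. Qed.

Lemma adj_comm k l (i : 'I_n) : (k.+1 < l)%N || (l.+1 < k)%N -> adj k (adj l i) = adj l (adj k i).
Proof.
move=> kl; rewrite -!permM; congr (fun_of_perm _ i); apply/commgP/conjg_fixP.
by rewrite /adj tpermJ -!/(adj _) !adj_id // neq_nat /=; lia.
Qed.

Lemma adj_braid k l (i : 'I_n) : l = k.+1 :> nat ->
  adj k (adj l (adj k i)) = adj l (adj k (adj l i)).
Proof.
move=> lk; rewrite -!permM; congr (fun_of_perm _ i).
have hl : lowI l = highI k by apply: val_inj; rewrite /= lk.
have V m : (adj m)^-1%g = adj m by rewrite /adj tpermV.
rewrite !mulgA.
have -> : (adj k * adj l * adj k = adj l ^ adj k)%g by rewrite conjgE V mulgA.
have -> : (adj l * adj k * adj l = adj k ^ adj l)%g by rewrite conjgE V mulgA.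
transitivity (tperm (lowI k) (highI l)).
  rewrite [X in (X ^ _)%g]/adj tpermJ hl {1}/adj tpermR adj_id // neq_nat /=; lia.
rewrite [X in _ = (X ^ _)%g]/adj tpermJ -hl {2}/adj tpermL adj_id // neq_nat /=; lia.
Qed.

Lemma opC v k l F : (k.+1 < l)%N || (l.+1 < k)%N -> op k (op l v) F = op l (op k v) F.
Proof.
move=> kl; rewrite /op.
have -> : swap (swap F k) l = swap (swap F l) k.
  by apply/ffunP => i; rewrite !ffunE adj_comm.
have -> : invax (swap F k) l = invax F l.
  by rewrite !invaxE !cont_swap !adj_id // neq_nat /=; lia.
have -> : invax (swap F l) k = invax F k.
  by rewrite !invaxE !cont_swap !adj_id // neq_nat /=; lia.
by ring.
Qed.

(** Only the three contents of the entries k, k + 1, k + 2 matter, and they must be distinct. Both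
    sides expand over the six fillings obtained by permuting these entries, and the coefficients are
    compared modulo [invdiff_triangle] and the squares of the roots. *)
Lemma op_braid v k l F : l = k.+1 :> nat ->
  cont F (lowI k) != cont F (highI k) -> cont F (lowI l) != cont F (highI l) ->
  cont F (lowI k) != cont F (highI l) ->
  op k (op l (op k v)) F = op l (op k (op l v)) F.
Proof.
move=> lk; have hl : lowI l = highI k by apply: val_inj; rewrite /= lk.
rewrite hl; set a := cont F (lowI k); set b := cont F (highI k); set c := cont F (highI l).
move=> ab bc ac.
have k1 : adj k (lowI k) = highI k by rewrite /adj tpermL.
have k2 : adj k (highI k) = lowI k by rewrite /adj tpermR.
have k3 : adj k (highI l) = highI l by rewrite adj_id // neq_nat /=; lia.
have l1 : adj l (lowI k) = lowI k by rewrite adj_id // neq_nat /=; lia.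
have l2 : adj l (highI k) = highI l by rewrite -hl /adj tpermL.
have l3 : adj l (highI l) = highI k by rewrite -hl /adj tpermR.
have br : swap (swap (swap F l) k) l = swap (swap (swap F k) l) k.
  by apply/ffunP => i; rewrite !ffunE -(adj_braid _ lk).
rewrite /op br !swapK !invaxE hl !cont_swap !(k1, k2, k3, l1, l2, l3) -/a -/b -/c.
rewrite (invdiffC a b) (invdiffC b c) !sqrrN.
have ex := sqr_sqrt_invdiff ab; have ey := sqr_sqrt_invdiff bc.
have rel := invdiff_triangle ab bc ac.
move: ex ey rel; set x := invdiff a b; set y := invdiff b c; set z := invdiff a c.
set e1 := Num.sqrt (1 - x ^+ 2); set e2 := Num.sqrt (1 - y ^+ 2); set e3 := Num.sqrt (1 - z ^+ 2).
set v1 := v F; set vk := v (swap F k); set vl := v (swap F l).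
set vkl := v (swap (swap F k) l); set vlk := v (swap (swap F l) k).
set vklk := v _ => ex ey rel.
apply/eqP; rewrite -subr_eq0; apply/eqP.
(* The difference of the two sides is written explicitly in the ideal generated by the triangle
   relation and the two square-root relations. *)
transitivity ((x * y - z * (x + y)) * ((x - y) * v1 + e1 * vk - e2 * vl)
   + z * v1 * ((e1 * e1 - (1 - x ^+ 2)) - (e2 * e2 - (1 - y ^+ 2)))); first by ring.
by rewrite rel ex ey !subrr !(mul0r, mulr0) addr0.
Qed.

Lemma cont_neq T k : cont T (lowI k) != cont T (highI k).
Proof. by have := axdist_neq0 T k; rewrite subr_eq0 eq_sym. Qed.

Lemma cont_neq2 T k l : l = k.+1 :> nat -> cont T (lowI k) != cont T (highI l).
Proof.
move=> lk; apply/eqP => /(@syt_content_far _ _ T (lowI k) (highI l)).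
by rewrite /= lk; lia.
Qed.

Definition word_mx (w : seq 'I_n.-1) : 'M[R]_(Defs.dim lam) :=
  foldr (fun k A => young_gen lam k *m A) 1%:M w.
Local Notation P := word_mx.

Lemma word_mx_cat w w' : P (w ++ w') = P w *m P w'.
Proof. by elim: w => [|k w IH] /=; rewrite ?mul1mx // IH mulmxA. Qed.

Lemma young_genM2 k l p (M : 'M[R]_(Defs.dim lam, p)) T j :
  (young_gen lam k *m (young_gen lam l *m M)) (syt_idx T) j =
  op k (op l (extend_col M j)) T.
Proof.
rewrite young_gen_mul; apply: op_ext => S.
by rewrite extend_colE young_gen_mul.
Qed.

Lemma matrix_syt p (A B : 'M[R]_(Defs.dim lam, p)) :
  (forall T j, A (syt_idx T) j = B (syt_idx T) j) -> A = B.
Proof. by move=> AB; apply/matrixP => i j; rewrite -(tnth_syt_idx i). Qed.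

Lemma young_gen_inv k : young_gen lam k *m young_gen lam k = 1%:M :> 'M[R]_(Defs.dim lam).
Proof.
apply: matrix_syt => T j; rewrite -[X in _ *m X]mulmx1 young_genM2 opK ?extend_colE //.
exact: cont_neq.
Qed.

Lemma young_gen_comm k l : (k.+1 < l)%N || (l.+1 < k)%N ->
  young_gen lam k *m young_gen lam l = young_gen lam l *m young_gen lam k :> 'M[R]_(Defs.dim lam).
Proof.
move=> kl; apply: matrix_syt => T j.
by rewrite -[X in (_ *m X) _ _]mulmx1 -[in RHS](mulmx1 (young_gen _ k)) !young_genM2 opC.
Qed.

Lemma young_gen_braid k l : l = k.+1 :> nat ->
  young_gen lam k *m (young_gen lam l *m young_gen lam k) =
  young_gen lam l *m (young_gen lam k *m young_gen lam l) :> 'M[R]_(Defs.dim lam).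
Proof.
move=> kl; apply: matrix_syt => T j.
rewrite -(mulmx1 (_ *m (_ *m young_gen _ k))) -(mulmx1 (_ *m (_ *m young_gen _ l))) -!mulmxA.
transitivity (op k (op l (op k (extend_col 1%:M j))) T).
  by rewrite young_gen_mul; apply: op_ext => S; rewrite extend_colE young_genM2.
rewrite op_braid ?cont_neq //; last exact: cont_neq2.
by rewrite young_gen_mul; apply: op_ext => S; rewrite extend_colE young_genM2.
Qed.

(** Letters out of range are dropped. Words over [nat] allow the bound on the letters to vary by
    induction while the type stays fixed. *)
Let ow (w : seq nat) : seq 'I_n.-1 := pmap insub w.

Let ow_val (w : seq 'I_n.-1) : ow (map val w) = w.
Proof. by elim: w => //= k w IH; rewrite /ow /= valK /= -/(ow _) IH. Qed.

(** Equality of permutations and equality of matrices are carried together, so that a rewriting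
    guided by the permutation is at once valid for the matrices. *)
Let weq (w w' : seq nat) : Prop :=
  adj_word (ow w) = adj_word (ow w') /\ P (ow w) = P (ow w').

Let ow_cat w w' : ow (w ++ w') = ow w ++ ow w'.
Proof. by rewrite /ow pmap_cat. Qed.

Let ow1 (k : nat) (kn : (k < n.-1)%N) (w : seq nat) : ow (k :: w) = Ordinal kn :: ow w.
Proof. by rewrite /ow /= insubT. Qed.

Let weq_refl w : weq w w. Proof. by []. Qed.
Let weq_trans (u v w : seq nat) : weq u v -> weq v w -> weq u w.
Proof. by move=> [h1 h2] [h3 h4]; split; [rewrite h1 | rewrite h2]. Qed.
Let weq_cat (u u' v v' : seq nat) : weq u u' -> weq v v' -> weq (u ++ v) (u' ++ v').
Proof.
move=> [h1 h2] [h3 h4]; rewrite /weq !ow_cat !adj_word_cat !word_mx_cat.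
by rewrite h1 h2 h3 h4.
Qed.

Let weq_inv (k : nat) : (k < n.-1)%N -> weq [:: k; k] [::].
Proof.
move=> kn; rewrite /weq !ow1 /=; split; first by rewrite mul1g /adj tperm2.
by rewrite mulmx1 young_gen_inv.
Qed.

Let weq_comm (k l : nat) : (k < n.-1)%N -> (l < n.-1)%N -> (k.+1 < l)%N || (l.+1 < k)%N ->
  weq [:: k; l] [:: l; k].
Proof.
move=> kn ln kl; rewrite /weq !ow1 /= !mulmx1 !mul1g; split.
  by apply/permP => i; rewrite !permM adj_comm.
by rewrite young_gen_comm.
Qed.

Let weq_braid (k : nat) : (k.+1 < n.-1)%N -> weq [:: k; k.+1; k] [:: k.+1; k; k.+1].
Proof.
move=> kn; have kn' := ltnW kn; rewrite /weq !ow1 /= !mulmx1 !mul1g; split.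
  by apply/permP => i; rewrite !permM adj_braid.
by rewrite young_gen_braid.
Qed.

Let weq_braid' (k : nat) : (k.+1 < n.-1)%N -> weq [:: k.+1; k; k.+1] [:: k; k.+1; k].
Proof. by case/weq_braid. Qed.

Let adj_word_fix (w : seq nat) (m : nat) (i : 'I_n) : all (fun a : nat => a < m)%N w -> (m < i)%N ->
  adj_word (ow w) i = i.
Proof.
elim: w => [|k w IH]; first by rewrite perm1.
case/andP=> km wm mi; have kn : (k < n.-1)%N by have := ltn_ord i; lia.
by rewrite ow1 /= permM IH // adj_id // neq_nat /=; lia.
Qed.

Let adj_word_down (m j : nat) (i i' : 'I_n) : (j <= m)%N -> i = j :> nat -> i' = m :> nat ->
  adj_word (ow (down m j)) i = i'.
Proof.
move: i; have [d dE] : exists d, (m - j)%N = d by exists (m - j)%N.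
elim: d j dE => [|d IH] j dE i jm ij im.
  have e : j = m by lia.
  by rewrite e downn perm1; apply: val_inj; rewrite /= ij im.
have kn : (j < n.-1)%N by have := ltn_ord i'; lia.
rewrite down_rcons; last by lia.
rewrite -cats1 ow_cat adj_word_cat permM ow1 /= mul1g.
apply: (IH j.+1) => //; try lia.
have -> : i = lowI (Ordinal kn) by apply: val_inj.
by rewrite /adj tpermL.
Qed.

(** The run closing the normal form carries its last letter j to the top point, which the remaining
    letters do not move. A permutation fixing the top point thus has an empty run, and the largest
    generator disappears. *)
Let word_reduce (q m : nat) (w : seq nat) : (m <= n.-1)%N -> all (fun a : nat => a < m)%N w ->
  (forall i : 'I_n, (q <= i)%N -> adj_word (ow w) i = i) ->
  exists2 w' : seq nat, all (fun a : nat => a.+1 < q)%N w' & weq w w'.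
Proof.
elim: m w => [|m IH] w mn wm fixw.
  by exists [::] => //; case: w wm fixw.
have [qm|mq] := leqP q m.+1; last first.
  by exists w => //; apply: sub_all wm => k /= ; lia.
have [w' [j [w'm jm ww']]] :=
  coxeter_nf weq_refl weq_trans weq_cat weq_inv weq_comm weq_braid' mn wm.
have mn' : (m.+1 < n)%N by lia.
have jn : (j < n)%N by lia.
have jE : j = m.+1.
  have : adj_word (ow w) (Ordinal jn) = Ordinal mn'.
    have [-> _] := ww'.
    rewrite ow_cat adj_word_cat permM (@adj_word_down _ _ _ (Ordinal mn')) //.
    exact: adj_word_fix w'm _.
  by rewrite -(fixw (Ordinal mn') qm) => /perm_inj/(congr1 val).
rewrite jE downn cats0 in ww'.
have [|i qi|w'' w''q h] := IH w' _ w'm; first by lia.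
  by have [<- _] := ww'; exact: fixw.
by exists w'' => //; exact: weq_trans h.
Qed.

(** With q = 0 this gives independence of the chosen word; with general q it shows that S_q acts by
    its own generators, which is the source of the block structure. *)
Lemma word_mx_support (q : nat) (w : seq 'I_n.-1) :
  (forall i : 'I_n, (q <= i)%N -> adj_word w i = i) ->
  exists w' : seq 'I_n.-1, [/\ all (fun k => k.+1 < q)%N w', adj_word w = adj_word w' &
    P w = P w'].
Proof.
move=> fixw.
have [|||w' w'q [h1 h2]] := @word_reduce q n.-1 (map val w) => //.
- by rewrite all_map; apply/allP => k _ /=.
- by move=> i qi; rewrite ow_val fixw.
exists (ow w'); rewrite ow_val in h1 h2; split => //.
apply/allP => k; rewrite mem_pmap => /mapP[x xw /= kx].
move: kx; case: insubP => //= y _ yx [->]; rewrite -yx in xw.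
exact: (allP w'q) xw.
Qed.

Lemma word_mx1 w : adj_word w = 1%g -> P w = 1%:M.
Proof.
move=> w1; have [|[|k w'] [//]] := @word_mx_support 0 w.
by move=> i _; rewrite w1 perm1.
Qed.

Lemma word_mx_rev w : P (rev w) *m P w = 1%:M.
Proof.
elim: w => [|k w IH]; first by rewrite mulmx1.
rewrite rev_cons -cats1 word_mx_cat /= mulmx1 -mulmxA (mulmxA (young_gen _ k)).
by rewrite young_gen_inv mul1mx.
Qed.

Lemma adj_word_rev w : adj_word (rev w) = (adj_word w)^-1%g :> 'S_n.
Proof.
elim: w => [|k w IH]; first by rewrite invg1.
by rewrite rev_cons -cats1 adj_word_cat /= mul1g IH invMg /adj tpermV.
Qed.

Lemma word_mx_eq w w' : adj_word w = adj_word w' -> P w = P w'.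
Proof.
move=> e; have : P (w ++ rev w') = 1%:M.
  by apply: word_mx1; rewrite adj_word_cat adj_word_rev e mulVg.
rewrite word_mx_cat => h.
by rewrite -[LHS]mulmx1 -(word_mx_rev w') mulmxA h mul1mx.
Qed.

Lemma young_repE w : young_rep lam (adj_word w) = P w.
Proof. exact/word_mx_eq/eqP/(xchooseP (adj_wordP (adj_word w))). Qed.

(** The factors change places because [s * t] applies s first, while the matrices follow composition
    from right to left. *)
Lemma young_repM (s t : 'S_n) :
  young_rep lam (s * t)%g = young_rep lam t *m young_rep lam s :> 'M[R]_(Defs.dim lam).
Proof.
have [w /eqP <-] := adj_wordP s; have [w' /eqP <-] := adj_wordP t.
by rewrite -adj_word_cat !young_repE word_mx_cat.
Qed.

Lemma young_rep1 : young_rep lam 1%g = 1%:M :> 'M[R]_(Defs.dim lam).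
Proof. by rewrite -[1%g]/(adj_word [::]) young_repE. Qed.

Lemma young_rep_adj k : young_rep lam (adj k) = young_gen lam k :> 'M[R]_(Defs.dim lam).
Proof. by rewrite -[adj k]mul1g -[(_ * _)%g]/(adj_word [:: k]) young_repE /= mulmx1. Qed.

Lemma young_gen_tr k : (young_gen lam k)^T = young_gen lam k :> 'M[R]_(Defs.dim lam).
Proof.
apply/matrixP => i j; rewrite !mxE; move: (tnth _ i) (tnth _ j) => S T.
rewrite /young_entry eq_sym; case: eqP => [->//|_].
have -> : (val S == [ffun i0 => T (adj k i0)]) = (val T == [ffun i0 => S (adj k i0)]).
  apply/eqP/eqP => /ffunP h; apply/ffunP => x.
    by rewrite ffunE -[S _]/(val S _) h ffunE /adj tpermK.
  by rewrite ffunE -[T _]/(val T _) h ffunE /adj tpermK.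
case: eqP => // h; congr (Num.sqrt (1 - _^-1)); rewrite -!rmorphXn; congr (_%:~R).
have -> : axdist T k = - axdist S k; last by rewrite sqrrN.
rewrite /axdist -[boxof T]/(val T) h !ffunE.
by rewrite {1}/adj tpermR /adj tpermL [RHS]opprB.
Qed.

Lemma word_mx_tr w : (P w)^T = P (rev w).
Proof.
elim: w => [|k w IH]; first by rewrite trmx1.
by rewrite rev_cons -cats1 word_mx_cat /= trmx_mul IH mulmx1 young_gen_tr.
Qed.

Lemma young_rep_tr (s : 'S_n) : (young_rep lam s)^T = young_rep lam s^-1%g :> 'M[R]_(Defs.dim lam).
Proof.
have [w /eqP <-] := adj_wordP s.
by rewrite -adj_word_rev !young_repE word_mx_tr.
Qed.

(** The generators are symmetric involutions, so the matrix is orthogonal and its rows are unit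
    vectors. *)
Lemma young_rep_le1 (s : 'S_n) i j : `|young_rep lam s i j| <= 1 :> R.
Proof.
have h : young_rep lam s *m (young_rep lam s)^T = 1%:M :> 'M[R]_(Defs.dim lam).
  by rewrite young_rep_tr -young_repM mulVg young_rep1.
have := congr1 (fun M : 'M[R]_(Defs.dim lam) => M i i) h; rewrite !mxE eqxx (bigD1 j) //= mxE => e.
rewrite -(@ler_pXn2r _ 2) ?nnegrE // expr1n real_normK ?num_real // expr2.
rewrite -[leRHS]/(true%:R) -e lerDl sumr_ge0 // => l _; rewrite mxE -expr2; exact: sqr_ge0.
Qed.

End YoungForm.

(** * Tableaux determined by contents and connected by exchanges *)

Section Contents.
Variable n : nat.

(** If S put l further down the diagonal than T does, the box of l in T would lie inside mu, above
    and to the left of the box of l in S, and would hold a smaller entry j of S. Since T and S agree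
    below l, T would have j and l in one box. *)
Lemma syt_cont_aux (lam mu : intpart n) (T : syt lam) (S : syt mu) (l : 'I_n) :
  (forall j : 'I_n, (j < l)%N -> T j = S j) -> cont T l = cont S l ->
  ((S l).1 <= (T l).1)%N.
Proof.
move=> IH ce; rewrite leqNgt; apply/negP => lt.
have ce' : (T l).2%:Z - (T l).1%:Z = (S l).2%:Z - (S l).1%:Z by exact: ce.
have ds := syt_diagram S l; rewrite /in_diagram in ds.
have [j Sj] : exists j : 'I_n, S j = T l.
  apply: syt_onto; rewrite /in_diagram.
  by have := part_anti mu (ltnW lt); lia.
have jl : (j <= l)%N by apply: (@syt_le _ _ S); rewrite Sj; lia.
have {jl} : (j < l)%N.
  rewrite ltn_neqAle jl andbT; apply: contraTneq lt => /val_inj e.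
  by rewrite -Sj e ltnn.
by move=> jl; have := IH j jl; rewrite Sj => /syt_inj e; rewrite e ltnn in jl.
Qed.

Lemma syt_cont_det (lam mu : intpart n) (T : syt lam) (S : syt mu) (m : nat) :
  (forall l : 'I_n, (l < m)%N -> cont T l = cont S l) ->
  forall l : 'I_n, (l < m)%N -> T l = S l.
Proof.
move=> ce l; move: {2}(val l) (leqnn l) => /= d; elim/ltn_ind: d l => d IH l ld lm.
have h (j : 'I_n) : (j < l)%N -> T j = S j.
  by move=> jl; apply: (IH j); lia.
have h1 := syt_cont_aux h (ce l lm).
have h2 : ((T l).1 <= (S l).1)%N.
  by apply: syt_cont_aux; [move=> j /h -> | rewrite ce].
have e : (T l).2%:Z - (T l).1%:Z = (S l).2%:Z - (S l).1%:Z by exact: ce.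
by rewrite [LHS]surjective_pairing [RHS]surjective_pairing; congr pair; apply: val_inj => /=; lia.
Qed.

Lemma syt_shape (lam mu : intpart n) (T : syt lam) (S : syt mu) :
  (forall l, T l = S l) -> lam = mu.
Proof.
move=> TS.
have dE (b a : 'I_n) : (a < part lam b)%N = (a < part mu b)%N.
  apply/idP/idP => h.
    have [k Tk] := @syt_onto _ _ T (b, a) h.
    by have := syt_diagram S k; rewrite /in_diagram -TS Tk.
  have [k Tk] := @syt_onto _ _ S (b, a) h.
  by have := syt_diagram T k; rewrite /in_diagram TS Tk.
have pE (b : nat) : (b < n)%N -> part lam b = part mu b.
  move=> bn; apply/eqP; rewrite eqn_leq.
  have l1 := part_le lam b; have l2 := part_le mu b.
  apply/andP; split; rewrite leqNgt; apply/negP => lt.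
    have an : (part mu b < n)%N by lia.
    by have := dE (Ordinal bn) (Ordinal an); rewrite /= lt ltnn.
  have an : (part lam b < n)%N by lia.
  by have := dE (Ordinal bn) (Ordinal an); rewrite /= lt ltnn.
apply/val_inj/eq_from_tnth => i; apply: val_inj.
have := pE i (ltn_ord i); rewrite /part !(nth_map ord0) ?size_tuple //.
by rewrite -!tnth_nth.
Qed.

Lemma syt_cont0 (lam : intpart n) (T : syt lam) (i : 'I_n) : val i = 0%N -> cont T i = 0.
Proof.
move=> i0; have n0 : (0 < n)%N by exact: leq_ltn_trans (ltn_ord i).
have [j Tj] : exists j : 'I_n, T j = (Ordinal n0, Ordinal n0).
  apply: syt_onto; rewrite /in_diagram /=.
  by have := syt_diagram T i; rewrite /in_diagram; have := part_anti lam (leq0n (T i).1); lia.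
have : (j <= i)%N by apply: (@syt_le _ _ T); rewrite Tj.
rewrite [X in (_ <= X)%N]i0 leqn0 => /eqP j0.
have -> : i = j by apply: val_inj; rewrite i0 /= j0.
by rewrite /cont Tj.
Qed.

Variable lam : intpart n.

Lemma swap_incomparable (T : syt lam) (k : 'I_n.-1) :
  ~~ (((T (lowI k)).1 <= (T (highI k)).1) && ((T (lowI k)).2 <= (T (highI k)).2))%N ->
  standard lam (swap T k).
Proof.
move=> h1; apply: swap_standard.
have kk : val (lowI k) = k by [].
have kk' : val (highI k) = k.+1 by [].
have {}h2 : ~~ (((T (highI k)).1 <= (T (lowI k)).1) && ((T (highI k)).2 <= (T (lowI k)).2))%N.
  apply/negP => /andP[a b]; have := @syt_le _ _ T (highI k) (lowI k) a b.
  by rewrite kk kk'; lia.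
apply/negP => /eqP d1.
have {d1} [d1|d1] : axdist T k = 1 \/ axdist T k = -1 by move: d1; clear; lia.
  by move: d1 h1 h2; rewrite /axdist /Defs.content; clear; lia.
by move: d1 h1 h2; rewrite /axdist /Defs.content; clear; lia.
Qed.

(* If S = T o p, exchanging a descent of p increases the sum of k * p k. *)
Lemma syt_connected_aux (m : nat) (Q : syt lam -> Prop) (T : syt lam) (d : nat) :
  (forall (S S' : syt lam) (k : 'I_n.-1), (k.+1 < m)%N -> val S' = swap S k -> Q S -> Q S') ->
  forall (S : syt lam) (p : 'S_n), (forall k, S k = T (p k)) ->
  (forall l : 'I_n, (m <= l)%N -> p l = l) ->
  (n * (n * n) <= d + \sum_(k < n) k * p k)%N -> Q T -> Q S.
Proof.
move=> Qswap; elim: d => [|d IH] S p Sp pm bnd QT.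
  (* With d = 0 the premise contradicts this crude bound on the sum, except when n = 0. *)
  have : (\sum_(k < n) k * p k < n * (n * n))%N \/ n = 0%N.
    case: n p {Sp pm bnd} => [|n'] p; [by right | left].
    rewrite big_ord_recl mul0n add0n -[X in (X * _)%N](card_ord n'.+1) -sum_nat_const.
    rewrite big_ord_recl /=.
    apply: (@leq_ltn_trans (\sum_(i < n') n'.+1 * n'.+1)%N).
      2: by rewrite -[X in (X < _)%N]add0n ltn_add2r.
    apply: leq_sum => i _; apply: leq_mul.
      exact: ltnW (ltn_ord (lift ord0 i)).
    exact: ltnW (ltn_ord (p _)).
  case=> [|n0]; first by lia.
  suff -> : S = T by [].
  by apply/val_inj/ffunP => x; have := ltn_ord x; rewrite [X in (_ < X)%N]n0.
case: (pickP (fun k : 'I_n.-1 => (k.+1 < m)%N && (p (highI k) < p (lowI k))%N)) => [k|noD].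
  case/andP=> km lt.
  have st : standard lam (swap S k).
    apply: swap_incomparable; rewrite !Sp; apply/negP => /andP[h1 h2].
    by have := @syt_le _ _ T _ _ h1 h2; lia.
  apply: (Qswap (Syt st) S k km); first by rewrite /= swapK.
  apply: (IH (Syt st) (adj k * p)%g) => //.
  - by move=> i; rewrite /= ffunE Sp permM.
  - move=> l ml; rewrite permM adj_id ?pm // neq_nat /=; lia.
  suff : (\sum_(i < n) i * p i < \sum_(i < n) i * (adj k * p)%g i)%N by lia.
  have nlh : highI k != lowI k by rewrite neq_nat /=; lia.
  rewrite (bigD1 (lowI k)) //= (bigD1 (highI k)) //=.
  rewrite [X in (_ < X)%N](bigD1 (lowI k)) //= [X in (_ < _ + X)%N](bigD1 (highI k)) //=.
  rewrite !permM /adj tpermL tpermR -/(adj k).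
  have -> : (\sum_(i < n | (i != lowI k) && (i != highI k)) i * (adj k * p)%g i =
             \sum_(i < n | (i != lowI k) && (i != highI k)) i * p i)%N.
    by apply: eq_bigr => i /andP[h1 h2]; rewrite permM adj_id.
  rewrite /=; move: lt; move: (p (highI k)) (p (lowI k)) => a b.
  set s := (\sum_(_ < _ | _) _)%N; rewrite !mulSn.
  move: (k * a)%N (k * b)%N => x y; lia.
suff -> : S = T by [].
(* Without descents p increases below m, and it fixes the points from m on; hence k <= p k
   everywhere, and equality of the two sums forces p to be the identity. *)
have step (i j : 'I_n) : j = i.+1 :> nat -> (j < m)%N -> (p i < p j)%N.
  move=> ji jm; have kn : (i < n.-1)%N by have := ltn_ord j; lia.
  have := noD (Ordinal kn); rewrite /= -ji jm /= => /negbT; rewrite -leqNgt.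
  have -> : lowI (Ordinal kn) = i by exact: val_inj.
  have -> : highI (Ordinal kn) = j by apply: val_inj.
  rewrite leq_eqVlt => /orP[/eqP/val_inj/perm_inj e|//].
  by move: ji; rewrite e; lia.
have ge (i : 'I_n) : (i <= p i)%N.
  have [mi|im] := leqP m i; first by rewrite pm.
  case: i im => i iN /= im; elim: i iN im => // i IHi iN im.
  have := @step (Ordinal (ltnW iN)) (Ordinal iN) erefl im.
  by have := IHi (ltnW iN) (ltnW im); lia.
have eqs : (\sum_(i < n) i = \sum_(i < n) p i)%N by apply: reindex_inj; exact: perm_inj.
have lei : leqif (\sum_(i < n) i)%N (\sum_(i < n) p i)%N
    [forall (i : 'I_n | true), (i == p i :> nat)].
  by apply: leqif_sum => i _; split => //; exact: ge.
have /esym/forallP h := lei.2; rewrite eqs eqxx in h.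
apply/val_inj/ffunP => i; rewrite -[LHS]/(S i) Sp; congr (T _).
by apply: val_inj; rewrite /= -(eqP (h i)).
Qed.

(** The classes are the blocks: the tableaux of one class index the basis of one irreducible
    constituent of the restriction to S_m. *)
Definition agree (m : nat) (T S : syt lam) : bool :=
  [forall l : 'I_n, (m <= l)%N ==> (T l == S l)].

Lemma agreeP m (T S : syt lam) :
  reflect (forall l : 'I_n, (m <= l)%N -> T l = S l) (agree m T S).
Proof.
apply: (iffP forallP) => h l; first by move/(implyP (h l))/eqP.
by apply/implyP => /h ->.
Qed.

Lemma agree_refl m T : agree m T T. Proof. exact/agreeP. Qed.

Lemma agree_sym m T S : agree m T S = agree m S T.
Proof. by apply/agreeP/agreeP => h l /h ->. Qed.

Lemma agree_trans m U T S : agree m T U -> agree m U S -> agree m T S.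
Proof. by move=> /agreeP h1 /agreeP h2; apply/agreeP => l ml; rewrite h1 // h2. Qed.

Lemma agree_all T S : agree n T S.
Proof. by apply/agreeP => l; have := ltn_ord l; lia. Qed.

(** An induction principle expressing that a block is connected under exchanges of consecutive
    entries below m. The permutation used sends an entry of S to the entry of T in the same box. *)
Lemma syt_connected (m : nat) (Q : syt lam -> Prop) (T S : syt lam) :
  (forall (S S' : syt lam) (k : 'I_n.-1), (k.+1 < m)%N -> val S' = swap S k -> Q S -> Q S') ->
  agree m T S -> Q T -> Q S.
Proof.
move=> Qswap /agreeP TS QT.
have ex (k : 'I_n) : exists j : 'I_n, T j == S k.
  by have [j jE] := @syt_onto _ _ T (S k) (syt_diagram S k); exists j; apply/eqP.
have pE k : T (xchoose (ex k)) = S k by exact: eqP (xchooseP (ex k)).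
have p_inj : injective (fun k => xchoose (ex k)).
  by move=> i j /(congr1 T); rewrite !pE => /syt_inj.
apply: (@syt_connected_aux m Q T (n * (n * n)) Qswap S (perm p_inj)) => //.
- by move=> k; rewrite permE pE.
- by move=> l ml; rewrite permE; apply: (@syt_inj _ _ T); rewrite pE TS.
- by rewrite leq_addr.
Qed.

End Contents.

(** * Blocks of tableaux and normalized characters *)

Section Schur.
Variables (R : realType) (n : nat).
Implicit Types (lam mu : intpart n) (k : 'I_n.-1).

(** The Jucys-Murphy recursion s_k J_k s_k + s_k = J_(k+1), read on functions of fillings, where J_k
    multiplies by the content of the entry k. *)
Lemma op_jm k (v : {ffun 'I_n -> 'I_n * 'I_n} -> R) F :
  cont F (lowI k) != cont F (highI k) ->
  op k (fun F => (cont F (lowI k))%:~R * op k v F) F + op k v F =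
  (cont F (highI k))%:~R * v F.
Proof.
move=> ne; rewrite /op !invax_swap !cont_swap !swapK {1}/adj tpermL sqrrN.
have := sqr_sqrt_invdiff R ne; rewrite -invaxE.
have : invax R F k * ((cont F (highI k))%:~R - (cont F (lowI k))%:~R) = 1.
  by rewrite -rmorphB /= /invax mulVf // intr_eq0 subr_eq0 eq_sym.
set x := invax R F k; set e := Num.sqrt _; set a := (cont F (lowI k))%:~R.
set b := (cont F (highI k))%:~R; set w := v (swap F k); set v1 := v F => xab ee.
apply/eqP; rewrite -subr_eq0; apply/eqP.
transitivity ((e * e - (1 - x ^+ 2)) * b * v1 - (x * (b - a) - 1) * (x * v1 + e * w)); first by ring.
by rewrite ee xab !subrr !mul0r subr0.
Qed.

(** The matrix of a Jucys-Murphy element: diagonal in the Young basis, with the contents of the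
    entry l as eigenvalues. *)
Definition cont_mx lam (l : 'I_n) : 'M[R]_(Defs.dim lam) :=
  diag_mx (\row_i (cont (tnth (syt_enum lam) i) l)%:~R).

Lemma cont_mxE lam l p (M : 'M[R]_(Defs.dim lam, p)) (T : syt lam) j :
  (cont_mx lam l *m M) (syt_idx T) j = (cont T l)%:~R * M (syt_idx T) j.
Proof. by rewrite mul_diag_mx !mxE syt_idxK. Qed.

Lemma cont_mx_step lam k :
  young_gen lam k *m (cont_mx lam (lowI k) *m young_gen lam k) + young_gen lam k =
  cont_mx lam (highI k).
Proof.
apply: matrix_syt => T j; rewrite mxE -[cont_mx lam (highI k)]mulmx1 cont_mxE.
have gE : young_gen lam k = young_gen lam k *m 1%:M :> 'M[R]_(Defs.dim lam) by rewrite mulmx1.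
rewrite gE -(mulmxA (young_gen _ _) 1%:M) mul1mx !young_gen_mul.
rewrite -extend_colE -op_jm ?cont_neq //; congr (_ + _); apply: op_ext => S.
by rewrite extend_colE cont_mxE young_gen_mul.
Qed.

(** The content matrices start from 0 and are built from the generators by [cont_mx_step], so
    whatever intertwines the generators intertwines them as well. *)
Lemma cont_mx_intertwine lam mu (m : nat) (A : 'M[R]_(Defs.dim lam, Defs.dim mu)) :
  (forall k, (k.+1 < m)%N -> young_gen lam k *m A = A *m young_gen mu k) ->
  forall l : 'I_n, (l < m)%N -> cont_mx lam l *m A = A *m cont_mx mu l.
Proof.
move=> GA [l ln]; elim: l ln => [|l IH] ln /= lm.
  have z nu : cont_mx nu (Ordinal ln) = 0.
    by apply: matrix_syt => T j; rewrite -[cont_mx _ _]mulmx1 cont_mxE syt_cont0 // mul0r mxE.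
  by rewrite !z mulmx0 mul0mx.
have kn : (l < n.-1)%N by lia.
have -> : Ordinal ln = highI (Ordinal kn) by apply: val_inj.
rewrite -!cont_mx_step mulmxDl mulmxDr GA //; congr (_ + _).
have {}IH := IH (ltnW ln) (ltnW lm).
have e : lowI (Ordinal kn) = Ordinal (ltnW ln) by apply: val_inj.
by rewrite e -!mulmxA GA // (mulmxA (cont_mx _ _)) IH !mulmxA GA.
Qed.

(** The contents of the entries below m are joint eigenvalues. An intertwiner connects only equal
    ones, and equal contents mean equal boxes by [syt_cont_det], even across different shapes. *)
Lemma intertwine_support lam mu (m : nat) (A : 'M[R]_(Defs.dim lam, Defs.dim mu)) :
  (forall k, (k.+1 < m)%N -> young_gen lam k *m A = A *m young_gen mu k) ->
  forall (T : syt lam) (S : syt mu), A (syt_idx T) (syt_idx S) != 0 ->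
  forall l : 'I_n, (l < m)%N -> T l = S l.
Proof.
move=> GA T S A0; apply: syt_cont_det => l lm.
have := congr1 (fun M : 'M[R]_(_, _) => M (syt_idx T) (syt_idx S)) (cont_mx_intertwine GA lm).
rewrite /= cont_mxE /cont_mx mul_mx_diag !mxE syt_idxK mulrC => /(mulfI A0) /eqP.
by rewrite eqr_int => /eqP.
Qed.

Lemma schur_zero lam mu (A : 'M[R]_(Defs.dim lam, Defs.dim mu)) :
  (forall k, young_gen lam k *m A = A *m young_gen mu k) -> lam != mu -> A = 0.
Proof.
move=> GA ne; apply/matrixP => i j; rewrite mxE -(tnth_syt_idx i) -(tnth_syt_idx j).
set T := tnth _ i; set S := tnth _ j; apply/eqP; apply: contraNT ne => A0; apply/eqP.
apply: (@syt_shape _ _ _ T S) => l.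
by apply: (@intertwine_support lam mu n A _ T S A0) => // k _.
Qed.

(** Off the diagonal A vanishes by [intertwine_support] inside a block and by assumption across
    blocks. For two tableaux related by an exchange, the generator has a nonzero entry between them,
    and comparing that entry in the commutation relation equates their diagonal values;
    connectedness spreads this over the block. *)
Lemma schur_block lam (m : nat) (A : 'M[R]_(Defs.dim lam)) :
  (forall k, (k.+1 < m)%N -> young_gen lam k *m A = A *m young_gen lam k) ->
  (forall T S : syt lam, ~~ agree m T S -> A (syt_idx T) (syt_idx S) = 0) ->
  (forall T S : syt lam, T != S -> A (syt_idx T) (syt_idx S) = 0) /\
  (forall T S : syt lam, agree m T S ->
     A (syt_idx T) (syt_idx T) = A (syt_idx S) (syt_idx S)).
Proof.
move=> GA blk.
have diag (T S : syt lam) : T != S -> A (syt_idx T) (syt_idx S) = 0.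
  move=> TS; have [/agreeP ag|/blk //] := boolP (agree m T S).
  apply/eqP; apply: contraNT TS => A0; apply/eqP/val_inj/ffunP => l.
  have [|lm] := leqP m l; first exact: ag.
  exact: (@intertwine_support lam lam m A).
split=> // T S TS; apply: (@syt_connected _ _ m
  (fun S => A (syt_idx T) (syt_idx T) = A (syt_idx S) (syt_idx S)) T S _ TS) => // U U' k km UU' ->.
have st : standard lam (swap U k) by rewrite -UU'; exact: valP.
have := swap_axdist st; rewrite -[swap U k]UU' in st *.
have ne : U != U' by rewrite -(inj_eq val_inj) UU' eq_sym swap_neq.
have := congr1 (fun M : 'M[R]_(_) => M (syt_idx U) (syt_idx U')) (GA k km).
rewrite /= !mxE (bigD1 (syt_idx U')) //= big1 ?addr0; last first.
  by move=> i iU; rewrite -(tnth_syt_idx i) diag ?mulr0 //; apply: contraNneq iU => <-; rewrite tnth_syt_idx.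
rewrite (bigD1 (syt_idx U)) //= big1 ?addr0; last first.
  by move=> i iU; rewrite -(tnth_syt_idx i) diag ?mul0r //; apply: contraNneq iU => ->; rewrite tnth_syt_idx.
rewrite mulrC => e d1; apply/esym; move: e; apply: mulIf.
rewrite mxE !syt_idxK /young_entry (eq_sym U') (negPf ne) UU' eqxx.
rewrite gt_eqF // sqrtr_gt0 subr_gt0 invf_lt1.
  rewrite -rmorphXn -[1]/(1%:~R : R) ltr_int.
  by move: d1 (axdist_neq0 U k); move: (axdist U k) => c; nia.
by rewrite exprn_even_gt0 //= intr_eq0 axdist_neq0.
Qed.

End Schur.

(** * Block traces and sums over conjugates *)

Section Blocks.
Variables (R : realType) (n : nat) (lam : intpart n).
Implicit Types (T S : syt lam) (g x : 'S_n) (m : nat).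
Local Notation mx := 'M[R]_(Defs.dim lam).

Definition low (m : nat) : {set 'I_n} := [set i : 'I_n | (i < m)%N].

Lemma low_fix m g (i : 'I_n) : perm_on (low m) g -> (m <= i)%N -> g i = i.
Proof. by move=> gm mi; apply: (out_perm gm); rewrite inE -leqNgt. Qed.

(** A suitable word for g exchanges only entries below m, so its product never leads from one block
    to another. *)
Lemma young_rep_block m g T S : perm_on (low m) g -> ~~ agree m T S ->
  young_rep lam g (syt_idx T) (syt_idx S) = 0 :> R.
Proof.
move=> gm; have [w /eqP wE] := adj_wordP g; rewrite -wE young_repE.
have [|w' [w'm _ ->]] := @word_mx_support R n lam m w.
  by move=> i mi; rewrite wE (low_fix gm).
elim: w' w'm T => [|k w' IH] /= => [_|/andP[km /IH{}IH]] T TS.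
  rewrite mxE; case: eqP => // /(congr1 (tnth (syt_enum lam))).
  by rewrite !syt_idxK => e; rewrite e agree_refl in TS.
rewrite young_gen_mul /op extend_colE IH // mulr0 add0r /extend_col.
case: insubP => [U _ Uk|_]; last by rewrite mulr0.
rewrite IH ?mulr0 //; apply: contra TS; apply: agree_trans.
apply/agreeP => l ml; rewrite -[boxof U]/(val U) Uk ffunE adj_id // neq_nat /=; lia.
Qed.

Definition bproj m T : mx := diag_mx (\row_i (agree m T (tnth (syt_enum lam) i))%:R).

Lemma bproj_comm m T g : perm_on (low m) g ->
  bproj m T *m young_rep lam g = young_rep lam g *m bproj m T.
Proof.
move=> gm; rewrite mul_diag_mx mul_mx_diag; apply/matrixP => i j; rewrite !mxE.
rewrite -(tnth_syt_idx i) -(tnth_syt_idx j); set U := tnth _ i; set S := tnth _ j.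
rewrite !syt_idxK; have [US|US] := boolP (agree m U S); last first.
  by rewrite (young_rep_block gm US) mulr0 mul0r.
suff -> : agree m T U = agree m T S by rewrite mulrC.
by apply/idP/idP => h; [exact: agree_trans h US | apply: agree_trans h _; rewrite agree_sym].
Qed.

Definition bsize m T : nat := #|[pred S | agree m T S]|.

Lemma bsize_gt0 m T : (0 < bsize m T)%N.
Proof. by apply/card_gt0P; exists T; rewrite inE agree_refl. Qed.

Definition btrace m T g : R :=
  \sum_(S | agree m T S) young_rep lam g (syt_idx S) (syt_idx S).

Definition bchar m T g : R := btrace m T g / (bsize m T)%:R.

Lemma btraceE m T g : btrace m T g = \tr (bproj m T *m young_rep lam g).
Proof.
rewrite /mxtrace sum_syt /btrace big_mkcond; apply: eq_bigr => S _.
by rewrite mul_diag_mx !mxE syt_idxK; case: ifP; rewrite ?mul1r ?mul0r.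
Qed.

Lemma young_repJ g x :
  young_rep lam (g ^ x)%g = young_rep lam x *m young_rep lam g *m young_rep lam x^-1%g :> mx.
Proof. by rewrite conjgE !young_repM. Qed.

Lemma young_repVr x : young_rep lam x^-1%g *m young_rep lam x = 1%:M :> mx.
Proof. by rewrite -young_repM mulgV young_rep1. Qed.

Lemma btraceJ m T g x : perm_on (low m) x -> btrace m T (g ^ x)%g = btrace m T g.
Proof.
move=> xm; rewrite !btraceE young_repJ !mulmxA bproj_comm // -!mulmxA mxtrace_mulC.
by rewrite -!mulmxA young_repVr mulmx1.
Qed.

Lemma perm_on_mulgr m y : perm_on (low m) y -> forall x,
  perm_on (low m) (x * y)%g = perm_on (low m) x.
Proof.
move=> ym x; apply/idP/idP => h; last exact: perm_onM.
by rewrite -(mulgK y x) perm_onM // perm_onV.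
Qed.

Lemma card_low m : (m <= n)%N -> #|[pred x : 'S_n | perm_on (low m) x]| = m`!.
Proof.
move=> mn; rewrite (_ : #|_| = #|perm_on (low m)|) // card_perm; congr (_`!).
rewrite cardsE -sum1_card (eq_bigl (fun i : 'I_n => i < m)%N) //.
by rewrite -(big_ord_widen n (fun=> 1%N)) // sum1_card card_ord.
Qed.

Definition csum m g : mx := \sum_(x | perm_on (low m) x) young_rep lam (g ^ x)%g.

Lemma csum_comm m g (k : 'I_n.-1) : (k.+1 < m)%N -> young_gen lam k *m csum m g = csum m g *m young_gen lam k.
Proof.
move=> km; have am : perm_on (low m) (adj k).
  apply/fintype.subsetP => i; rewrite !inE; apply: contraR => im.
  by rewrite adj_id // neq_nat /=; lia.
rewrite -young_rep_adj -[LHS]mulmx1 -(young_repVr (adj k)) [LHS]mulmxA; congr (_ *m _).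
rewrite /csum mulmx_sumr mulmx_suml [RHS](reindex_inj (mulIg (adj k))) /=.
apply: eq_big => [x|x _]; first by rewrite perm_on_mulgr.
by rewrite conjgM [RHS]young_repJ.
Qed.

(** The sum of the conjugates of g commutes with S_m, hence is a scalar on each block by Schur's
    lemma. Its trace over the block identifies the scalar, as all conjugates of g by S_m have the
    same block trace. *)
Lemma csum_block m g T S : (m <= n)%N -> perm_on (low m) g ->
  csum m g (syt_idx T) (syt_idx S) = if T == S then m`!%:R * bchar m T g else 0.
Proof.
move=> mn gm; have gxm x : perm_on (low m) x -> perm_on (low m) (g ^ x)%g.
  by move=> xm; rewrite conjgE !(perm_onM, perm_onV).
have [||h1 h2] := @schur_block R n lam m (csum m g).
- exact: csum_comm.
- move=> U V UV; rewrite summxE big1 // => x xm.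
  by rewrite (young_rep_block _ UV) // gxm.
case: eqP => [<-|/eqP/h1 //].
rewrite /bchar mulrA; apply: (@mulIf _ ((bsize m T)%:R : R)).
  by rewrite pnatr_eq0 -lt0n bsize_gt0.
rewrite divfK ?pnatr_eq0 -?lt0n ?bsize_gt0 //.
transitivity (\sum_(S | agree m T S) csum m g (syt_idx S) (syt_idx S)).
  rewrite -(eq_bigr _ (fun S TS => h2 T S TS)) sumr_const mulr_natr.
  by congr (_ *+ _); rewrite /bsize; apply: eq_card => U.
under eq_bigr do rewrite summxE.
rewrite exchange_big /=.
transitivity (\sum_(x : 'S_n | perm_on (low m) x) btrace m T g).
  by apply: eq_bigr => x xm; rewrite -(btraceJ T g xm).
rewrite sumr_const mulr_natl; congr (_ *+ _); rewrite -card_low //.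
Qed.

Definition nchar g : R := \tr (young_rep lam g) / (Defs.dim lam)%:R.

Lemma agree_all_true T : [pred S | agree n T S] =1 xpredT.
Proof. by move=> S /=; rewrite agree_all. Qed.

Lemma btrace_all T g : btrace n T g = \tr (young_rep lam g).
Proof. by rewrite /mxtrace sum_syt; apply: eq_bigl => S; rewrite agree_all. Qed.

Lemma bchar_all T g : bchar n T g = nchar g.
Proof.
rewrite /bchar /nchar btrace_all; congr (_ / _%:R).
by rewrite /bsize (eq_card (agree_all_true T)).
Qed.

Lemma perm_on_all g : perm_on (low n) g.
Proof. by apply/fintype.subsetP => i; rewrite !inE. Qed.

Lemma csum_all g : csum n g = (n`!%:R * nchar g)%:M.
Proof.
apply: matrix_syt => T j; rewrite -(tnth_syt_idx j).
rewrite csum_block ?perm_on_all // mxE bchar_all (can_eq (fun T => syt_idxK T)).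
by case: eqP.
Qed.

Lemma ncharJ g x : nchar (g ^ x)%g = nchar g.
Proof.
by rewrite /nchar young_repJ mxtrace_mulC mulmxA young_repVr mul1mx.
Qed.

(** The sum of all conjugates of h is the scalar matrix n! [nchar h]; multiply it by the matrix of g
    and take the trace. *)
Lemma ncharM g h : nchar g * nchar h = (n`!%:R)^-1 * \sum_x nchar (g * h ^ x)%g.
Proof.
have : \tr (csum n h *m young_rep lam g) = n`!%:R * nchar h * \tr (young_rep lam g).
  by rewrite csum_all mul_scalar_mx mxtraceZ.
rewrite /csum mulmx_suml raddf_sum /= => e.
rewrite /nchar -mulr_suml -/(nchar h) mulrA.
rewrite (eq_bigl (perm_on (low n))); last by move=> x; rewrite perm_on_all.
under eq_bigr do rewrite young_repM.
rewrite e !mulrA mulVf ?mul1r ?pnatr_eq0 -?lt0n ?fact_gt0 //.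
by congr (_ / _); rewrite mulrAC [RHS]mulrAC; congr (_ / _); exact: mulrC.
Qed.

Lemma sum_bchar m g : \sum_T bchar m T g = \tr (young_rep lam g).
Proof.
rewrite /bchar /btrace; under eq_bigr do rewrite mulr_suml big_mkcond.
rewrite exchange_big /= /mxtrace sum_syt; apply: eq_bigr => S _.
rewrite -big_mkcond /= (eq_bigr (fun=> young_rep lam g (syt_idx S) (syt_idx S) / (bsize m S)%:R)).
  rewrite sumr_const.
  have -> : #|[pred T | agree m T S]| = bsize m S.
    by apply: eq_card => T; rewrite !inE agree_sym.
  by rewrite -[LHS]mulr_natr divfK // pnatr_eq0 -lt0n bsize_gt0.
move=> T TS; congr (_ / _%:R); apply: eq_card => U; rewrite !inE.
apply/idP/idP => h; last exact: agree_trans TS h.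
by apply: agree_trans h; rewrite agree_sym.
Qed.

(** By [csum_block] the left side is, up to the factor m! squared, the trace of the square of the
    diagonal matrix [csum m g]. *)
Lemma sum_bchar2 m g : (m <= n)%N -> perm_on (low m) g ->
  \sum_T bchar m T g ^+ 2 =
  (m`!%:R ^+ 2)^-1 * \sum_(x | perm_on (low m) x) \sum_(y | perm_on (low m) y)
    \tr (young_rep lam (g ^ x * g ^ y)%g).
Proof.
move=> mn gm; have f0 : (m`!%:R : R) != 0 by rewrite pnatr_eq0 -lt0n fact_gt0.
transitivity ((m`!%:R ^+ 2)^-1 * \tr (csum m g *m csum m g)).
  rewrite /mxtrace sum_syt mulr_sumr; apply: eq_bigr => T _.
  rewrite mxE sum_syt (bigD1 T) //= big1 ?addr0; last first.
    by move=> S ST; rewrite csum_block // eq_sym (negPf ST) mul0r.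
  rewrite csum_block // eqxx; field; exact: f0.
congr (_ * _); rewrite /csum mulmx_suml raddf_sum [RHS]exchange_big /=.
apply: eq_bigr => x _; rewrite mulmx_sumr raddf_sum /=.
by apply: eq_bigr => y _; rewrite -young_repM.
Qed.

End Blocks.

(** The witness is the row reading tableau: the rows are filled one after the other, [reshape_index]
    giving the row and [reshape_offset] the column of an entry. *)
Lemma dim_gt0 n (lam : intpart n) : (0 < Defs.dim lam)%N.
Proof.
pose sh := map val lam.
have szsh : size sh = n by rewrite size_map size_tuple.
have sumsh : sumn sh = n by have /andP[_ /eqP] := valP lam.
have idxP (k : 'I_n) : (reshape_index sh k < n)%N.
  by rewrite -[X in (_ < X)%N]szsh reshape_indexP // sumsh.
have offP (k : 'I_n) : (reshape_offset sh k < part lam (reshape_index sh k))%N.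
  by apply: reshape_offsetP; rewrite sumsh.
have offn (k : 'I_n) : (reshape_offset sh k < n)%N by exact: leq_trans (offP k) (part_le _ _).
pose F : {ffun 'I_n -> 'I_n * 'I_n} := [ffun k => (Ordinal (idxP k), Ordinal (offn k))].
have key (k : 'I_n) : (k = sumn (take (reshape_index sh k) sh) + reshape_offset sh k :> nat)%N.
  by rewrite -[LHS](reshape_indexK sh).
suff st : standard lam F by apply/card_gt0P; exists (Syt st).
apply/and4P; split.
- apply/injectiveP => k l; rewrite !ffunE => -[e1 e2]; apply: val_inj.
  by rewrite /= (key k) (key l) e1 e2.
- by apply/forallP => k; rewrite ffunE /in_diagram /=; exact: offP.
- apply/forallP => k; apply/forallP => l; apply/implyP; rewrite !ffunE => /andP[/eqP[e1] /= lt].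
  by rewrite (key k) (key l) e1 ltn_add2l.
- apply/forallP => k; apply/forallP => l; apply/implyP; rewrite !ffunE => /andP[_ /= lt].
  rewrite (key k) (key l) ltn_addr //.
  have := offP k; rewrite /part -/sh => h.
  have rk : (reshape_index sh k < size sh)%N by rewrite szsh.
  apply: leq_trans (_ : sumn (take (reshape_index sh k).+1 sh) <= _)%N.
    by rewrite (take_nth 0%N) // sumn_rcons ltn_add2l.
  rewrite -(cat_take_drop (reshape_index sh k).+1 (take (reshape_index sh l) sh)).
  by rewrite sumn_cat take_takel // leq_addr.
Qed.

(** * Cycle types and Plancherel averages *)

Section PermExtension.
Variable T : finType.

(** The complements of D and of its image have equal size, and their enumerations are matched in
    order. *)
Lemma perm_extend (D : {set T}) (f : T -> T) : {in D &, injective f} ->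
  exists p : {perm T}, {in D, p =1 f}.
Proof.
move=> f_inj; pose E := enum (~: D); pose F := enum (~: (f @: D)).
have szEF : size E = size F.
  rewrite -!cardE; have := cardsC D; have := cardsC (f @: D).
  by rewrite (card_in_imset f_inj); lia.
pose q x := if x \in D then f x else nth x F (index x E).
have qF x : x \notin D -> q x \in ~: (f @: D).
  move=> xD; rewrite /q (negPf xD) -mem_enum mem_nth // -szEF index_mem mem_enum.
  by rewrite inE.
have q_inj : injective q.
  move=> x y; have [xD|xD] := boolP (x \in D); have [yD|yD] := boolP (y \in D).
  - by rewrite /q xD yD; exact: f_inj.
  - move=> e; have := qF y yD; rewrite -e /q xD inE => /negP[]; exact: imset_f.
  - move=> e; have := qF x xD; rewrite e /q yD inE => /negP[]; exact: imset_f.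
  have xE : (index x E < size F)%N by rewrite -szEF index_mem mem_enum inE.
  have yE : (index y E < size F)%N by rewrite -szEF index_mem mem_enum inE.
  rewrite /q (negPf xD) (negPf yD) (set_nth_default x y) // => /eqP.
  rewrite nth_uniq ?enum_uniq // => /eqP e.
  have xE' : x \in E by rewrite mem_enum inE.
  have yE' : y \in E by rewrite mem_enum inE.
  by rewrite -(nth_index x xE') e nth_index.
exists (perm q_inj) => x xD; by rewrite permE /q xD.
Qed.

Definition orbit_size (s : {perm T}) (x : T) : nat := #|porbit s x|.
(** The number k m_k of points lying on k-cycles. Counting points instead of cycles makes the
    quantity additive when a stable set is split off. *)
Definition orbit_pts (s : {perm T}) (k : nat) : nat := #|[set x | orbit_size s x == k]|.

Lemma iter_orbit_mod (s : {perm T}) x i : iter i s x = iter (i %% orbit_size s x) s x.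
Proof.
rewrite {1}(divn_eq i (orbit_size s x)) addnC iterD; congr (iter _ _ _).
by elim: (i %/ _)%N => // q IH; rewrite mulSn iterD IH iter_porbit.
Qed.

Lemma iter_orbit_inj (s : {perm T}) x i j : iter i s x = iter j s x ->
  (i %% orbit_size s x = j %% orbit_size s x)%N.
Proof.
have k0 : (0 < orbit_size s x)%N by rewrite lt0n card_porbit_neq0.
rewrite iter_orbit_mod (iter_orbit_mod s x j) => e.
apply/eqP; rewrite -(@nth_uniq _ x (traject s x (orbit_size s x))) ?size_traject ?ltn_pmod //.
  by rewrite !nth_traject ?ltn_pmod // e.
exact: uniq_traject_porbit.
Qed.

Lemma mem_orbit_iter (s : {perm T}) x y : y \in porbit s x -> exists i, y = iter i s x.
Proof. by case/porbitP => i ->; exists i; rewrite permX. Qed.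

Lemma iter_mem_orbit (s : {perm T}) x i : iter i s x \in porbit s x.
Proof. by rewrite -permX mem_porbit. Qed.

Lemma orbit_size_eq (s : {perm T}) x y : y \in porbit s x -> orbit_size s y = orbit_size s x.
Proof. by rewrite -eq_porbit_mem => /eqP; rewrite /orbit_size => ->. Qed.

Lemma iter_conj (t p : {perm T}) i z : iter i (t ^ p)%g (p z) = p (iter i t z).
Proof. by elim: i => //= i ->; rewrite permJ. Qed.

Lemma orbit_sizeJ (t p : {perm T}) z : orbit_size (t ^ p)%g (p z) = orbit_size t z.
Proof.
rewrite /orbit_size -[RHS](card_imset _ (@perm_inj _ p)); apply: eq_card => y.
apply/idP/imsetP => [/mem_orbit_iter[i ->]|[w /mem_orbit_iter[i ->] ->]].
  by exists (iter i t z); rewrite ?iter_mem_orbit // iter_conj.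
by rewrite -iter_conj iter_mem_orbit.
Qed.

Lemma orbit_ptsJ (t p : {perm T}) k : orbit_pts (t ^ p)%g k = orbit_pts t k.
Proof.
rewrite /orbit_pts -[RHS](card_imset _ (@perm_inj _ p)); apply: eq_card => y.
apply/idP/imsetP => [|[w]]; rewrite !inE => h.
  by exists ((p^-1)%g y); rewrite ?permKV // inE -(orbit_sizeJ t p) permKV.
by move=> ->; rewrite orbit_sizeJ.
Qed.

(* Conjugates t so that it agrees with s on one more cycle at a time. *)
Lemma perm_conj_aux (s : {perm T}) d : forall (t : {perm T}) (A : {set T}),
  {in A, forall x, (s x \in A) && (t x == s x)} -> (#|~: A| <= d)%N ->
  (forall k, orbit_pts s k = orbit_pts t k) -> exists p, (t ^ p)%g = s.
Proof.
elim: d => [|d IH] t A stA cA cnt.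
  exists 1%g; rewrite conjg1; apply/permP => x.
  have : x \in A.
    by apply/negPn/negP => xA; have /card_gt0P : exists x, x \in ~: A by [exists x; rewrite inE]; lia.
  by case/stA/andP => _ /eqP.
have [x /= xA|allA] := pickP [pred x | x \notin A]; last first.
  apply: (IH t A stA _ cnt); rewrite (@eq_card0 _ (mem (~: A))) // => x.
  by rewrite inE; exact: allA.
have sAE y : (s y \in A) = (y \in A).
  apply/idP/idP => [sy|/stA/andP[]//].
  have : s @: A = A.
    apply/eqP; rewrite eqEcard card_imset ?leqnn ?andbT; last exact: perm_inj.
    by apply/fintype.subsetP => _ /imsetP[z /stA/andP[zA _] ->].
  by move=> e; move: sy; rewrite -{1}e => /imsetP[z zA /perm_inj ->].
have itA y i : y \in A -> (iter i s y \in A) && (iter i t y == iter i s y).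
  move=> yA; elim: i => [|i /andP[h1 /eqP h2]]; first by rewrite /= yA eqxx.
  by rewrite /= h2; exact: stA.
have itAE y i : (iter i s y \in A) = (y \in A) by elim: i => //= i; rewrite sAE.
have tAE y : (t y \in A) = (y \in A).
  apply/idP/idP => [ty|/[dup] yA /stA/andP[h /eqP->]//].
  have : t @: A = A.
    apply/eqP; rewrite eqEcard card_imset ?leqnn ?andbT; last exact: perm_inj.
    by apply/fintype.subsetP => _ /imsetP[z /stA/andP[zA /eqP e] ->]; rewrite e.
  by move=> e; move: ty; rewrite -{1}e => /imsetP[z zA /perm_inj ->].
have ittAE y i : (iter i t y \in A) = (y \in A) by elim: i => //= i; rewrite tAE.
have szA y : y \in A -> orbit_size s y = orbit_size t y.
  move=> yA; apply: eq_card => z; apply/idP/idP => /mem_orbit_iter[i ->].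
    by have /andP[_ /eqP <-] := itA y i yA; exact: iter_mem_orbit.
  by have /andP[_ /eqP ->] := itA y i yA; exact: iter_mem_orbit.
pose k := orbit_size s x.
(* A is a union of cycles on which s and t coincide, so outside A the two permutations still have
   equally many points on k-cycles. *)
have [y] : exists y, y \in [set y | orbit_size t y == k] :\: A.
  apply/card_gt0P; have : (0 < #|[set y | orbit_size s y == k] :\: A|)%N.
    by apply/card_gt0P; exists x; rewrite !inE xA eqxx.
  rewrite !cardsD; have := cnt k; rewrite /orbit_pts => ->.
  suff -> : [set y | orbit_size s y == k] :&: A = [set y | orbit_size t y == k] :&: A by [].
  by apply/finset.setP => y; rewrite !inE; case: (boolP (y \in A)) => yA; rewrite ?andbF // szA.
rewrite !inE => /andP[yA /eqP yk].
pose f z := if z \in A then z else iter (index z (traject t y k)) s x.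
have fE i : f (iter i t y) = iter i s x.
  rewrite /f ittAE (negPf yA) (iter_orbit_mod t y i) yk (iter_orbit_mod s x i) -/k.
  have ik : (i %% k < k)%N by rewrite ltn_pmod // lt0n card_porbit_neq0.
  rewrite -(nth_traject t ik) index_uniq ?size_traject //.
  by rewrite -yk; exact: uniq_traject_porbit.
have [p pE] : exists p : {perm T}, {in A :|: porbit t y, p =1 f}.
  apply: perm_extend => z w; rewrite !inE => /orP[zA|/mem_orbit_iter[i ->]] /orP[wA|/mem_orbit_iter[j ->]].
  - by rewrite /f zA wA.
  - by rewrite fE /f zA => e; move: zA; rewrite e itAE (negPf xA).
  - by rewrite fE /f wA => e; move: wA; rewrite -e itAE (negPf xA).
  - rewrite !fE => /iter_orbit_inj e.
    by rewrite (iter_orbit_mod t y i) (iter_orbit_mod t y j) yk e.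
have pA z : z \in A -> p z = z by move=> zA; rewrite pE ?inE ?zA // /f zA.
have pO i : p (iter i t y) = iter i s x by rewrite pE ?fE // inE iter_mem_orbit orbT.
have [|||q qE] := IH (t ^ p)%g (A :|: porbit s x).
- move=> z; rewrite !inE => /orP[zA|/mem_orbit_iter[i ->]].
    have /andP[h1 /eqP h2] := stA z zA.
    by rewrite h1 /= -{1}(pA z zA) permJ h2 pA.
  rewrite -[s (iter i s x)]/(iter i.+1 s x) iter_mem_orbit orbT /=.
  by rewrite -{1}pO permJ -[t (iter i t y)]/(iter i.+1 t y) pO.
- have : (#|~: (A :|: porbit s x)| < #|~: A|)%N; last by lia.
  apply: proper_card; rewrite properE finset.setCS finset.subsetUl /=; apply/fintype.subsetPn.
  by exists x; rewrite !inE ?xA // porbit_id orbT.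
- by move=> j; rewrite orbit_ptsJ.
by exists (p * q)%g; rewrite conjgM.
Qed.

Lemma perm_conj (s t : {perm T}) : (forall k, orbit_pts s k = orbit_pts t k) ->
  exists p, (t ^ p)%g = s.
Proof.
move=> cnt; apply: (@perm_conj_aux s #|~: (finset.set0 : {set T})| t finset.set0) => //.
by move=> x; rewrite inE.
Qed.

Lemma orbit_ptsE (s : {perm T}) k :
  orbit_pts s k = (k * count_mem k [seq #|pred_of_set c| | c <- enum (porbits s)])%N.
Proof.
rewrite /orbit_pts -sum1dep_card.
rewrite (partition_big (porbit s) (mem (porbits s))) /=; last by move=> x _; exact: imset_f.
rewrite (eq_bigr (fun c : {set T} => if #|c| == k then k else 0)%N); last first.
  move=> c /imsetP[x _ ->]; rewrite -[#|_|]/(orbit_size s x).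
  rewrite (eq_bigl (fun y => (orbit_size s x == k) && (y \in porbit s x))).
    by case: eqP => e /=; rewrite ?big_pred0_eq // sum1_card -[LHS]/(orbit_size s x).
  move=> y; rewrite eq_porbit_mem.
  case: (boolP (y \in porbit s x)) => [/orbit_size_eq -> |]; rewrite ?andbT ?andbF //.
rewrite -big_mkcondr /= sum_nat_const mulnC; congr (_ * _)%N.
rewrite count_map cardE /enum_mem size_filter count_filter; apply: eq_count => c /=.
by rewrite andbC.
Qed.

Lemma sum_orbits (s : {perm T}) : sumn [seq #|pred_of_set c| | c <- enum (porbits s)] = #|T|.
Proof.
rewrite sumnE big_map big_enum /= -sum1_card (partition_big (porbit s) (mem (porbits s))) /=.
  apply: eq_bigr => c /imsetP[x _ ->]; rewrite -sum1_card; apply: eq_bigl => y.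
  by rewrite eq_porbit_mem.
by move=> x _; exact: imset_f.
Qed.

End PermExtension.

(** * Cycle types as partitions *)

Section CycleType.
Variable n : nat.

Lemma cycle_type_pos (s : 'S_n) : all (leq 1) (cycle_type s).
Proof.
rewrite /cycle_type all_sort all_map; apply/allP => c; rewrite mem_enum => /imsetP[x _ ->] /=.
by rewrite lt0n card_porbit_neq0.
Qed.

Lemma sumn_cycle_type (s : 'S_n) : sumn (cycle_type s) = n.
Proof. by rewrite /cycle_type (perm_sumn (permEl (perm_sort _ _))) sum_orbits card_ord. Qed.

Lemma size_cycle_type (s : 'S_n) : (size (cycle_type s) <= n)%N.
Proof.
rewrite -[leqRHS](sumn_cycle_type s); move: (cycle_type_pos s).
by elim: (cycle_type s) => //= k r IH /andP[k0 /IH]; lia.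
Qed.

Lemma orbit_pts_cycle_type (s : 'S_n) k : orbit_pts s k = (k * multiplicity k (cycle_type s))%N.
Proof.
rewrite orbit_ptsE /multiplicity /cycle_type; congr (_ * _)%N.
by apply/seq.permP; rewrite perm_sym perm_sort.
Qed.

Definition padded_type (s : 'S_n) : seq nat := cycle_type s ++ nseq (n - size (cycle_type s)) 0%N.

Definition cycle_tuple (s : 'S_n) : n.-tuple 'I_n.+1 :=
  [tuple (inord (nth 0%N (cycle_type s) i) : 'I_n.+1) | i < n].

Lemma cycle_part_subproof (s : 'S_n) :
  sorted geq (map val (cycle_tuple s)) && (sumn (map val (cycle_tuple s)) == n).
Proof.
have -> : map val (cycle_tuple s) = padded_type s.
  apply: (@eq_from_nth _ 0%N).
    by rewrite size_map size_tuple /padded_type size_cat size_nseq subnKC // size_cycle_type.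
  move=> i; rewrite size_map size_tuple => ilt.
  rewrite (nth_map ord0) ?size_tuple // -[i]/(val (Ordinal ilt)) -tnth_nth tnth_mktuple.
  rewrite /= inordK; last first.
    rewrite ltnS -[leqRHS](sumn_cycle_type s).
    have [h|h] := ltnP i (size (cycle_type s)); last by rewrite nth_default.
    have := mem_nth 0%N h; move: (nth _ _ _) => y.
    elim: (cycle_type s) => //= a l IH; rewrite inE => /orP[/eqP->|/IH]; lia.
  by rewrite /padded_type nth_cat; case: ltnP => h; rewrite ?nth_nseq ?if_same // nth_default.
have geq_tr : transitive geq by move=> x y z /= yx zy; exact: leq_trans yx.
apply/andP; split.
  rewrite sorted_pairwise // /padded_type pairwise_cat; apply/and3P; split.
  - by apply/allrelP => x y _; rewrite mem_nseq => /andP[_ /eqP->].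
  - by rewrite -sorted_pairwise // /cycle_type sort_sorted // => x y /=; exact: leq_total.
  - by elim: (n - _)%N => //= k ->; rewrite andbT; apply/allP => x; rewrite mem_nseq => /andP[_ /eqP->].
by rewrite /padded_type sumn_cat sumn_cycle_type sumn_nseq mul0n addn0.
Qed.

(** Putting cycle types in the type that indexes the representations makes the character table a
    square matrix. *)
Definition cycle_part (s : 'S_n) : intpart n := IntPart (cycle_part_subproof s).

Lemma cycle_part_conj (s t : 'S_n) : cycle_part s = cycle_part t -> exists p, (t ^ p)%g = s.
Proof.
move=> /(congr1 val) /= e; apply: perm_conj => k.
have nthE i : (i < n)%N -> nth 0%N (cycle_type s) i = nth 0%N (cycle_type t) i.
  move=> ilt; have := congr1 (fun u => val (tnth u (Ordinal ilt))) e.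
  have le (r : 'S_n) : (nth 0%N (cycle_type r) i < n.+1)%N.
    rewrite ltnS -[leqRHS](sumn_cycle_type r).
    have [h|h] := ltnP i (size (cycle_type r)); last by rewrite nth_default.
    have := mem_nth 0%N h; move: (nth _ _ _) => y.
    elim: (cycle_type r) => //= a l IH; rewrite inE => /orP[/eqP->|/IH]; lia.
  by rewrite !tnth_mktuple /= !inordK.
suff st : cycle_type s = cycle_type t by rewrite !orbit_pts_cycle_type st.
have aux (a b : 'S_n) : (forall i, (i < n)%N -> nth 0%N (cycle_type a) i = nth 0%N (cycle_type b) i) ->
    (size (cycle_type a) <= size (cycle_type b))%N.
  move=> ab; rewrite leqNgt; apply/negP => lt.
  have := ab (size (cycle_type b)) (leq_trans lt (size_cycle_type a)).
  rewrite [in RHS]nth_default // => z.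
  by have /allP/(_ _ (mem_nth 0%N lt)) := cycle_type_pos a; rewrite z.
apply: (@eq_from_nth _ 0%N).
  by apply/eqP; rewrite eqn_leq !aux // => i /nthE.
by move=> i ilt; apply: nthE; exact: leq_trans ilt (size_cycle_type s).
Qed.

End CycleType.

(** * Character orthogonality and Plancherel expectations *)

Section Plancherel.
Variables (R : realType) (n : nat).
Implicit Types (lam mu : intpart n) (g : 'S_n).

Definition chi lam g : R := \tr (young_rep lam g).

Lemma chiV lam g : chi lam g^-1%g = chi lam g.
Proof. by rewrite /chi -young_rep_tr mxtrace_tr. Qed.

Lemma chiJ lam g x : chi lam (g ^ x)%g = chi lam g.
Proof. by rewrite /chi young_repJ mxtrace_mulC mulmxA young_repVr mul1mx. Qed.

Definition avg lam mu (E : 'M[R]_(Defs.dim lam, Defs.dim mu)) : 'M[R]_(Defs.dim lam, Defs.dim mu) :=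
  \sum_g young_rep lam g *m E *m young_rep mu g^-1%g.

Lemma avg_intertwine lam mu (E : 'M[R]_(Defs.dim lam, Defs.dim mu)) (k : 'I_n.-1) :
  young_gen lam k *m avg E = avg E *m young_gen mu k.
Proof.
rewrite -!young_rep_adj /avg mulmx_sumr mulmx_suml.
rewrite [RHS](reindex_inj (mulIg (adj k))) /=; apply: eq_bigr => g _.
rewrite !young_repM invMg young_repM -!mulmxA; congr (_ *m (_ *m (_ *m _))).
by rewrite young_repVr mulmx1.
Qed.

Lemma avg_delta lam mu i j i' j' :
  avg (delta_mx i j : 'M[R]_(Defs.dim lam, Defs.dim mu)) i' j' =
  \sum_g young_rep lam g i' i * young_rep mu g^-1%g j j'.
Proof.
rewrite summxE; apply: eq_bigr => g _; rewrite mxE (bigD1 j) //= big1 ?addr0.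
  rewrite mxE (bigD1 i) //= big1 ?addr0; first by rewrite mxE !eqxx mulr1.
  by move=> a ai; rewrite mxE (negPf ai) mulr0.
move=> b bj; rewrite mxE big1 ?mul0r // => a _.
by rewrite mxE (negPf bj) andbF mulr0.
Qed.

(** The group averages of the matrix units are intertwiners. Between different shapes they vanish;
    within one shape they are scalar, and the trace of the unit, preserved by averaging, gives the
    scalar. *)
Lemma chi_orth lam mu : \sum_g chi lam g * chi mu g = (lam == mu)%:R * n`!%:R.
Proof.
transitivity (\sum_i \sum_j avg (delta_mx i j : 'M[R]_(Defs.dim lam, Defs.dim mu)) i j).
  transitivity (\sum_g \sum_i \sum_j young_rep lam g i i * young_rep mu g^-1%g j j : R).
    apply: eq_bigr => g _; rewrite -(chiV mu) /chi /mxtrace mulr_suml.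
    by apply: eq_bigr => i _; rewrite mulr_sumr.
  rewrite exchange_big /=; apply: eq_bigr => i _; rewrite exchange_big /=.
  by apply: eq_bigr => j _; rewrite avg_delta.
case: eqP => [<-|/eqP ne]; last first.
  rewrite mul0r big1 // => i _; rewrite big1 // => j _.
  by rewrite (@schur_zero R n lam mu (avg (delta_mx i j))) ?mxE // => k; exact: avg_intertwine.
have d0 : (Defs.dim lam)%:R != 0 :> R by rewrite pnatr_eq0 -lt0n dim_gt0.
have avgE (i j : 'I_(Defs.dim lam)) :
    avg (delta_mx i j) i j = (i == j)%:R * (n`!%:R / (Defs.dim lam)%:R) :> R.
  have [||h1 h2] := @schur_block R n lam n (avg (delta_mx i j)).
  - by move=> k _; exact: avg_intertwine.
  - by move=> T S; rewrite agree_all.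
  have [ij|ij] := eqVneq i j; last first.
    have := h1 (tnth (syt_enum lam) i) (tnth (syt_enum lam) j).
    rewrite !tnth_syt_idx mul0r; apply.
    by apply: contra_neq ij => /(congr1 (@syt_idx _ _)); rewrite !tnth_syt_idx.
  subst j; rewrite mul1r; apply: (mulIf d0); rewrite divfK //.
  transitivity (\tr (avg (delta_mx i i) : 'M[R]_(Defs.dim lam))).
    rewrite /mxtrace sum_syt (eq_bigr (fun=> avg (delta_mx i i) i i)).
      by rewrite sumr_const mulr_natr.
    move=> T _; have := h2 T (tnth (syt_enum lam) i) (agree_all _ _).
    by rewrite tnth_syt_idx.
  rewrite /avg raddf_sum /= (eq_bigr (fun=> 1)).
    by rewrite sumr_const card_Sn.
  move=> g _; rewrite mxtrace_mulC mulmxA young_repVr mul1mx.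
  rewrite /mxtrace (bigD1 i) //= big1 ?addr0; first by rewrite mxE eqxx.
  by move=> a ai; rewrite mxE (negPf ai).
rewrite (eq_bigr (fun=> n`!%:R / (Defs.dim lam)%:R)).
  by rewrite sumr_const card_ord mul1r -[LHS]mulr_natr divfK.
move=> i _; rewrite (bigD1 i) //= big1 ?addr0; first by rewrite avgE eqxx mul1r.
by move=> j ji; rewrite avgE eq_sym (negPf ji) mul0r.
Qed.

(** The default value is harmless in the sums below: a type with no representative would come with
    class size 0. *)
Definition type_rep (nu : intpart n) : 'S_n := odflt 1%g [pick g | cycle_part g == nu].

Lemma type_repP g : exists x, (g ^ x)%g = type_rep (cycle_part g).
Proof.
apply: cycle_part_conj; rewrite /type_rep; case: pickP => /= [h /eqP //|/(_ g)].
by rewrite eqxx.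
Qed.

Lemma chi_type lam g : chi lam (type_rep (cycle_part g)) = chi lam g.
Proof. by have [x <-] := type_repP g; rewrite chiJ. Qed.

(* The character table, with columns weighted by class sizes, has orthonormal
   rows; as it is square its columns are orthonormal too. *)
Lemma chi_dim_sum g : \sum_lam (Defs.dim lam)%:R * chi lam g = (g == 1%g)%:R * n`!%:R.
Proof.
have f0 : (n`!%:R : R) != 0 by rewrite pnatr_eq0 -lt0n fact_gt0.
pose p := #|{: intpart n}|.
pose w (nu : intpart n) : R := #|[pred g : 'S_n | cycle_part g == nu]|%:R.
pose A : 'M[R]_p := \matrix_(i, j) chi (enum_val i) (type_rep (enum_val j)).
pose B : 'M[R]_p := \matrix_(j, i) (w (enum_val j) * chi (enum_val i) (type_rep (enum_val j)) / n`!%:R).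
have AB : A *m B = 1%:M.
  apply/matrixP => i k; rewrite !mxE.
  transitivity ((\sum_g chi (enum_val i) g * chi (enum_val k) g) / n`!%:R).
    rewrite (partition_big (@cycle_part n) predT) //= mulr_suml.
    rewrite (reindex (@enum_val _ {: intpart n})) /=; last first.
      by exists enum_rank => x _; rewrite ?enum_valK ?enum_rankK.
    apply: eq_bigr => j _; rewrite !mxE !mulrA; congr (_ / _).
    transitivity (\sum_(g | cycle_part g == enum_val j)
        chi (enum_val i) (type_rep (enum_val j)) * chi (enum_val k) (type_rep (enum_val j))).
      by rewrite sumr_const -[RHS]mulr_natl /w mulrAC mulrC mulrA.
    by apply: eq_bigr => g' /eqP <-; rewrite !chi_type.
  by rewrite chi_orth (inj_eq enum_val_inj) -mulrA divff ?mulr1.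
have BA := mulmx1C AB.
have key (nu nu' : intpart n) :
    w nu * (\sum_lam chi lam (type_rep nu) * chi lam (type_rep nu')) = (nu == nu')%:R * n`!%:R.
  have := congr1 (fun M : 'M[R]_p => M (enum_rank nu) (enum_rank nu') * n`!%:R) BA.
  rewrite !mxE (inj_eq enum_rank_inj) => <-; rewrite mulr_sumr mulr_suml.
  rewrite (reindex (@enum_val _ {: intpart n})) /=; last first.
    by exists enum_rank => x _; rewrite ?enum_valK ?enum_rankK.
  by apply: eq_bigr => i _; rewrite !mxE !enum_rankK; field.
have rep1 : type_rep (cycle_part 1%g) = 1%g.
  by have [x <-] := type_repP 1%g; rewrite conj1g.
have cp1 g' : (cycle_part g' == cycle_part 1%g) = (g' == 1%g).
  by apply/eqP/eqP => [/cycle_part_conj[x]|-> //]; rewrite conj1g.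
have := key (cycle_part 1%g) (cycle_part g).
have -> : w (cycle_part 1%g) = 1.
  by rewrite /w (eq_card (B := pred1 1%g)) ?card1 // => x; rewrite !inE cp1.
rewrite mul1r rep1 eq_sym cp1 => <-; apply: eq_bigr => lam _; rewrite chi_type.
by congr (_ * _); rewrite /chi young_rep1 mxtrace1.
Qed.

Definition Ex (F : intpart n -> R) : R := \sum_lam plancherel lam * F lam.

Lemma plancherel_ge0 lam : 0 <= plancherel lam :> R.
Proof. by rewrite /plancherel divr_ge0 // exprn_ge0. Qed.

Lemma Ex_nchar g : Ex (fun lam => nchar R lam g) = (g == 1%g)%:R.
Proof.
have f0 : (n`!%:R : R) != 0 by rewrite pnatr_eq0 -lt0n fact_gt0.
apply: (mulIf f0); rewrite -chi_dim_sum /Ex mulr_suml; apply: eq_bigr => lam _.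
have d0 : (Defs.dim lam)%:R != 0 :> R by rewrite pnatr_eq0 -lt0n dim_gt0.
by rewrite /plancherel /nchar -/(chi lam g); field; rewrite f0 d0.
Qed.

Lemma Ex1 : Ex (fun=> 1) = 1.
Proof.
rewrite -[RHS]/(true%:R) -(eqxx (1%g : 'S_n)) -Ex_nchar /Ex; apply: eq_bigr => lam _.
rewrite /nchar young_rep1 mxtrace1 divff // pnatr_eq0 -lt0n; exact: dim_gt0.
Qed.

Lemma ExD F G : Ex (fun lam => F lam + G lam) = Ex F + Ex G.
Proof. by rewrite /Ex -big_split /=; apply: eq_bigr => lam _; rewrite mulrDr. Qed.

Lemma ExZ c F : Ex (fun lam => c * F lam) = c * Ex F.
Proof. by rewrite /Ex mulr_sumr; apply: eq_bigr => lam _; rewrite mulrCA. Qed.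

Lemma Ex_sum (I : finType) (P : pred I) (F : I -> intpart n -> R) :
  Ex (fun lam => \sum_(i | P i) F i lam) = \sum_(i | P i) Ex (F i).
Proof. by rewrite /Ex exchange_big /=; apply: eq_bigr => lam _; rewrite mulr_sumr. Qed.

Lemma Ex_le F G : (forall lam, F lam <= G lam) -> Ex F <= Ex G.
Proof. by move=> FG; apply: ler_sum => lam _; apply: ler_wpM2l; rewrite ?plancherel_ge0. Qed.

Lemma eq_Ex F G : (forall lam, F lam = G lam) -> Ex F = Ex G.
Proof. by move=> FG; apply: eq_bigr => lam _; rewrite FG. Qed.

Lemma Ex_norm F : `|Ex F| <= Ex (fun lam => `|F lam|).
Proof.
apply: le_trans (ler_norm_sum _ _ _) _; apply: ler_sum => lam _.
by rewrite normrM ger0_norm ?plancherel_ge0.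
Qed.

Definition inv_prob (m : nat) g : R :=
  #|[pred x : 'S_n | perm_on (low n m) x && (g ^ x == g^-1)%g]|%:R / m`!%:R.

(** The expectation turns each trace of [sum_bchar2] into the indicator of g^x g^y = 1; translating
    one conjugator by the other leaves a single count over S_m. *)
Lemma Ex_bchar2 m g : (m <= n)%N -> perm_on (low n m) g ->
  Ex (fun lam => (\sum_(T : syt lam) bchar R m T g ^+ 2) / (Defs.dim lam)%:R) = inv_prob m g.
Proof.
move=> mn gm; have f0 : (m`!%:R : R) != 0 by rewrite pnatr_eq0 -lt0n fact_gt0.
under eq_Ex => lam.
  rewrite sum_bchar2 // -mulrA mulr_suml; under eq_bigr do rewrite mulr_suml.
  over.
rewrite /= ExZ Ex_sum; under eq_bigr do rewrite Ex_sum.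
transitivity ((m`!%:R ^+ 2)^-1 * \sum_(x : 'S_n | perm_on (low n m) x)
   (#|[pred x : 'S_n | perm_on (low n m) x && (g ^ x == g^-1)%g]|%:R : R)).
  congr (_ * _); apply: eq_bigr => x xm.
  rewrite (eq_bigr (fun y : 'S_n => (g ^ (y * x^-1) == g^-1)%g%:R : R)); last first.
    move=> y ym; rewrite [LHS]Ex_nchar; congr (_%:R); congr (nat_of_bool _).
    rewrite -eq_invg_mul eq_sym conjgM -[X in _ = (_ == X)](conjgK x) conjVg.
    by rewrite (inj_eq (@conjg_inj _ x^-1)%g).
  rewrite (reindex_inj (mulIg x)) /= -natr_sum -sum1_card; congr (_%:R).
  rewrite big_mkcond [RHS]big_mkcond /=; apply: eq_bigr => y _.
  by rewrite perm_on_mulgr // mulgK inE; case: ifP => //= _; case: (_ == _).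
rewrite /inv_prob; set c : R := #|[pred x : 'S_n | perm_on (low n m) x && _]|%:R.
transitivity ((m`!%:R ^+ 2)^-1 * (c * m`!%:R)); last by field.
congr (_ * _); rewrite sumr_const -[LHS]mulr_natr; congr (_ * _%:R).
by rewrite -(card_low mn); apply: eq_card.
Qed.

End Plancherel.

(** * Supports and orbits of extended permutations *)

Section Extend.
Variables (r n : nat).
Hypothesis rn : (r <= n)%N.
Implicit Types (s t : 'S_r).

Lemma extend_widen s i : extend n s (widen_ord rn i) = widen_ord rn (s i).
Proof.
rewrite extendE // /extend_fun [insub _](valK i).
apply: val_inj; rewrite val_insubd /= ifT //; exact: leq_trans (ltn_ord _) rn.
Qed.

Lemma extend_out s (i : 'I_n) : (r <= i)%N -> extend n s i = i.
Proof. by move=> ri; rewrite extendE // /extend_fun insubF //; apply/negbTE; rewrite -leqNgt. Qed.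

Lemma widen_split (P : 'I_n -> Prop) : (forall i : 'I_r, P (widen_ord rn i)) ->
  (forall i : 'I_n, (r <= i)%N -> P i) -> forall i, P i.
Proof.
move=> h1 h2 i; have [/h2//|ir] := leqP r i.
by have -> : i = widen_ord rn (Ordinal ir) by exact: val_inj.
Qed.

Lemma widen_or (i : 'I_n) : (exists j, i = widen_ord rn j) \/ (r <= i)%N.
Proof.
have [|ir] := leqP r i; first by right.
by left; exists (Ordinal ir); exact: val_inj.
Qed.

Lemma extendM s t : extend n (s * t)%g = (extend n s * extend n t)%g.
Proof.
apply/permP; apply: widen_split => i; rewrite permM; first by rewrite !extend_widen permM.
by move=> ri; rewrite !extend_out.
Qed.

Lemma extend1 : extend n (1%g : 'S_r) = 1%g.
Proof.
apply/permP; apply: widen_split => i; rewrite perm1; first by rewrite extend_widen perm1.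
by move=> ri; rewrite !extend_out.
Qed.

Lemma extendV s : extend n s^-1%g = (extend n s)^-1%g.
Proof. by apply/eqP; rewrite eq_sym eq_invg_mul -extendM mulgV extend1. Qed.

Lemma widen_inj : injective (widen_ord rn).
Proof. by move=> i j /(congr1 val) /= e; exact: val_inj. Qed.

Lemma extend_inj : injective (@extend r n).
Proof.
move=> s t st; apply/permP => i; apply: widen_inj.
by rewrite -!extend_widen st.
Qed.

Lemma extend_low s : perm_on (low n r) (extend n s).
Proof.
apply/fintype.subsetP => i; rewrite !inE; apply: contraR; rewrite -leqNgt => ri.
by rewrite extend_out.
Qed.

Lemma orbit_size_extend s i : orbit_size (extend n s) (widen_ord rn i) = orbit_size s i.
Proof.
rewrite /orbit_size -[RHS](card_imset _ widen_inj); apply: eq_card => y.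
have it e j : iter e (extend n s) (widen_ord rn j) = widen_ord rn (iter e s j).
  by elim: e => //= e ->; rewrite extend_widen.
apply/idP/imsetP => [/mem_orbit_iter[e ->]|[w /mem_orbit_iter[e ->] ->]].
  by exists (iter e s i); rewrite ?iter_mem_orbit // it.
by rewrite -it iter_mem_orbit.
Qed.

End Extend.

(** * Supports of products *)

Section Support.
Variable T : finType.
Implicit Types (s t x : {perm T}).

Definition psupp s : {set T} := [set i | s i != i].

Lemma orbit_size1 s i : (orbit_size s i == 1%N) = (s i == i).
Proof.
apply/idP/eqP => [/eqP o1|si].
  by have := iter_porbit s i; rewrite -/(orbit_size s i) o1.
apply/cards1P; exists i; apply/finset.setP => y; rewrite inE; apply/idP/eqP => [|->].
  by case/mem_orbit_iter => e ->; elim: e => //= e ->.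
exact: porbit_id.
Qed.

Lemma orbit_size_gt0 s i : (0 < orbit_size s i)%N.
Proof. by rewrite lt0n card_porbit_neq0. Qed.

Lemma orbit_size_ge2 s i : (2 <= orbit_size s i)%N = (i \in psupp s).
Proof. by rewrite inE -orbit_size1; have := orbit_size_gt0 s i; lia. Qed.

Lemma orbit_size_le s i : (orbit_size s i <= #|T|)%N.
Proof. exact: max_card. Qed.

Lemma card_psupp s M : (#|T| <= M)%N -> #|psupp s| = (\sum_(2 <= k < M.+1) orbit_pts s k)%N.
Proof.
move=> TM; rewrite -sum1_card.
transitivity (\sum_(2 <= k < M.+1) \sum_(i | orbit_size s i == k) 1)%N; last first.
  by apply: eq_bigr => k _; rewrite sum1dep_card.
rewrite (exchange_big_dep xpredT) //= [LHS]big_mkcond /=.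
apply: eq_bigr => i _; rewrite -orbit_size_ge2.
rewrite -big_filter; case: ifP => h.
  rewrite (_ : [seq k <- _ | _] = [:: orbit_size s i]) ?big_seq1 //.
  rewrite -(filter_pred1_uniq (iota_uniq 2 (M.+1 - 2)) (_ : orbit_size s i \in _)).
    by rewrite /index_iota; apply: eq_filter => k /=; rewrite eq_sym.
  by rewrite mem_iota; have := orbit_size_le s i; lia.
rewrite big1_seq // => k /andP[_]; rewrite mem_filter mem_index_iota => /and3P[/eqP <- h2 _].
by rewrite h2 in h.
Qed.

Lemma orbit_pts_sum s : (orbit_pts s 1 + #|psupp s|)%N = #|T|.
Proof.
rewrite -(cardsC (psupp s)) addnC; congr (_ + _)%N; apply: eq_card => i.
by rewrite !inE orbit_size1 negbK.
Qed.

Lemma orbit_pts0 s : orbit_pts s 0 = 0%N.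
Proof. by apply: eq_card0 => i; rewrite inE -leqn0 leqNgt orbit_size_gt0. Qed.

(** The number of fixed points follows from the other counts. Leaving k = 1 out makes the criterion
    insensitive to the fixed points added by an extension. *)
Lemma perm_conj2 s t : (forall k, (2 <= k)%N -> orbit_pts s k = orbit_pts t k) ->
  exists p, (t ^ p)%g = s.
Proof.
move=> h; apply: perm_conj => -[|[|k]]; [by rewrite !orbit_pts0 | | exact: h].
have e : #|psupp s| = #|psupp t|.
  rewrite !(@card_psupp _ #|T|) //; apply: eq_big_nat => k /andP[k2 _]; exact: h.
by have := orbit_pts_sum s; have := orbit_pts_sum t; lia.
Qed.

Lemma psuppJ s x : psupp (s ^ x)%g = x @: psupp s.
Proof.
apply/finset.setP => i; apply/idP/imsetP => [|[j js ->]].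
  rewrite inE => h; exists ((x^-1)%g i); last by rewrite permKV.
  by rewrite inE; apply: contra h => /eqP h; rewrite -(permKV x i) permJ h.
by rewrite inE permJ (inj_eq perm_inj); move: js; rewrite inE.
Qed.

Lemma psupp_perm s i : (s i \in psupp s) = (i \in psupp s).
Proof. by rewrite !inE (inj_eq perm_inj). Qed.

(** A point moved by exactly one factor is moved by the product: if only s moves i, then t sending s
    i back to i would contradict that t fixes i. *)
Lemma psupp_symdiff s t : (psupp s :\: psupp t) :|: (psupp t :\: psupp s) \subset psupp (s * t)%g.
Proof.
apply/fintype.subsetP => i; rewrite !inE permM.
have [si|si] := eqVneq (s i) i; first by rewrite si /= andbF.
have [ti|//] := eqVneq (t i) i => _; apply: contra si => /eqP e; apply/eqP.
by apply: (@perm_inj _ t); rewrite e ti.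
Qed.

Lemma card_symdiff (A B : {set T}) :
  (#|(A :\: B) :|: (B :\: A)| + 2 * #|A :&: B| = #|A| + #|B|)%N.
Proof.
rewrite -[#|A|](cardsID B) -[#|B|](cardsID A) [B :&: A]finset.setIC cardsU.
suff -> : (A :\: B) :&: (B :\: A) = finset.set0 by rewrite cards0; lia.
by apply/finset.setP => i; rewrite !inE; do 2 case: (_ \in _).
Qed.

Lemma card_psuppM s t :
  (#|psupp s| + #|psupp t| <= #|psupp (s * t)%g| + 2 * #|psupp s :&: psupp t|)%N.
Proof. by rewrite -card_symdiff leq_add2r subset_leq_card // psupp_symdiff. Qed.

Lemma card_psuppM_le s t : (#|psupp (s * t)%g| <= #|psupp s| + #|psupp t|)%N.
Proof.
apply: leq_trans (leq_card_setU _ _); apply: subset_leq_card; apply/fintype.subsetP => i.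
rewrite !inE permM; apply: contraR; rewrite negb_or !negbK => /andP[/eqP -> /eqP ->] //.
Qed.

(* Pointwise constraints on D cut out a coset of the pointwise stabilizer of D. *)
Lemma card_perm_on_eq (D : {set T}) (f : T -> T) : {in D &, injective f} ->
  #|[pred x : {perm T} | [forall i in D, x i == f i]]| = (#|T| - #|D|)`!.
Proof.
move=> /perm_extend[p pE].
have -> : (#|T| - #|D|)%N = #|~: D| by rewrite -(cardsC D) addKn.
rewrite -card_perm.
rewrite -[RHS](card_imset _ (mulIg p)); apply: eq_card => x; apply/idP/imsetP.
  rewrite inE => /forall_inP h; exists (x * p^-1)%g; last by rewrite mulgKV.
  apply/fintype.subsetP => i; rewrite !inE; apply: contra => iD.
  by rewrite permM (eqP (h i iD)) -pE // permK.
move=> [y yD ->]; rewrite inE; apply/forall_inP => i iD.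
by rewrite permM (out_perm yD) ?pE // !inE iD.
Qed.

Lemma card_perm_on_le (D : {set T}) (f : T -> T) :
  (#|[pred x : {perm T} | [forall i in D, x i == f i]]| <= (#|T| - #|D|)`!)%N.
Proof.
case: (pickP [pred x : {perm T} | [forall i in D, x i == f i]]) => [x /forall_inP h|h].
  rewrite card_perm_on_eq // => i j iD jD; rewrite -(eqP (h i iD)) -(eqP (h j jD)).
  exact: perm_inj.
by rewrite (eq_card0 h).
Qed.

End Support.

(** * Cycles of products and counting of overlaps *)

Section OrbitSurgery.
Variable T : finType.
Implicit Types (a b c x : {perm T}) (S : {set T}).

Lemma stable_iter b S i e : {in S, forall i, b i \in S} -> i \in S -> iter e b i \in S.
Proof. by move=> bS iS; elim: e => //= e; exact: bS. Qed.

Lemma stable_out b S i : {in S, forall i, b i \in S} -> i \notin S -> b i \notin S.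
Proof.
move=> bS; apply: contra => bi.
have : b @: S = S.
  apply/eqP; rewrite eqEcard card_imset ?leqnn ?andbT; last exact: perm_inj.
  by apply/fintype.subsetP => _ /imsetP[z /bS zA ->].
by move=> e; move: bi; rewrite -{1}e => /imsetP[z zA /perm_inj ->].
Qed.

Lemma orbit_size_agree b c S i : {in S, forall i, b i \in S} -> {in S, b =1 c} -> i \in S ->
  orbit_size b i = orbit_size c i.
Proof.
move=> bS bc iS; have it e : iter e b i = iter e c i.
  by elim: e => //= e <-; apply: bc; exact: stable_iter.
apply: eq_card => y; apply/idP/idP => /mem_orbit_iter[e ->].
  by rewrite it iter_mem_orbit.
by rewrite -it iter_mem_orbit.
Qed.

(** Here c is b with its cycles inside the stable set S erased; the erased points become fixed
    points, which the restriction to cycles of length at least 2 ignores. *)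
Lemma orbit_pts_off b c S j : {in S, forall i, b i \in S} -> {in S, forall i, c i = i} ->
  (forall i, i \notin S -> c i = b i) -> (2 <= j)%N ->
  orbit_pts b j = (orbit_pts c j + #|[set i in S | orbit_size b i == j]|)%N.
Proof.
move=> bS cS cb j2; rewrite /orbit_pts -[LHS](cardsID S) addnC; congr (_ + _)%N.
  apply: eq_card => i; rewrite !inE; have [iS|iS] /= := boolP (i \in S).
    by apply/esym/negbTE; rewrite neq_ltn (eqP (_ : orbit_size c i == 1%N)) ?orbit_size1 ?cS ?j2 ?eqxx.
  have bC : {in ~: S, forall i, b i \in ~: S} by move=> y; rewrite !inE; exact: stable_out.
  by rewrite (@orbit_size_agree b c (~: S)) ?inE // => y; rewrite inE => /cb.
by apply: eq_card => i; rewrite !inE andbC.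
Qed.

Lemma orbit_pts_disjoint a b j : psupp a :&: psupp b = finset.set0 -> (2 <= j)%N ->
  orbit_pts (a * b)%g j = (orbit_pts a j + orbit_pts b j)%N.
Proof.
move=> /finset.setP ab j2.
have fa i : i \in psupp a -> b i = i.
  move=> ia; apply/eqP; have := ab i; rewrite !inE.
  by move: ia; rewrite inE => -> /= /negbT; rewrite negbK.
have fab : {in psupp a, (a * b)%g =1 a}.
  by move=> i ia; rewrite permM fa // psupp_perm.
have st : {in psupp a, forall i, (a * b)%g i \in psupp a}.
  by move=> i ia; rewrite fab // psupp_perm.
rewrite (@orbit_pts_off (a * b)%g b (psupp a) j) //; last first.
  by move=> i; rewrite inE negbK permM => /eqP ->.
rewrite addnC; congr (_ + _)%N; apply: eq_card => i; rewrite !inE -[a i != i]/(~~ _).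
have [ai|ai] /= := eqVneq (a i) i.
  by apply/esym/negbTE; rewrite neq_ltn (eqP (_ : orbit_size a i == 1%N)) ?orbit_size1 ?ai ?j2 ?eqxx.
by rewrite (@orbit_size_agree _ a (psupp a)) // inE.
Qed.

Lemma psuppV a : psupp a^-1%g = psupp a.
Proof.
apply/finset.setP => i; rewrite !inE; congr (~~ _).
by apply/eqP/eqP => e; rewrite -{1}e ?permKV ?permK.
Qed.

Lemma cancel_disjoint a b : {in psupp a, forall i, b (a i) = i} ->
  (psupp a \subset psupp b) * (psupp (a * b)%g = psupp b :\: psupp a).
Proof.
move=> ba; have sub : psupp a \subset psupp b.
  apply/fintype.subsetP => i ia; have := psupp_perm a (a^-1%g i); rewrite permKV => e.
  have ia' : a^-1%g i \in psupp a by rewrite -e.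
  have := ba _ ia'; rewrite permKV inE => ->; apply: contraTneq ia => ei.
  by rewrite inE negbK -{1}ei permKV.
split=> //; apply/finset.setP => i; rewrite [in RHS]finset.in_setD.
have [ia|ia] /= := boolP (i \in psupp a); first by rewrite inE permM ba // eqxx.
by move: ia; rewrite !inE negbK permM => /eqP ->.
Qed.

(** This is the equality case of [card_psuppM]: the product must then fix every point of the
    overlap. Hence a maps the overlap to itself, and as a has a single nontrivial cycle, the overlap
    is the whole of that cycle. *)
Lemma overlap_cancel a b : {in psupp a, forall i, porbit a i = psupp a} ->
  (0 < #|psupp a :&: psupp b|)%N ->
  (#|psupp (a * b)%g| + 2 * #|psupp a :&: psupp b| = #|psupp a| + #|psupp b|)%N ->
  {in psupp a, forall i, b (a i) = i}.
Proof.
move=> cyc /card_gt0P[i0 i0I]; rewrite -card_symdiff => /addIn e.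
have {}e : psupp (a * b)%g = (psupp a :\: psupp b) :|: (psupp b :\: psupp a).
  by apply/eqP; rewrite eq_sym eqEcard psupp_symdiff e leqnn.
have fixI i : i \in psupp a :&: psupp b -> b (a i) = i.
  rewrite finset.in_setI => /andP[ia ib]; apply/eqP; rewrite -permM.
  by have /finset.setP/(_ i) := e; rewrite finset.in_setU !finset.in_setD ia ib inE => /negbT; rewrite negbK.
have stI : {in psupp a :&: psupp b, forall i, a i \in psupp a :&: psupp b}.
  move=> i iI; have := iI; rewrite !finset.in_setI psupp_perm => /andP[-> ib] /=.
  by rewrite -psupp_perm fixI.
have sub : {in psupp a, forall i, i \in psupp a :&: psupp b}.
  move=> i; have i0a : i0 \in psupp a by move: i0I; rewrite finset.in_setI => /andP[].
  rewrite -{1}(cyc i0 i0a) => /mem_orbit_iter[d ->]; exact: stable_iter.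
by move=> i /sub /fixI.
Qed.

(** An overlap of at least m points means that x sends some m points of B to prescribed points of A.
    There are at most (#|A| + 1)^#|B| partial functions from B to A, and each one defined at m
    points leaves at most (#|T| - m)! permutations. *)
Lemma card_overlap (A B : {set T}) m :
  (#|[pred x : {perm T} | (m <= #|A :&: x @: B|)%N]| <= #|A|.+1 ^ #|B| * (#|T| - m)`!)%N.
Proof.
pose R := [pred o : option T | if o is Some a then a \in A else true].
have cardR : #|R| = #|A|.+1.
  pose s := None :: map Some (enum A).
  have us : uniq s.
    by rewrite /= map_inj_uniq ?enum_uniq ?andbT; [apply/mapP => -[] | move=> a b []].
  have -> : #|A|.+1 = size s by rewrite /= size_map cardE.
  rewrite -(card_uniqP us); apply: eq_card => -[a|]; rewrite !inE //=.
  by rewrite mem_map ?mem_enum // => b c [].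
pose Sf (f : {ffun T -> option T}) (x : {perm T}) :=
  [forall i in [set i | f i != None], x i == odflt i (f i)].
pose F := [pred f : {ffun T -> option T} | (f \in pffun_on None (mem B) R) && (#|[set i | f i != None]| == m)].
apply: (@leq_trans (\sum_(f in F) #|[pred x | Sf f x]|)).
  rewrite (eq_bigr (fun f => \sum_x (Sf f x : nat))%N); last first.
    by move=> f _; rewrite -sum1_card big_mkcond; apply: eq_bigr => x _; rewrite inE; case: (Sf f x).
  rewrite exchange_big -sum1_card big_mkcond; apply: leq_sum => x _.
  rewrite inE; case: ifP => // mx.
  pose B' := [set i in B | x i \in A].
  have B'E : #|B'| = #|A :&: x @: B|.
    rewrite -(card_imset _ (@perm_inj _ x)); apply: eq_card => y.
    apply/imsetP/idP => [[i]|]; first by rewrite !inE => /andP[iB iA] ->; rewrite iA imset_f.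
    by rewrite inE => /andP[yA /imsetP[i iB yi]]; exists i => //; rewrite inE iB -yi.
  pose D := [set i in take m (enum B')].
  have DB' : {subset D <= B'} by move=> i; rewrite inE => /mem_take; rewrite mem_enum.
  have cD : #|D| = m.
    rewrite cardsE; have /card_uniqP -> := take_uniq m (enum_uniq (mem B')).
    by rewrite size_takel // -cardE B'E.
  pose f : {ffun T -> option T} := [ffun i => if i \in D then Some (x i) else None].
  have suppf : [set i | f i != None] = D.
    by apply/finset.setP => i; rewrite inE ffunE; case: ifP.
  have fF : f \in F.
    rewrite inE suppf cD eqxx andbT; apply/pffun_onP; split.
      apply/fintype.subsetP => i; rewrite inE ffunE; case: ifP => // /DB'.
      by rewrite inE => /andP[].
    move=> _ /fintype.imageP[i iB ->]; rewrite ffunE inE; case: ifP => // /DB'.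
    by rewrite inE => /andP[].
  rewrite (bigD1 f) //= (_ : Sf f x) // /Sf suppf.
  by apply/forall_inP => i iD; rewrite ffunE iD.
apply: (@leq_trans (\sum_(f in F) (#|T| - m)`!)).
  by apply: leq_sum => f; rewrite inE => /andP[_ /eqP <-]; exact: card_perm_on_le.
rewrite sum_nat_const leq_mul2r; apply/orP; right.
rewrite -cardR -(card_pffun_on None (mem B) R); apply: subset_leq_card; apply/fintype.subsetP => f.
by rewrite inE => /andP[].
Qed.

End OrbitSurgery.

Section ExtendMore.
Variables (r n : nat).
Hypothesis rn : (r <= n)%N.

Lemma psupp_extend (s : 'S_r) : psupp (extend n s) = widen_ord rn @: psupp s.
Proof.
apply/finset.setP => j; have [[i ->]|] := widen_or rn j.
  by rewrite (mem_imset _ _ (@widen_inj _ _ rn)) !inE extend_widen (inj_eq (@widen_inj _ _ rn)).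
move=> ri; rewrite inE extend_out // eqxx; apply/esym/negbTE/imsetP => -[i _ e].
by move: ri; rewrite e /= leqNgt ltn_ord.
Qed.

Lemma card_psupp_extend (s : 'S_r) : #|psupp (extend n s)| = #|psupp s|.
Proof. by rewrite psupp_extend card_imset //; exact: widen_inj. Qed.

Lemma orbit_pts_extend (s : 'S_r) k : (2 <= k)%N -> orbit_pts (extend n s) k = orbit_pts s k.
Proof.
move=> k2; rewrite /orbit_pts -[RHS](card_imset _ (@widen_inj _ _ rn)); apply: eq_card => j.
have [[i ->]|] := widen_or rn j.
  by rewrite (mem_imset _ _ (@widen_inj _ _ rn)) !inE orbit_size_extend.
move=> ri; rewrite inE (eqP (_ : orbit_size _ _ == 1%N)) ?orbit_size1 ?extend_out //.
rewrite ltn_eqF //; apply/esym/negbTE/imsetP => -[i _ e].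
by move: ri; rewrite e /= leqNgt ltn_ord.
Qed.

Lemma low_perm_extend (z : 'S_n) : perm_on (low n r) z -> exists y : 'S_r, extend n y = z.
Proof.
move=> zr; have zl (i : 'I_r) : (z (widen_ord rn i) < r)%N.
  by have := perm_closed (widen_ord rn i) zr; rewrite !inE /= ltn_ord => ->.
have f_inj : injective (fun i => Ordinal (zl i)).
  by move=> i j /(congr1 val) /= /val_inj /perm_inj /widen_inj.
exists (perm f_inj); apply/permP => j; have [[i ->]|] := widen_or rn j.
  by rewrite extend_widen permE; exact: val_inj.
by move=> ri; rewrite extend_out // (low_fix zr).
Qed.

(** A permutation moving at most r points is conjugated so that its support, listed by its
    enumeration, becomes an initial segment. *)
Lemma small_support_extend (z : 'S_n) : (#|psupp z| <= r)%N ->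
  exists (y : 'S_r) (x : 'S_n), extend n y = (z ^ x)%g.
Proof.
move=> zr.
pose f (i : 'I_n) : 'I_n := insubd i (index i (enum (psupp z))).
have fE i : i \in psupp z -> f i = index i (enum (psupp z)) :> nat.
  move=> iz; rewrite val_insubd ifT //; apply: leq_trans rn; apply: leq_trans zr.
  by rewrite cardE index_mem mem_enum.
have [x xE] : exists x : 'S_n, {in psupp z, x =1 f}.
  apply: perm_extend => i j iz jz /(congr1 val); rewrite /= !fE // => e.
  by rewrite -(nth_index i (_ : i \in enum (psupp z))) ?mem_enum // e nth_index ?mem_enum.
have [|y yE] := @low_perm_extend (z ^ x)%g; last by exists y, x.
apply/fintype.subsetP => j jz; have {jz} : j \in psupp (z ^ x)%g by move: jz; rewrite !inE.
rewrite psuppJ => /imsetP[i iz ->].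
rewrite xE // inE fE //; apply: leq_trans zr.
by rewrite cardE index_mem mem_enum.
Qed.

End ExtendMore.

(** * Counting cancellations of a k-cycle *)

Section KCycle.
Variable k : nat.
Hypothesis k2 : (2 <= k)%N.

Definition kcycle : 'S_k := perm (@ordS_inj k).

Lemma iter_kcycle e (i : 'I_k) : iter e kcycle i = ((i + e) %% k)%N :> nat.
Proof.
elim: e => [|e IH] /=; first by rewrite addn0 modn_small.
by rewrite permE /= IH -addn1 modnDml addn1 addnS.
Qed.

Lemma porbit_kcycle i : porbit kcycle i = finset.setT.
Proof.
apply/finset.setP => j; rewrite finset.in_setT.
have -> : j = iter (j + (k - i)) kcycle i; last exact: iter_mem_orbit.
apply: val_inj; rewrite /= iter_kcycle addnCA subnKC ?modnDr ?modn_small //.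
exact: ltnW.
Qed.

Lemma orbit_size_kcycle i : orbit_size kcycle i = k.
Proof. by rewrite /orbit_size porbit_kcycle cardsT card_ord. Qed.

Lemma psupp_kcycle : psupp kcycle = finset.setT.
Proof. by apply/finset.setP => i; rewrite -orbit_size_ge2 orbit_size_kcycle k2 finset.in_setT. Qed.

Lemma orbit_pts_kcycle j : orbit_pts kcycle j = if j == k then k else 0%N.
Proof.
rewrite /orbit_pts; case: eqP => [->|/eqP jk].
  rewrite (eq_card (B := 'I_k)) ?card_ord // => i.
  by rewrite !inE orbit_size_kcycle eqxx.
by rewrite eq_card0 // => i; rewrite inE orbit_size_kcycle eq_sym (negPf jk).
Qed.

Variable q : nat.
Variable h : 'S_q.

Lemma disjoint_union_exists : exists t : 'S_(k + q), forall j, (2 <= j)%N ->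
  orbit_pts t j = (orbit_pts kcycle j + orbit_pts h j)%N.
Proof.
have kn := leq_addr q k; have qn := leq_addl k q.
pose f (i : 'I_(k + q)) : 'I_(k + q) := insubd i (i + k)%N.
have fE i : i \in low (k + q) q -> f i = (i + k)%N :> nat.
  by rewrite inE => iq; rewrite val_insubd addnC ltn_add2l iq.
have [x xE] : exists x : 'S_(k + q), {in low (k + q) q, x =1 f}.
  apply: perm_extend => i j iq jq /(congr1 val); rewrite /= !fE // => e.
  by apply: val_inj => /=; lia.
exists (extend (k + q) kcycle * extend (k + q) h ^ x)%g => j j2.
rewrite orbit_pts_disjoint // ?orbit_ptsJ ?orbit_pts_extend //.
apply/finset.setP => i; rewrite psuppJ !psupp_extend finset.in_setI finset.in_set0.
apply/negbTE/negP => /andP[/imsetP[a _ ->] /imsetP[_ /imsetP[b _ ->] e]].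
have bl : widen_ord qn b \in low (k + q) q by rewrite inE /= ltn_ord.
have := congr1 val e; rewrite xE //= fE //= => e'.
by have : (a < k)%N := ltn_ord a; rewrite e'; lia.
Qed.

(* The x for which the cycle type of h contains, moved by x, the inverse of the
   k-cycle: x is determined on a k-cycle of h by the preimage of one point. *)
Lemma card_cancel n : (k + q <= n)%N ->
  let G := extend n kcycle in let H := extend n h in
  #|[pred x : 'S_n | [forall i in psupp G, (H ^ x)%g (G i) == i]]| =
  (orbit_pts h k * (n - k)`!)%N.
Proof.
move=> kqn G H; have kn : (k <= n)%N by lia.
have qn : (q <= n)%N by lia.
have k0 : (0 < k)%N by lia.
pose i0 : 'I_n := widen_ord kn (Ordinal k0).
have szG : orbit_size G i0 = k by rewrite orbit_size_extend orbit_size_kcycle.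
have suppG i : i \in psupp G -> exists e, i = iter e G i0.
  rewrite (psupp_extend kn) => /imsetP[j _ ->]; exists j.
  have it e : iter e G i0 = widen_ord kn (iter e kcycle (Ordinal k0)).
    by elim: e => //= e ->; rewrite extend_widen.
  by rewrite it; apply: val_inj; rewrite /= iter_kcycle add0n modn_small.
have i0G : i0 \in psupp G by rewrite -orbit_size_ge2 szG.
have GV e : iter e G^-1%g i0 \in psupp G.
  by elim: e => //= e; rewrite -{2}psuppV psupp_perm psuppV.
have szGV : orbit_size G^-1%g i0 = k by rewrite /orbit_size porbitV.
have HJ (x : 'S_n) y : (H ^ x)%g (x y) = x (H y) by rewrite permJ.
(* If j lies on a k-cycle of H, then [f j] maps this cycle, traversed forwards from j, to the cycle
   of G traversed backwards from [i0]. *)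
pose f j y : 'I_n := iter (index y (traject H j k)) G^-1%g i0.
have fE j : orbit_size H j = k -> forall e, f j (iter e H j) = iter e G^-1%g i0.
  move=> jk e; rewrite /f (iter_orbit_mod H j e) jk (iter_orbit_mod G^-1%g i0 e) szGV.
  have ek : (e %% k < k)%N by rewrite ltn_pmod.
  rewrite -(nth_traject H ek) index_uniq ?size_traject //.
  by rewrite -jk; exact: uniq_traject_porbit.
(* The cancelling x are sorted by the preimage j of [i0]: cancellation then says that j lies on a
   k-cycle of H and that x agrees with [f j] on it. *)
have split (x : 'S_n) j : [forall i in psupp G, (H ^ x)%g (G i) == i] && (x^-1%g i0 == j) =
    (orbit_size H j == k) && [forall y in porbit H j, x y == f j y].
  apply/andP/andP => [[/forall_inP cx /eqP xj]|[/eqP jk /forall_inP cx]].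
    have it e : x (iter e H j) = iter e G^-1%g i0.
      elim: e => [|e IH] /=; first by rewrite -xj permKV.
      rewrite -HJ IH; have := cx (iter e.+1 G^-1%g i0) (GV e.+1).
      by rewrite /= permKV => /eqP.
    have jk : orbit_size H j = k.
      rewrite -(orbit_sizeJ H x) -xj permKV.
      rewrite -szGV; apply: eq_card => y.
      have it' e : iter e (H ^ x)%g i0 = iter e G^-1%g i0.
        by rewrite -[in LHS](permKV x i0) xj iter_conj it.
      apply/idP/idP => /mem_orbit_iter[e ->]; first by rewrite it' iter_mem_orbit.
      by rewrite -it' iter_mem_orbit.
    split; first by rewrite jk.
    by apply/forall_inP => y /mem_orbit_iter[e ->]; rewrite fE // it.
  have it e : x (iter e H j) = iter e G^-1%g i0.
    by rewrite (eqP (cx _ (iter_mem_orbit _ _ _))) fE.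
  split; last by rewrite -[i0]/(iter 0 G^-1%g i0) -it permK.
  apply/forall_inP => i; rewrite -{1}psuppV => iG.
  have [e ->] : exists e, i = iter e.+1 G^-1%g i0.
    have [e ie] : exists e, G i = iter e G^-1%g i0.
      rewrite psuppV -psupp_perm in iG; have [e ->] := suppG _ iG.
      by apply: mem_orbit_iter; rewrite porbitV iter_mem_orbit.
    by exists e; rewrite /= -ie permK.
  have -> : G (iter e.+1 G^-1%g i0) = iter e G^-1%g i0 by rewrite iterS permKV.
  by rewrite -!it HJ.
rewrite -sum1_card (partition_big (fun x : 'S_n => x^-1%g i0) predT) //=.
rewrite (eq_bigr (fun j => (orbit_size H j == k) * (n - k)`!)%N); last first.
  move=> j _; rewrite (eq_bigl _ _ (fun x => split x j)).
  case: eqP => /= [jk|_]; last by rewrite big_pred0_eq.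
  have -> : (n - k = #|'I_n| - #|porbit H j|)%N by rewrite card_ord -[#|porbit H j|]/(orbit_size H j) jk.
  rewrite mul1n sum1_card.
  apply: card_perm_on_eq => y z /mem_orbit_iter[a ->] /mem_orbit_iter[b ->].
  rewrite !fE // => /iter_orbit_inj; rewrite szGV => e.
  by rewrite (iter_orbit_mod H j a) (iter_orbit_mod H j b) jk e.
rewrite -big_distrl /= -(orbit_pts_extend qn) //; congr (_ * _)%N.
by rewrite /orbit_pts -sum1dep_card [RHS]big_mkcond; apply: eq_bigr => j _; case: eqP.
Qed.

End KCycle.

Local Open Scope classical_set_scope.
Local Open Scope ring_scope.

(** * Products of normalized characters *)

Section Ratio.
Variable R : realType.

Definition sq (n : nat) : R := Num.sqrt n%:R.

Lemma sqr_sq n : sq n ^+ 2 = n%:R. Proof. by rewrite sqr_sqrtr. Qed.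

Lemma sq_ge1 n : (0 < n)%N -> 1 <= sq n.
Proof. by move=> n0; rewrite -[leLHS]sqrtr1 ler_sqrt ?ler0n // ler1n. Qed.

Lemma sq_gt0 n : (0 < n)%N -> 0 < sq n.
Proof. by move/sq_ge1; exact: lt_le_trans. Qed.

Lemma cvg_invn : (fun n => (n%:R : R)^-1) @ \oo --> (0 : R).
Proof. by rewrite -(cvg_shiftS (fun n => (n%:R : R)^-1)); exact: cvg_harmonic. Qed.

Lemma cvg_invsq : (fun n => (sq n)^-1) @ \oo --> (0 : R).
Proof.
rewrite (_ : (fun n => _) = (fun n => Num.sqrt (n%:R^-1 : R))); last first.
  by apply/funext => n; rewrite /sq sqrtrV.
have : (Num.sqrt \o (fun n : nat => (n%:R : R)^-1)) @ \oo --> Num.sqrt (0 : R).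
  by apply: continuous_cvg; [exact: sqrt_continuous | exact: cvg_invn].
by rewrite sqrtr0; apply.
Qed.

(** n^m times the probability that a uniform permutation takes m prescribed values at m given
    points; it tends to 1. *)
Definition fact_ratio (m n : nat) : R := n%:R ^+ m * (n - m)`!%:R / n`!%:R.

Lemma fact_neq0 n : (n`!%:R : R) != 0.
Proof. by rewrite pnatr_eq0 -lt0n fact_gt0. Qed.

Lemma cvg_fact_ratio m : fact_ratio m @ \oo --> (1 : R).
Proof.
elim: m => [|m IH].
  rewrite (_ : fact_ratio 0 = cst 1); first exact: cvg_cst.
  by apply/funext => n; rewrite /fact_ratio expr0 subn0 mul1r divff // fact_neq0.
rewrite -(cvg_shiftn m.+1).
rewrite (_ : (fun n => _) = (fun n => fact_ratio m (n + m.+1) * (1 + m%:R * harmonic n))); last first.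
  apply/funext => n; rewrite /fact_ratio /harmonic /=.
  have -> : (n + m.+1 - m.+1 = n)%N by rewrite addnK.
  have -> : (n + m.+1 - m = n.+1)%N by lia.
  rewrite factS natrM exprS; have e : (n + m.+1)%:R = n.+1%:R + m%:R :> R.
    by rewrite -natrD addSnnS.
  rewrite {1}e; have n0 : (n.+1%:R : R) != 0 by rewrite pnatr_eq0.
  move: n0 (fact_neq0 (n + m.+1)); move: (n.+1%:R : R) ((n + m.+1)`!%:R : R) ((n + m.+1)%:R ^+ m : R) (n`!%:R : R) => a b c f a0 b0.
  by field; rewrite a0 b0.
have h1 : (fun n => fact_ratio m (n + m.+1)) @ \oo --> (1 : R).
  by rewrite (cvg_shiftn m.+1 (fact_ratio m)).
have h2 : (fun n => 1 + m%:R * harmonic n) @ \oo --> (1 + m%:R * 0 : R).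
  by apply: cvgD; [exact: cvg_cst | apply: cvgM; [exact: cvg_cst | exact: cvg_harmonic]].
by have := cvgM h1 h2; rewrite mulr0 addr0 mulr1; apply.
Qed.

Lemma fact_ratioE m n : (0 < n)%N -> (n - m)`!%:R / n`!%:R = fact_ratio m n / sq n ^+ (2 * m) :> R.
Proof.
move=> n0; rewrite /fact_ratio exprM sqr_sq.
have h : (n%:R ^+ m : R) != 0 by rewrite expf_neq0 // pnatr_eq0 -lt0n.
move: h (fact_neq0 n); move: (n%:R ^+ m : R) (n`!%:R : R) ((n - m)`!%:R : R) => a b c a0 b0.
by field; rewrite a0 b0.
Qed.

Definition bseq (a : nat -> R) : Prop := exists M, \forall n \near \oo, `|a n| <= M.
Definition zseq (a : nat -> R) : Prop := a @ \oo --> (0 : R).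

Lemma cvg_bseq a l : a @ \oo --> (l : R) -> bseq a.
Proof.
move=> al; exists (`|l| + 1); have /cvgrPdist_le/(_ 1 ltr01) := al.
apply: filterS => n h; rewrite -[a n](subKr l).
by apply: le_trans (ler_normB _ _) _; rewrite lerD2l.
Qed.

Lemma bseqM a b : bseq a -> bseq b -> bseq (fun n => a n * b n).
Proof.
move=> [M hM] [N hN]; exists (M * N); near=> n; rewrite normrM.
by apply: ler_pM => //; near: n.
Unshelve. all: by end_near. Qed.

Lemma bseqD a b : bseq a -> bseq b -> bseq (fun n => a n + b n).
Proof.
move=> [M hM] [N hN]; exists (M + N); near=> n; apply: le_trans (ler_normD _ _) _.
by apply: lerD; near: n.
Unshelve. all: by end_near. Qed.

Lemma bseq_cst c : bseq (fun=> c).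
Proof. by exists `|c|; near=> n. Unshelve. all: by end_near. Qed.

Lemma zseqM a b : bseq a -> zseq b -> zseq (fun n => a n * b n).
Proof.
move=> [M hM] hb; apply/norm_cvg0P.
apply: (@squeeze_cvgr _ _ _ _ (fun=> 0) (fun n => M * `|b n|)).
- near=> n; rewrite normr_ge0 /= normrM ler_wpM2r //; near: n; exact: hM.
- exact: cvg_cst.
- have h : (fun n => `|b n|) @ \oo --> (0 : R) by rewrite -(normr0 R); exact: cvg_norm.
  have h' : (fun n => M * `|b n|) @ \oo --> (M * 0 : R) by apply: (cvgM _ h); exact: cvg_cst.
  by rewrite mulr0 in h'.
Unshelve. all: by end_near. Qed.

Lemma zseq_bseq a : zseq a -> bseq a. Proof. exact: cvg_bseq. Qed.

End Ratio.

(** * Combinations of normalized characters with asymptotic coefficients *)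

Section Algebra.
Variable R : realType.

Definition X r (s : 'S_r) n (lam : intpart n) : R :=
  sq R n ^+ #|psupp s| * nchar R lam (extend n s).

(* Eventually, a finite combination of the X s with coefficient sequences in Q. *)
Inductive gen (Q : (nat -> R) -> Prop) : (forall n, intpart n -> R) -> Prop :=
| gen_nil Y : (\forall n \near \oo, forall lam : intpart n, Y n lam = 0) -> gen Q Y
| gen_cons a r (s : 'S_r) Y Y' : Q a -> gen Q Y ->
    (\forall n \near \oo, forall lam : intpart n, Y' n lam = a n * X s lam + Y n lam) ->
    gen Q Y'.

Definition ideal (Q : (nat -> R) -> Prop) := forall a b, bseq b -> Q a -> Q (fun n => b n * a n).

Lemma ideal_bseq : ideal (@bseq R).
Proof. by move=> a b; exact: bseqM. Qed.

Lemma ideal_zseq : ideal (@zseq R).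
Proof. by move=> a b; exact: zseqM. Qed.

Lemma gen_ext Q Y Y' : gen Q Y ->
  (\forall n \near \oo, forall lam : intpart n, Y' n lam = Y n lam) -> gen Q Y'.
Proof.
case=> [Z hZ|a r s Z Z' Qa gZ hZ] h.
  by apply: gen_nil; near=> n => lam; rewrite (near h n) // (near hZ n).
by apply: (gen_cons Qa gZ); near=> n => lam; rewrite (near h n) // (near hZ n).
Unshelve. all: by end_near. Qed.

Lemma gen_eq Q Y Y' : gen Q Y -> (forall n (lam : intpart n), Y' n lam = Y n lam) -> gen Q Y'.
Proof. by move=> gY h; apply: gen_ext gY _; near=> n. Unshelve. all: by end_near. Qed.

Lemma gen0 Q : gen Q (fun _ _ => 0).
Proof. by apply: gen_nil; near=> n. Unshelve. all: by end_near. Qed.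

Lemma gen_mono (Q Q' : (nat -> R) -> Prop) Y : (forall a, Q a -> Q' a) -> gen Q Y -> gen Q' Y.
Proof.
move=> QQ'; elim=> [Z hZ|a r s Z Z' Qa _ IH hZ]; first exact: gen_nil.
exact: gen_cons (QQ' _ Qa) IH hZ.
Qed.

Lemma gen_X Q a r (s : 'S_r) : Q a -> gen Q (fun n lam => a n * X s lam).
Proof.
move=> Qa; apply: (gen_cons Qa (gen0 Q)); near=> n => lam.
by rewrite addr0.
Unshelve. all: by end_near. Qed.

Lemma gen_add Q Y Z : gen Q Y -> gen Q Z -> gen Q (fun n lam => Y n lam + Z n lam).
Proof.
move=> gY gZ; elim: gY => [Y' hY|a r s Y1 Y2 Qa _ IH hY].
  by apply: (gen_ext gZ); near=> n => lam; rewrite (near hY n) // add0r.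
by apply: (gen_cons Qa IH); near=> n => lam; rewrite (near hY n) // addrA.
Unshelve. all: by end_near. Qed.

Lemma gen_scale (Q Q' : (nat -> R) -> Prop) b Y : (forall a, Q a -> Q' (fun n => b n * a n)) ->
  gen Q Y -> gen Q' (fun n lam => b n * Y n lam).
Proof.
move=> QQ'; elim=> [Z hZ|a r s Z Z' Qa _ IH hZ].
  by apply: gen_nil; near=> n => lam; rewrite (near hZ n) // mulr0.
apply: (gen_cons (QQ' _ Qa) IH); near=> n => lam.
by rewrite (near hZ n) // mulrDr mulrA.
Unshelve. all: by end_near. Qed.

Lemma gen_sum Q (I : Type) (l : seq I) (P : pred I) (Y : I -> forall n, intpart n -> R) :
  (forall i, P i -> gen Q (Y i)) -> gen Q (fun n lam => \sum_(i <- l | P i) Y i n lam).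
Proof.
move=> h; elim: l => [|i l IH].
  by apply: (gen_eq (gen0 Q)) => n lam; rewrite big_nil.
have [Pi|Pi] := boolP (P i).
  by apply: (gen_eq (gen_add (h i Pi) IH)) => n lam; rewrite big_cons Pi.
by apply: (gen_eq IH) => n lam; rewrite big_cons (negPf Pi).
Qed.

Definition overlap r q (g : 'S_r) (h : 'S_q) n (x : 'S_n) : nat :=
  #|psupp (extend n g) :&: x @: psupp (extend n h)|.

(** The order n^(-e/2): half-integer powers occur since X_s is scaled by [sq n] for each moved
    point. *)
Definition small_of (e : nat) (a : nat -> R) : Prop :=
  exists M, \forall n \near \oo, `|a n| <= M / sq R n ^+ e.

Lemma nchar_conj n (lam : intpart n) (z z' : 'S_n) :
  (forall k, (2 <= k)%N -> orbit_pts z k = orbit_pts z' k) -> nchar R lam z = nchar R lam z'.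
Proof. by move=> /perm_conj2[p <-]; rewrite ncharJ. Qed.

(* Sort the x by a representative in S_(r + q) of the class of g h^x; if its
   support has w points, then the overlap is at least (|g| + |h| + e - w) / 2. *)
Lemma gen_partial r q (g : 'S_r) (h : 'S_q) (B : forall n, pred 'S_n) (e : nat) :
  (\forall n \near \oo, forall x, B n x ->
    (#|psupp g| + #|psupp h| + e <=
     #|psupp (extend n g * extend n h ^ x)%g| + 2 * overlap g h x)%N) ->
  gen (small_of e) (fun n lam => sq R n ^+ (#|psupp g| + #|psupp h|) *
    ((n`!%:R)^-1 * \sum_(x | B n x) nchar R lam (extend n g * extend n h ^ x)%g)).
Proof.
move=> hB; set w := (#|psupp g| + #|psupp h|)%N; pose N := (r + q)%N.
(* At most r + q = N points are moved by the product, so a representative in S_N exists as soon as N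
   <= n; the default is met only for smaller n. *)
pose nu n (x : 'S_n) : 'S_N := odflt 1%g [pick y : 'S_N |
  [exists x' : 'S_n, extend n y == ((extend n g * extend n h ^ x) ^ x')%g]].
have nuP n (x : 'S_n) : (N <= n)%N ->
    exists x', extend n (nu n x) = ((extend n g * extend n h ^ x) ^ x')%g.
  move=> Nn; rewrite /nu; case: pickP => /= [y /existsP[x' /eqP e']|noy]; first by exists x'.
  have [|y [x' yE]] := @small_support_extend N n Nn (extend n g * extend n h ^ x)%g.
    apply: leq_trans (card_psuppM_le _ _) _; rewrite psuppJ card_imset; last exact: perm_inj.
    rewrite !card_psupp_extend; try lia.
    apply: leq_add; apply: leq_trans (max_card _) _; by rewrite card_ord.
  by have /existsP[] := noy y; exists x'; rewrite yE.
pose a (y : 'S_N) (n : nat) : R := sq R n ^+ w / sq R n ^+ #|psupp y| *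
  (#|[pred x : 'S_n | B n x && (nu n x == y)]|%:R / n`!%:R).
have a_small y : small_of e (a y).
  (* A product with v moved points needs an overlap of at least half of w + e - v, rounded up. This
     costs a factor n^(-m), and 2m >= w + e - v leaves n^(-e/2) after the scaling by n^((w-v)/2).
     Truncated subtraction only matters when v > w + e, where m = 0 suffices. *)
  pose v := #|psupp y|; pose m := uphalf (w + e - v).
  pose C : R := (#|psupp g|.+1 ^ #|psupp h|)%:R.
  have mE : (2 * m = odd (w + e - v) + (w + e - v))%N.
    rewrite /m uphalf_half; have := odd_double_half (w + e - v); rewrite -mul2n.
    by case: (odd _) => /=; lia.
  have oddle : (odd (w + e - v) <= 1)%N by case: (odd _).
  have vm : (w + e <= v + 2 * m)%N by lia.
  have [M hM] := cvg_bseq (@cvg_fact_ratio R m).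
  exists (C * M); near=> n.
  have Nn : (N <= n)%N by near: n; exact: nbhs_infty_ge.
  have n0 : (0 < n)%N by near: n; exact: nbhs_infty_gt.
  have rn : (r <= n)%N by lia.
  have qn : (q <= n)%N by lia.
  have s1 := sq_ge1 R n0; have s0 := sq_gt0 R n0.
  have cnt : (#|[pred x : 'S_n | B n x && (nu n x == y)]| <=
      #|psupp g|.+1 ^ #|psupp h| * (n - m)`!)%N.
    rewrite -(card_psupp_extend rn g) -(card_psupp_extend qn h).
    have := card_overlap (psupp (extend n g)) (psupp (extend n h)) m; rewrite card_ord.
    apply: leq_trans; apply: subset_leq_card.
    apply/fintype.subsetP => x; rewrite !inE => /andP[Bx /eqP xy].
    have [x' e'] := nuP n x Nn.
    have : (w + e <= v + 2 * overlap g h x)%N.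
      have := near hB n; move=> /(_ _)/(_ x Bx); rewrite -/w.
      rewrite -(card_imset (psupp (_ * _)%g) (@perm_inj _ x')) -psuppJ -e' xy card_psupp_extend //.
      by apply.
    by rewrite /overlap; lia.
  have a0 : 0 <= a y n by rewrite /a mulr_ge0 // divr_ge0 // exprn_ge0 // ltW.
  rewrite ger0_norm //.
  apply: (@le_trans _ _ (sq R n ^+ w / sq R n ^+ v * (C * (fact_ratio R m n / sq R n ^+ (2 * m))))).
    rewrite /a -fact_ratioE //; apply: ler_wpM2l; first by rewrite divr_ge0 // exprn_ge0 // ltW.
    rewrite mulrA; apply: ler_wpM2r; first by rewrite invr_ge0.
    by rewrite /C -natrM ler_nat.
  have fM : fact_ratio R m n <= M by apply: le_trans (ler_norm _) _; near: n.
  have f0 : 0 <= fact_ratio R m n by rewrite /fact_ratio divr_ge0 // mulr_ge0 // exprn_ge0.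
  have p0 i : sq R n ^+ i != 0 by rewrite expf_neq0 // gt_eqF.
  have -> : sq R n ^+ w / sq R n ^+ v * (C * (fact_ratio R m n / sq R n ^+ (2 * m))) =
      C * fact_ratio R m n * (sq R n ^+ w / (sq R n ^+ v * sq R n ^+ (2 * m))).
    move: (p0 v) (p0 (2 * m)%N); move: (sq R n ^+ v) (sq R n ^+ (2 * m)) (sq R n ^+ w) => b c d b0 c0.
    by field; rewrite b0 c0.
  have C0 : 0 <= C by exact: ler0n.
  have e0 i : 0 <= sq R n ^+ i by rewrite exprn_ge0 // ltW.
  apply: ler_pM.
  - exact: mulr_ge0.
  - by apply: divr_ge0 => //; exact: mulr_ge0.
  - exact: ler_wpM2l.
  rewrite ler_pdivrMr ?mulr_gt0 ?exprn_gt0 // mulrC ler_pdivlMr ?exprn_gt0 // -!exprD.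
  by apply: ler_weXn2l.
have gen_a : gen (small_of e) (fun n lam => \sum_(y : 'S_N) a y n * X y lam).
  by apply: gen_sum => y _; exact: gen_X.
apply: (gen_ext gen_a); near=> n => lam.
have Nn : (N <= n)%N by near: n; exact: nbhs_infty_ge.
have n0 : (0 < n)%N by near: n; exact: nbhs_infty_gt.
rewrite (partition_big (nu n) predT) //= 2!mulr_sumr; apply: eq_bigr => y _.
rewrite (eq_bigr (fun=> nchar R lam (extend n y))); last first.
  move=> x /andP[_ /eqP <-]; have [x' ->] := nuP n x Nn; by rewrite ncharJ.
rewrite sumr_const /a /X -[nchar _ _ _ *+ _]mulr_natr.
rewrite [#|(fun _ => _)|](eq_card (B := [pred x : 'S_n | B n x && (nu n x == y)])) //.
have p0 i : sq R n ^+ i != 0 by rewrite expf_neq0 // gt_eqF // sq_gt0.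
move: (p0 #|psupp y|) (fact_neq0 R n).
move: (sq R n ^+ #|psupp y|) (sq R n ^+ w) (n`!%:R : R) (#|_|%:R : R) => b c f d b0 f0.
by field; rewrite b0 f0.
Unshelve. all: by end_near. Qed.

End Algebra.

(** * Products with a k-cycle *)

Section Recursion.
Variable R : realType.
Local Notation gen := (@gen R).
Local Notation X := (X R).

Lemma small_of0 (a : nat -> R) : small_of 0 a -> bseq a.
Proof.
by move=> [M hM]; exists M; apply: filterS hM => n; rewrite expr0 divr1.
Qed.

Lemma small_of1 (a : nat -> R) : small_of 1 a -> zseq a.
Proof.
move=> [M hM]; apply/norm_cvg0P.
apply: (@squeeze_cvgr _ _ _ _ (fun=> 0) (fun n => M * (sq R n)^-1)).
- by apply: filterS hM => n; rewrite expr1 normr_ge0.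
- exact: cvg_cst.
- have h : (fun n => M * (sq R n)^-1) @ \oo --> (M * 0 : R).
    by apply: (cvgM _ (@cvg_invsq R)); exact: cvg_cst.
  by rewrite mulr0 in h.
Qed.

Lemma X_mul r q (g : 'S_r) (h : 'S_q) n (lam : intpart n) : (r <= n)%N -> (q <= n)%N ->
  X g lam * X h lam = sq R n ^+ (#|psupp g| + #|psupp h|) *
    ((n`!%:R)^-1 * \sum_x nchar R lam (extend n g * extend n h ^ x)%g).
Proof. by move=> rn qn; rewrite -ncharM /X exprD; ring. Qed.

Lemma card_psupp_ext_sum r q (g : 'S_r) (h : 'S_q) n (x : 'S_n) : (r <= n)%N -> (q <= n)%N ->
  (#|psupp g| + #|psupp h| <=
   #|psupp (extend n g * extend n h ^ x)%g| + 2 * overlap g h x)%N.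
Proof.
move=> rn qn; rewrite -(card_psupp_extend rn g) -(card_psupp_extend qn h).
by rewrite -(card_imset (psupp (extend n h)) (@perm_inj _ x)) -psuppJ /overlap -psuppJ card_psuppM.
Qed.

Lemma gen_XX r q (g : 'S_r) (h : 'S_q) :
  gen (@bseq R) (fun n lam => X g lam * X h lam).
Proof.
apply: (@gen_ext _ _ (fun n lam => sq R n ^+ (#|psupp g| + #|psupp h|) *
    ((n`!%:R)^-1 * \sum_(x | predT x) nchar R lam (extend n g * extend n h ^ x)%g))).
  apply: gen_mono small_of0 _; apply: (@gen_partial R r q g h (fun n => predT) 0).
  near=> n => x _; rewrite addn0; apply: card_psupp_ext_sum; near: n; exact: nbhs_infty_ge.
by near=> n => lam; apply: X_mul; near: n; exact: nbhs_infty_ge.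
Unshelve. all: by end_near. Qed.

Lemma gen_mulX Q r (s : 'S_r) Y : ideal Q -> gen Q Y -> gen Q (fun n lam => X s lam * Y n lam).
Proof.
move=> iQ; elim=> [Z hZ|a q t Z Z' Qa _ IH hZ].
  by apply: gen_nil; near=> n => lam; rewrite (near hZ n) // mulr0.
have g1 : gen Q (fun n lam => a n * (X s lam * X t lam)).
  apply: (gen_scale (Q := @bseq R)) (gen_XX s t) => b bb.
  have -> : (fun n => a n * b n) = (fun n => b n * a n) by apply/funext => n; rewrite mulrC.
  exact: iQ.
apply: (gen_ext (gen_add g1 IH)); near=> n => lam.
by rewrite (near hZ n) //; ring.
Unshelve. all: by end_near. Qed.

Lemma gen_mul Q Y Z : ideal Q -> gen Q Y -> gen (@bseq R) Z -> gen Q (fun n lam => Y n lam * Z n lam).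
Proof.
move=> iQ gY; elim=> [Y' hY|a q t Y1 Y2 Qa _ IH hY].
  by apply: gen_nil; near=> n => lam; rewrite (near hY n) // mulr0.
have g1 : gen Q (fun n lam => a n * (X t lam * Y n lam)).
  apply: (gen_scale (Q := Q)); last exact: gen_mulX.
  by move=> b Qb; exact: iQ.
apply: (gen_ext (gen_add g1 IH)); near=> n => lam.
by rewrite (near hY n) //; ring.
Unshelve. all: by end_near. Qed.

Lemma X_type r q (s : 'S_r) (t : 'S_q) n (lam : intpart n) : (r <= n)%N -> (q <= n)%N ->
  (forall k, (2 <= k)%N -> orbit_pts s k = orbit_pts t k) -> X s lam = X t lam.
Proof.
move=> rn qn st; rewrite /X; congr (_ * _).
  congr (_ ^+ _); rewrite (@card_psupp _ s (r + q)) ?card_ord ?leq_addr //.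
  rewrite (@card_psupp _ t (r + q)) ?card_ord ?leq_addl //.
  by apply: eq_big_nat => k /andP[k2 _]; exact: st.
by apply: nchar_conj => k k2; rewrite !orbit_pts_extend // st.
Qed.

Lemma Ex_X r (s : 'S_r) n : (r <= n)%N -> Ex (fun lam : intpart n => X s lam) = (s == 1%g)%:R.
Proof.
move=> rn; rewrite /X ExZ Ex_nchar -(extend1 rn) (inj_eq (extend_inj rn)).
case: eqP => [->|_]; last by rewrite mulr0.
rewrite mulr1 (_ : #|psupp _| = 0%N) ?expr0 //.
by apply: eq_card0 => i; rewrite inE perm1 eqxx.
Qed.

(** The mean of a finite combination of the X_s is the sum of the coefficients of the identities,
    and these tend to 0. *)
Lemma gen_small_Ex Y : gen (@zseq R) Y -> (fun n => Ex (@Y n)) @ \oo --> (0 : R).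
Proof.
elim=> [Z hZ|a r s Z Z' Qa _ IH hZ].
  apply: (@cvg_trans _ ((fun=> 0 : R) @ \oo)); last exact: cvg_cst.
  apply: near_eq_cvg; near=> n; rewrite /Ex big1 // => lam _.
  by rewrite (near hZ n) // mulr0.
have h : (fun n => a n * (s == 1%g)%:R + Ex (@Z n)) @ \oo --> (0 * (s == 1%g)%:R + 0 : R).
  by apply: cvgD => //; apply: cvgM => //; exact: cvg_cst.
rewrite mul0r addr0 in h; apply: cvg_trans h; apply: near_eq_cvg; near=> n.
rewrite -(@Ex_X _ s n); last by near: n; exact: nbhs_infty_ge.
by rewrite -ExZ -ExD; apply: eq_Ex => lam; rewrite (near hZ n).
Unshelve. all: by end_near. Qed.

Lemma gen_bdd_Ex Y : gen (@bseq R) Y -> bseq (fun n => Ex (@Y n)).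
Proof.
elim=> [Z hZ|a r s Z Z' Qa _ IH hZ].
  exists 0; near=> n; rewrite /Ex big1 ?normr0 // => lam _.
  by rewrite (near hZ n) // mulr0.
have [M hM] : bseq (fun n => a n * (s == 1%g)%:R + Ex (@Z n)).
  by apply: bseqD => //; apply: bseqM => //; exact: bseq_cst.
exists M; near=> n.
have -> : Ex (@Z' n) = a n * (s == 1%g)%:R + Ex (@Z n).
  rewrite -(@Ex_X _ s n); last by near: n; exact: nbhs_infty_ge.
  by rewrite -ExZ -ExD; apply: eq_Ex => lam; rewrite (near hZ n).
by near: n.
Unshelve. all: by end_near. Qed.

Lemma gen_X1 r (s : 'S_r) : gen (@bseq R) (fun n lam => X s lam).
Proof.
apply: (gen_eq (gen_X s (@bseq_cst R 1))) => n lam; by rewrite mul1r.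
Qed.

Lemma card_no_overlap r q (g : 'S_r) (h : 'S_q) :
  zseq (fun n => #|[pred x : 'S_n | overlap g h x == 0%N]|%:R / n`!%:R - 1 : R).
Proof.
pose C : R := (#|psupp g|.+1 ^ #|psupp h|)%:R.
apply/norm_cvg0P.
apply: (@squeeze_cvgr _ _ _ _ (fun=> 0) (fun n => C * (fact_ratio R 1 n * (n%:R)^-1))).
- near=> n; rewrite normr_ge0 /=.
  have n0 : (0 < n)%N by near: n; exact: nbhs_infty_gt.
  have rn : (r <= n)%N by near: n; exact: nbhs_infty_ge.
  have qn : (q <= n)%N by near: n; exact: nbhs_infty_ge.
  have := cardC [pred x : 'S_n | overlap g h x == 0%N]; rewrite card_Sn => cC.
  have := card_overlap (psupp (extend n g)) (psupp (extend n h)) 1.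
  rewrite card_ord !card_psupp_extend // => c1.
  have e : (#|predC [pred x : 'S_n | overlap g h x == 0%N]| <=
      #|psupp g|.+1 ^ #|psupp h| * (n - 1)`!)%N.
    apply: leq_trans c1; apply: subset_leq_card; apply/fintype.subsetP => x.
    by rewrite !inE -lt0n.
  have -> : #|[pred x : 'S_n | overlap g h x == 0%N]|%:R / n`!%:R - 1 =
      - (#|predC [pred x : 'S_n | overlap g h x == 0%N]|%:R / n`!%:R) :> R.
    have f0 := fact_neq0 R n; rewrite -[X in _ - X](divff f0) -mulrBl -mulNr; congr (_ / _).
    by rewrite -cC natrD; ring.
  rewrite normrN ger0_norm ?divr_ge0 //.
  apply: (@le_trans _ _ ((#|psupp g|.+1 ^ #|psupp h| * (n - 1)`!)%:R / n`!%:R)).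
    by apply: ler_wpM2r; rewrite ?invr_ge0 // ler_nat.
  by rewrite natrM -mulrA fact_ratioE // muln1 sqr_sq.
- exact: cvg_cst.
- have h0 : (fun n => C * (fact_ratio R 1 n * (n%:R)^-1)) @ \oo --> (C * (1 * 0) : R).
    apply: cvgM; first exact: cvg_cst.
    apply: cvgM; [exact: cvg_fact_ratio | exact: cvg_invn].
  by rewrite !mulr0 in h0.
Unshelve. all: by end_near. Qed.

(** Here t is h with a disjoint k-cycle added, and t' is h with one k-cycle removed, constrained
    only when h has one. Disjoint supports give X_t, with probability tending to 1. Cancellation
    loses 2k moved points, whose factor n^k exactly compensates the probability, of order n^(-k),
    found in [card_cancel]. All other overlaps are of lower order. *)
Lemma main_recursion k q (h : 'S_q) r' (t : 'S_r') q' (t' : 'S_q') : (2 <= k)%N ->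
  (forall j, (2 <= j)%N -> orbit_pts t j = (orbit_pts (kcycle k) j + orbit_pts h j)%N) ->
  ((0 < orbit_pts h k)%N -> forall j, (2 <= j)%N ->
     orbit_pts h j = (orbit_pts t' j + if j == k then k else 0)%N) ->
  gen (@zseq R) (fun n lam => X (kcycle k) lam * X h lam -
    (X t lam + (orbit_pts h k)%:R * X t' lam)).
Proof.
move=> k2 tE t'E; pose g := kcycle k.
pose G n : 'S_n := extend n g; pose H n : 'S_n := extend n h.
pose B0 n (x : 'S_n) := overlap g h x == 0%N.
pose B1 n (x : 'S_n) := [forall i in psupp (G n), (H n ^ x)%g (G n i) == i].
have wk : #|psupp g| = k by rewrite psupp_kcycle // cardsT card_ord.
pose w := (k + #|psupp h|)%N.
have B2 : gen (@zseq R) (fun n lam => sq R n ^+ w * ((n`!%:R)^-1 *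
    \sum_(x | ~~ B0 n x && ~~ B1 n x) nchar R lam (G n * H n ^ x)%g)).
  rewrite /w -wk; apply: gen_mono small_of1 _.
  (* The exponent 1 expresses that the support inequality is strict here: by [overlap_cancel],
     equality together with a nonempty overlap would mean that the k-cycle is cancelled. *)
  apply: (@gen_partial R k q g h (fun n x => ~~ B0 n x && ~~ B1 n x) 1).
  near=> n => x /andP[b0 b1].
  have rn : (k <= n)%N by near: n; exact: nbhs_infty_ge.
  have qn : (q <= n)%N by near: n; exact: nbhs_infty_ge.
  rewrite addn1 ltn_neqAle card_psupp_ext_sum // andbT.
  apply: contra b1 => /eqP e; apply/forall_inP => i iG; apply/eqP.
  move: i iG; apply: overlap_cancel.
  - move=> i; rewrite psupp_extend => /imsetP[j _ ->].
    apply/eqP; rewrite eqEcard; apply/andP; split.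
      apply/fintype.subsetP => _ /mem_orbit_iter[d ->].
      have -> : iter d (extend n g) (widen_ord rn j) = widen_ord rn (iter d g j).
        by elim: d => //= d ->; rewrite extend_widen.
      by rewrite imset_f // psupp_kcycle // finset.in_setT.
    rewrite card_imset; last exact: widen_inj.
    by rewrite wk -[#|_|]/(orbit_size _ _) orbit_size_extend orbit_size_kcycle.
  - by move: b0; rewrite /B0 /overlap -psuppJ lt0n.
  rewrite psuppJ -/(overlap g h x) -e (card_imset _ (@perm_inj _ x)).
  by rewrite !card_psupp_extend.
have disj01 n (x : 'S_n) : (k <= n)%N -> B0 n x -> B1 n x -> False.
  move=> rn /eqP b0 /forall_inP b1.
  have [sub _] := @cancel_disjoint _ (G n) (H n ^ x)%g (fun i ig => eqP (b1 i ig)).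
  move: b0; rewrite /overlap -psuppJ (finset.setIidPl sub) card_psupp_extend // wk; lia.
have B1E n (lam : intpart n) (x : 'S_n) : (k <= n)%N -> (q <= n)%N -> (q' <= n)%N -> B1 n x ->
    (0 < orbit_pts h k)%N -> nchar R lam (G n * H n ^ x)%g = nchar R lam (extend n t').
  move=> kn qn qn' /forall_inP b1 h0.
  apply: nchar_conj => j j2; rewrite orbit_pts_extend //.
  have st : {in psupp (G n), forall i, (H n ^ x)%g i = (G n)^-1%g i}.
    move=> i; rewrite -psuppV -psupp_perm psuppV => iG.
    by have := b1 _ iG; rewrite permKV => /eqP.
  have stS : {in psupp (G n), forall i, (H n ^ x)%g i \in psupp (G n)}.
    by move=> i iG; rewrite st // -psuppV psupp_perm psuppV.
  have := @orbit_pts_off _ (H n ^ x)%g (G n * H n ^ x)%g (psupp (G n)) j stS.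
  rewrite orbit_ptsJ orbit_pts_extend // t'E // => e.
  have {}e := e _ _ j2.
  have cE : #|finset (fun i => (i \in psupp (G n)) && (orbit_size (H n ^ x)%g i == j))| =
      if j == k then k else 0%N.
    have sz : {in psupp (G n), forall i, orbit_size (H n ^ x)%g i = k}.
      move=> i iG; rewrite (orbit_size_agree stS st iG) /orbit_size porbitV.
      move: iG; rewrite psupp_extend => /imsetP[i' _ ->].
      by rewrite -[#|_|]/(orbit_size _ _) orbit_size_extend orbit_size_kcycle.
    case: eqP => [->|/eqP jk].
      rewrite -{2}wk -(card_psupp_extend kn g); apply: eq_card => i; rewrite inE.
      by case: (boolP (i \in _)) => //= iG; rewrite sz ?eqxx.
    apply: eq_card0 => i; rewrite inE; case: (boolP (i \in _)) => //= iG.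
    by rewrite sz // eq_sym (negPf jk).
  rewrite cE in e; symmetry; apply/eqP; rewrite -(eqn_add2r (if j == k then k else 0%N)); apply/eqP.
  apply: e => i iG; first by rewrite permM; exact/eqP/b1.
  by rewrite permM; move: iG; rewrite inE negbK => /eqP ->.
have B0E n (lam : intpart n) (x : 'S_n) : (k <= n)%N -> (q <= n)%N -> (r' <= n)%N -> B0 n x ->
    nchar R lam (G n * H n ^ x)%g = nchar R lam (extend n t).
  move=> kn qn rn' /eqP b0; apply: nchar_conj => j j2; rewrite orbit_pts_extend // tE //.
  rewrite orbit_pts_disjoint // ?orbit_ptsJ ?orbit_pts_extend //.
  by apply/eqP; rewrite -cards_eq0 psuppJ -/(overlap g h x) b0.
have wt : #|psupp t| = w.
  rewrite /w -wk !(@card_psupp _ _ (k + q + r')) ?card_ord; try lia.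
  by rewrite -big_split /=; apply: eq_big_nat => j /andP[j2 _]; exact: tE.
(* A cancellation removes k moved points from each of the two factors. *)
have wt' : (0 < orbit_pts h k)%N -> w = (2 * k + #|psupp t'|)%N.
  move=> h0; rewrite /w; suff -> : #|psupp h| = (#|psupp t'| + k)%N by lia.
  rewrite -[X in (_ + X)%N]wk !(@card_psupp _ _ (k + q + q')) ?card_ord; try lia.
  rewrite -big_split /=; apply: eq_big_nat => j /andP[j2 _].
  by rewrite t'E // orbit_pts_kcycle.
pose c0 n : R := #|[pred x : 'S_n | B0 n x]|%:R / n`!%:R - 1.
pose c1 n : R := (orbit_pts h k)%:R * (fact_ratio R k n - 1).
have z1 : zseq c1.
  have h1 : (fun n => (orbit_pts h k)%:R * (fact_ratio R k n - 1)) @ \oo -->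
      ((orbit_pts h k)%:R * (1 - 1) : R).
    apply: cvgM; first exact: cvg_cst.
    by apply: cvgB; [exact: cvg_fact_ratio | exact: cvg_cst].
  by rewrite subrr mulr0 in h1.
have := gen_add B2 (gen_add (gen_X t (card_no_overlap g h)) (gen_X t' z1)).
move=> gg; apply: (gen_ext gg); near=> n => lam.
have n0 : (0 < n)%N by near: n; exact: nbhs_infty_gt.
have kqn : (k + q <= n)%N by near: n; exact: nbhs_infty_ge.
have kn : (k <= n)%N by lia.
have qn : (q <= n)%N by lia.
have rn' : (r' <= n)%N by near: n; exact: nbhs_infty_ge.
have qn' : (q' <= n)%N by near: n; exact: nbhs_infty_ge.
rewrite X_mul // -/g -/(G n) -/(H n) wk -/w.
set S2 := \sum_(x | ~~ B0 n x && ~~ B1 n x) _.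
have -> : \sum_x nchar R lam (G n * H n ^ x)%g =
    nchar R lam (extend n t) *+ #|[pred x : 'S_n | B0 n x]| +
    (\sum_(x | ~~ B0 n x && B1 n x) nchar R lam (G n * H n ^ x)%g + S2).
  rewrite (bigID (B0 n)) /=; congr (_ + _); last by rewrite (bigID (B1 n)).
  rewrite (eq_bigr (fun=> nchar R lam (extend n t))); last by move=> x; exact: B0E.
  by rewrite sumr_const.
have -> : \sum_(x | ~~ B0 n x && B1 n x) nchar R lam (G n * H n ^ x)%g =
    (orbit_pts h k * (n - k)`!)%:R * nchar R lam (extend n t').
  rewrite -(card_cancel k2 h kqn) -/(G n) -/(H n).
  rewrite (eq_bigl (B1 n)); last first.
    move=> x; case: (boolP (B1 n x)); rewrite ?andbF // andbT => b1.
    by apply/negP => b0; exact: disj01 b0 b1.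
  have [h0|h0] := posnP (orbit_pts h k).
    have : #|[pred x : 'S_n | B1 n x]| = 0%N by rewrite (card_cancel k2 h kqn) h0.
    move=> /[dup] c -> ; rewrite mul0r big1 // => x b1.
    by have := card0_eq c x; rewrite inE b1.
  rewrite (eq_bigr (fun=> nchar R lam (extend n t'))); last by move=> x b1; exact: B1E.
  by rewrite sumr_const mulr_natl.
have e1 : sq R n ^+ w * ((n`!%:R)^-1 * ((orbit_pts h k * (n - k)`!)%:R * nchar R lam (extend n t')))
    = (orbit_pts h k)%:R * fact_ratio R k n * X t' lam.
  have [h0|h0] := posnP (orbit_pts h k); first by rewrite h0 !mul0r !mulr0.
  have p0 : sq R n ^+ (2 * k) != 0 by rewrite expf_neq0 // gt_eqF // sq_gt0.
  rewrite (wt' h0) exprD natrM.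
  have : fact_ratio R k n = sq R n ^+ (2 * k) * ((n - k)`!%:R / n`!%:R).
    by rewrite fact_ratioE // mulrC divfK.
  by rewrite /X => ->; ring.
have e0 : sq R n ^+ w * ((n`!%:R)^-1 * (nchar R lam (extend n t) *+ #|[pred x : 'S_n | B0 n x]|)) =
    (c0 n + 1) * X t lam.
  rewrite /c0 subrK /X wt -[nchar _ _ _ *+ _]mulr_natr; ring.
rewrite !mulrDr e1 e0 /c0 /c1; ring.
Unshelve. all: by end_near. Qed.

End Recursion.

(** * Hermite polynomials and joint moments *)

Section HermiteLimit.
Variable R : realType.
Local Notation gen := (@gen R).
Local Notation X := (X R).
Local Notation herm := (@hermite R).

Lemma cvg_bigsum (I : Type) (l : seq I) (u : I -> nat -> R) (L : I -> R) :
  (forall i, u i @ \oo --> L i) -> (fun n => \sum_(i <- l) u i n) @ \oo --> (\sum_(i <- l) L i : R).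
Proof.
move=> h; elim: l => [|i l IH].
  by rewrite big_nil (_ : (fun n => _) = cst 0); [exact: cvg_cst | apply/funext => n; rewrite big_nil].
rewrite big_cons (_ : (fun n => _) = (fun n => u i n + \sum_(j <- l) u j n)).
  by apply: cvgD.
by apply/funext => n; rewrite big_cons.
Qed.

Lemma hermiteS m : herm m.+1 = 'X * herm m - m%:R *: herm m.-1.
Proof. by case: m => [|m] //=; rewrite mulr1 scale0r subr0. Qed.

Lemma size_hermite m : size (herm m) = m.+1 /\ herm m \is monic.
Proof.
elim/ltn_ind: m => -[|[|m]] IH; first by rewrite /= size_poly1 monic1.
  by rewrite /= size_polyX monicX.
have [s1 m1] := IH m.+1 (ltnSn _); have [s0 m0] := IH m (ltnW (ltnSn _)).
have nz : herm m.+1 != 0 by rewrite monic_neq0.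
have sX : size ('X * herm m.+1) = m.+3 by rewrite mulrC size_mulX // s1.
have lt : (size (- (m.+1%:R *: herm m))%R < size ('X * herm m.+1)%R)%N.
  by rewrite size_polyN sX; apply: leq_ltn_trans (size_scale_leq _ _) _; rewrite s0; lia.
rewrite hermiteS; split; first by rewrite size_polyDl.
by rewrite monicE lead_coefDl // mulrC lead_coefMX -monicE.
Qed.

Lemma hermite_basis (p : {poly R}) : exists c : nat -> R,
  p = \sum_(i < size p) c i *: herm i.
Proof.
have [d] := ubnP (size p); elim: d p => // d IH p.
have [->|p0 sp] := eqVneq p 0; first by exists (fun=> 0); rewrite size_poly0 big_ord0.
have [m szp] : exists m, size p = m.+1 by exists (size p).-1; rewrite prednK // lt0n size_poly_eq0.
pose q := p - lead_coef p *: herm m.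
have [sH mH] := size_hermite m.
have sq : (size q <= m)%N.
  apply/leq_sizeP => j; rewrite leq_eqVlt => /orP[/eqP <-|mj].
    rewrite coefB coefZ; move: mH; rewrite monicE /lead_coef sH /= => /eqP ->.
    by rewrite szp /= mulr1 subrr.
  by rewrite coefB coefZ !nth_default ?mulr0 ?subr0 // ?sH ?szp.
have [|c cE] := IH q; first by rewrite szp in sp; lia.
exists (fun i => if i == m then lead_coef p else if (i < size q)%N then c i else 0).
rewrite szp big_ord_recr /= eqxx -[LHS](subrK (lead_coef p *: herm m)) -/q; congr (_ + _).
rewrite {1}cE (big_ord_widen_cond m xpredT (fun i => c i *: herm i)) // big_mkcond.
apply: eq_bigr => i _ /=; have -> : (i == m :> nat) = false by rewrite ltn_eqF // ltn_ord.
by case: ifP => //; rewrite scale0r.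
Qed.

Definition V (k : nat) n (lam : intpart n) : R := X (kcycle k) lam / Num.sqrt k%:R.

Definition Hfac (k m : nat) (x : R) : R := Num.sqrt k%:R ^+ m * (herm m).[x].

Definition Hm (K : nat) (a : nat -> nat) n (lam : intpart n) : R :=
  \prod_(2 <= k < K.+1) Hfac k (a k) (V k lam).

Lemma sqrt_neq0 k : (0 < k)%N -> Num.sqrt (k%:R : R) != 0.
Proof. by move=> k0; rewrite sqrtr_eq0 -ltNge ltr0n. Qed.

Lemma Hfac_rec k m n (lam : intpart n) : (2 <= k)%N ->
  Hfac k m.+1 (V k lam) = X (kcycle k) lam * Hfac k m (V k lam) -
    (k * m)%:R * Hfac k m.-1 (V k lam).
Proof.
move=> k2; have k0 := @sqrt_neq0 k (ltnW k2).
have kk : Num.sqrt (k%:R : R) * Num.sqrt k%:R = k%:R by rewrite -expr2 sqr_sqrtr.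
have -> : X (kcycle k) lam = Num.sqrt k%:R * V k lam by rewrite /V mulrC divfK.
rewrite /Hfac hermiteS hornerD hornerN hornerZ hornerM hornerX exprS.
case: m => [|m]; first by rewrite muln0 expr0; ring.
rewrite [m.+1.-1]/= exprS natrM; move: kk k0.
move: (Num.sqrt _) (V k lam) => s x kk s0; move: ((herm m.+1).[x]) ((herm m).[x]) => a b.
by rewrite -kk; ring.
Qed.

Lemma Hm_split K a k n (lam : intpart n) : (2 <= k <= K)%N ->
  Hm K a lam = Hfac k (a k) (V k lam) *
    \prod_(2 <= j < K.+1 | j != k) Hfac j (a j) (V j lam).
Proof.
move=> kK; rewrite /Hm (bigD1_seq k) //=; last by rewrite iota_uniq.
by rewrite mem_index_iota ltnS.
Qed.

Definition dec (a : nat -> nat) (k : nat) (j : nat) : nat := if j == k then (a j).-1 else a j.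

Lemma Hm_rec K a k n (lam : intpart n) : (2 <= k <= K)%N -> (0 < a k)%N ->
  Hm K a lam = X (kcycle k) lam * Hm K (dec a k) lam -
    (k * (a k).-1)%:R * Hm K (dec (dec a k) k) lam.
Proof.
move=> kK ak; rewrite !(Hm_split _ _ kK) /dec eqxx.
have E (b : nat -> nat) : (forall j, j != k -> b j = a j) ->
    \prod_(2 <= j < K.+1 | j != k) Hfac j (b j) (V j lam) =
    \prod_(2 <= j < K.+1 | j != k) Hfac j (a j) (V j lam).
  by move=> ba; apply: eq_bigr => j /ba ->.
rewrite (E (fun j => if j == k then (a j).-1 else a j)); last by move=> j /negPf ->.
rewrite (E (fun j => if j == k then (if j == k then (a j).-1 else a j).-1 else
  if j == k then (a j).-1 else a j)); last by move=> j /negPf ->.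
case: (a k) ak => // m _ /=; rewrite Hfac_rec; last by case/andP: kK.
ring.
Qed.

Lemma sum_dec K a k : (2 <= k <= K)%N -> (0 < a k)%N ->
  (\sum_(2 <= j < K.+1) a j = (\sum_(2 <= j < K.+1) dec a k j).+1)%N.
Proof.
move=> kK ak; rewrite (bigD1_seq k) //= ?iota_uniq ?mem_index_iota ?ltnS //.
rewrite [in RHS](bigD1_seq k) //= ?iota_uniq ?mem_index_iota ?ltnS //.
rewrite {1}/dec eqxx -addSn prednK //; congr (_ + _)%N.
by apply: eq_bigr => j /negPf jk; rewrite /dec jk.
Qed.

Lemma X1 n (lam : intpart n) : X (1%g : 'S_0) lam = 1.
Proof.
rewrite /X (_ : #|psupp _| = 0%N); last by apply: eq_card0 => i; rewrite inE perm1 eqxx.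
rewrite expr0 mul1r /nchar extend1 // young_rep1 mxtrace1 divff // pnatr_eq0 -lt0n.
exact: dim_gt0.
Qed.

Lemma orbit_pts_id (T : finType) j : (2 <= j)%N -> orbit_pts (1%g : {perm T}) j = 0%N.
Proof.
move=> j2; apply: eq_card0 => i; rewrite inE; apply/negbTE; rewrite ltn_eqF //.
by rewrite (eqP (_ : orbit_size _ _ == 1%N)) ?orbit_size1 ?perm1.
Qed.

Definition has_type K (a : nat -> nat) r (s : 'S_r) :=
  forall j, (2 <= j)%N -> orbit_pts s j = if (j <= K)%N then (j * a j)%N else 0%N.

(** Induction on the number of nontrivial cycles. Splitting off one k-cycle, X_s satisfies
    [main_recursion] up to an error of vanishing coefficients, while [Hm] satisfies the same
    recurrence exactly by [Hm_rec]; the error from the induction hypothesis survives multiplication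
    by the k-cycle variable. *)
Lemma X_hermite K N a : (\sum_(2 <= j < K.+1) a j <= N)%N ->
  exists r (s : 'S_r), has_type K a s /\ gen (@zseq R) (fun n lam => X s lam - Hm K a lam).
Proof.
elim/ltn_ind: N a => N IH a aN.
have [|none] := pickP (fun k : 'I_K.+1 => (2 <= k)%N && (0 < a k)%N); last first.
  have a0 j : (2 <= j <= K)%N -> a j = 0%N.
    move=> /andP[j2 jK]; have jK' : (j < K.+1)%N by [].
    by have := none (Ordinal jK'); rewrite /= j2 /= lt0n => /negbT; rewrite negbK => /eqP.
  exists 0%N, 1%g; split.
    move=> j j2; rewrite orbit_pts_id //.
    by case: ifP => // jK; rewrite a0 ?muln0 // j2.
  apply: gen_nil; near=> n => lam; rewrite X1 /Hm big_nat_cond big1 ?subrr //.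
  by move=> j /andP[/andP[j2 jK] _]; rewrite /Hfac a0 ?j2 // expr0 hornerC mulr1.
move=> k /andP[k2 ak]; have kK : (2 <= k <= K)%N by rewrite k2 -ltnS /=.
have sd := sum_dec kK ak.
have NN : (N.-1 < N)%N by move: aN; rewrite sd; case: (N).
have aN' : (\sum_(2 <= j < K.+1) dec a k j <= N.-1)%N by move: aN; rewrite sd; case: (N).
have [r0 [h [hT hG]]] := IH N.-1 NN (dec a k) aN'.
have hk : orbit_pts h k = (k * (a k).-1)%N.
  by rewrite hT // -ltnS ltn_ord /dec eqxx.
have [t tE] := disjoint_union_exists k2 h.
have decP j : dec a k j = if j == k then (a j).-1 else a j by [].
have kk : (k <= K)%N by rewrite -ltnS.
exists (k + r0)%N, t; split.
  move=> j j2; rewrite tE // orbit_pts_kcycle hT // decP.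
  by case: eqP => [->|_] //; rewrite kk; case: (a k) ak => // m _; rewrite mulnS.
(* If h has no k-cycle left, the coefficient in front of [X t'] is 0 and any permutation will do;
   otherwise the induction hypothesis is used a second time. *)
have [r1 [t' [t'E t'G]]] : exists r1 (t' : 'S_r1),
    ((0 < orbit_pts h k)%N -> forall j, (2 <= j)%N ->
       orbit_pts h j = (orbit_pts t' j + if j == k :> nat then val k else 0)%N) /\
    gen (@zseq R) (fun n lam => (orbit_pts h k)%:R * (X t' lam - Hm K (dec (dec a k) k) lam)).
  have [h0|h0] := posnP (orbit_pts h k).
    exists 0%N, 1%g; split => //; apply: gen_nil; near=> n => lam.
    by rewrite h0 mul0r.
  have ak' : (0 < dec a k k)%N.
    by rewrite decP eqxx; move: h0; rewrite hk muln_gt0 => /andP[].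
  have sd' := sum_dec kK ak'.
  have aN2 : (\sum_(2 <= j < K.+1) dec (dec a k) k j <= N.-1)%N.
    by apply: leq_trans aN'; rewrite sd'.
  have [r1 [t' [t'T t'G]]] := IH N.-1 NN (dec (dec a k) k) aN2.
  exists r1, t'; split.
    move=> _ j j2; rewrite hT // t'T // [dec (dec a k) k j]/dec decP.
    case: eqP => [->|_]; last by rewrite addn0.
    by rewrite kk; move: ak'; rewrite decP eqxx; case: (a k).-1 => // m _ /=; rewrite mulnS addnC.
  apply: (gen_scale (Q := @zseq R)) t'G => b; exact: (@zseqM R _ b (bseq_cst _)).
have g1 := main_recursion R (t' := t') k2 tE t'E.
have g2 : gen (@zseq R) (fun n lam => X (kcycle k) lam * (X h lam - Hm K (dec a k) lam)).
  by apply: gen_mulX hG; exact: ideal_zseq.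
have gN Y : gen (@zseq R) Y -> gen (@zseq R) (fun n lam => -1 * Y n lam).
  by apply: (gen_scale (b := fun=> -1)) => b; exact: (@zseqM R _ b (bseq_cst _)).
apply: (gen_eq (gen_add (gN _ g1) (gen_add g2 (gN _ t'G)))) => n lam.
rewrite (Hm_rec _ kK ak) -hk; ring.
Unshelve. all: by end_near. Qed.

Lemma X_hermite_type K a r (s : 'S_r) : has_type K a s ->
  gen (@zseq R) (fun n lam => X s lam - Hm K a lam).
Proof.
move=> sT; have [r' [t [tT tG]]] := @X_hermite K _ a (leqnn _).
apply: (gen_ext tG); near=> n => lam; congr (_ - _).
apply: X_type => [||k k2]; [near: n; exact: nbhs_infty_ge | near: n; exact: nbhs_infty_ge |].
by rewrite sT // tT.
Unshelve. all: by end_near. Qed.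

Lemma ExB n (F G : intpart n -> R) : Ex (fun lam => F lam - G lam) = Ex F - Ex G.
Proof. by rewrite /Ex -sumrB; apply: eq_bigr => lam _; rewrite mulrBr. Qed.

Lemma Ex_Hm K a : (fun n => Ex (@Hm K a n)) @ \oo -->
  ([forall k : 'I_K.+1, (2 <= k)%N ==> (a k == 0%N)]%:R : R).
Proof.
have [r [s [sT sG]]] := @X_hermite K _ a (leqnn _).
have h1 := gen_small_Ex sG.
have s1 : (s == 1%g) = [forall k : 'I_K.+1, (2 <= k)%N ==> (a k == 0%N)].
  apply/eqP/forallP => [s1 k|h].
    apply/implyP => k2; have := sT k k2; rewrite -ltnS ltn_ord s1.
    by rewrite orbit_pts_id // => /esym/eqP; rewrite muln_eq0; lia.
  apply/permP => i; rewrite perm1; apply/eqP; rewrite -orbit_size1.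
  have := sT (orbit_size s i); have := orbit_size_gt0 s i.
  case: (ltngtP 1 (orbit_size s i)) => // o2 _ /(_ isT).
  have : (0 < orbit_pts s (orbit_size s i))%N by apply/card_gt0P; exists i; rewrite inE.
  move=> pos e; move: pos; rewrite e; case: ifP => // oK.
  by have := h (Ordinal (oK : orbit_size s i < K.+1)%N); rewrite /= o2 /= => /eqP ->; rewrite muln0.
have h2 : (fun n => (s == 1%g)%:R - Ex (fun lam : intpart n => X s lam - Hm K a lam)) @ \oo -->
    ((s == 1%g)%:R - 0 : R) by apply: cvgB => //; exact: cvg_cst.
rewrite subr0 s1 in h2; apply: cvg_trans h2; apply: near_eq_cvg; near=> n.
rewrite -s1 -(@Ex_X R _ s n); last by near: n; exact: nbhs_infty_ge.
by rewrite (@ExB n (fun lam => X s lam) (@Hm K a n)) subKr.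
Unshelve. all: by end_near. Qed.

Lemma gen_cst c : gen (@bseq R) (fun _ _ => c).
Proof.
by apply: (gen_eq (gen_X (1%g : 'S_0) (bseq_cst c))) => n lam; rewrite X1 mulr1.
Qed.

Lemma gen_V k : gen (@bseq R) (@V k).
Proof.
apply: (gen_eq (gen_mul (@ideal_bseq R) (gen_X1 R (kcycle k)) (gen_cst (Num.sqrt k%:R)^-1))).
by [].
Qed.

Lemma gen_horner Y (p : {poly R}) : gen (@bseq R) Y -> gen (@bseq R) (fun n lam => p.[Y n lam]).
Proof.
move=> gY; elim/poly_ind: p => [|p c IH].
  by apply: (gen_eq (gen0 (@bseq R))) => n lam; rewrite horner0.
apply: (gen_eq (gen_add (gen_mul (@ideal_bseq R) IH gY) (gen_cst c))) => n lam.
by rewrite hornerMXaddC.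
Qed.

Lemma gen_prod (l : seq nat) (P : pred nat) (Y : nat -> forall n, intpart n -> R) :
  (forall k, gen (@bseq R) (Y k)) -> gen (@bseq R) (fun n lam => \prod_(k <- l | P k) Y k n lam).
Proof.
move=> h; elim: l => [|k l IH].
  by apply: (gen_eq (gen_cst 1)) => n lam; rewrite big_nil.
have [Pk|Pk] := boolP (P k).
  by apply: (gen_eq (gen_mul (@ideal_bseq R) (h k) IH)) => n lam; rewrite big_cons Pk.
by apply: (gen_eq IH) => n lam; rewrite big_cons (negPf Pk).
Qed.

Lemma gen_Hm K a : gen (@bseq R) (@Hm K a).
Proof.
apply: gen_prod => k; apply: (gen_mul (@ideal_bseq R) (gen_cst (Num.sqrt k%:R ^+ a k))).
exact: gen_horner (gen_V k).
Qed.

Variable gam : {poly R} -> R.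
Hypothesis gam_lin : forall (c : nat -> R) (p : nat -> {poly R}) m,
  gam (\sum_(i < m) c i *: p i) = \sum_(i < m) c i * gam (p i).
Hypothesis gam_hermite : forall m, gam (herm m) = (m == 0%N)%:R.

(** The abstract [gam] stands for the mean under a standard Gaussian. Both sides are multilinear in
    the polynomials, so they may be expanded in the Hermite basis one variable at a time, which
    reduces the claim to [Ex_Hm]. *)
Lemma poly_moments K (q : nat -> {poly R}) :
  (fun n => Ex (fun lam : intpart n => \prod_(2 <= k < K.+1) (q k).[V k lam])) @ \oo -->
  (\prod_(2 <= k < K.+1) gam (q k) : R).
Proof.
(* The variables from m on already carry Hermite polynomials; the index of such a polynomial is
   recovered from its degree as the predecessor of its size. *)
have gen_case m : forall q : nat -> {poly R}, (forall k, (m <= k)%N -> q k = herm (size (q k)).-1) ->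
    (fun n => Ex (fun lam : intpart n => \prod_(2 <= k < K.+1) (q k).[V k lam])) @ \oo -->
    (\prod_(2 <= k < K.+1) gam (q k) : R).
  elim: m => [|m IH] {}q qH.
    pose a k := (size (q k)).-1.
    pose c : R := \prod_(2 <= k < K.+1) Num.sqrt k%:R ^+ a k.
    have c0 : c != 0.
      rewrite /c big_nat_cond; elim/big_ind: _ => [|x y|k /andP[/andP[k2 _] _]].
      - exact: oner_neq0.
      - exact: mulf_neq0.
      - by rewrite expf_neq0 // sqrt_neq0 // ltnW.
    have h : (fun n => c^-1 * Ex (@Hm K a n)) @ \oo -->
        (c^-1 * ([forall k : 'I_K.+1, (2 <= k)%N ==> (a k == 0%N)]%:R) : R).
      by apply: cvgM; [exact: cvg_cst | exact: Ex_Hm].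
    have -> : \prod_(2 <= k < K.+1) gam (q k) =
        c^-1 * ([forall k : 'I_K.+1, (2 <= k)%N ==> (a k == 0%N)]%:R).
      case: forallP => [a0|na].
        have a0' k : (2 <= k < K.+1)%N -> a k = 0%N.
          by move=> /andP[k2 kK]; have /implyP/(_ k2)/eqP := a0 (Ordinal kK).
        rewrite mulr1 /c big_nat_cond big1 => [|k /andP[kK _]].
          rewrite big_nat_cond big1 ?invr1 // => k /andP[kK _].
          by rewrite a0' // expr0.
        by rewrite qH // -/(a k) a0' // gam_hermite eqxx.
      have [k] : exists k : 'I_K.+1, ~~ ((2 <= k)%N ==> (a k == 0%N)).
        by apply/existsP; rewrite -negb_forall; apply/forallP.
      rewrite negb_imply => /andP[k2 ak]; rewrite mulr0.
      rewrite (bigD1_seq (val k)) //= ?iota_uniq ?mem_index_iota ?k2 ?ltn_ord //.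
      by rewrite qH // -/(a k) gam_hermite (negPf ak) mul0r.
    apply: cvg_trans h; apply: near_eq_cvg; near=> n.
    rewrite -ExZ; apply: eq_Ex => lam; rewrite /Hm /Hfac big_split /= -/c mulKf //.
    by apply: eq_bigr => k _; rewrite [in RHS]qH.
  pose upd p k := if k == m then p else q k.
  have updH i k : (m <= k)%N -> upd (herm i) k = herm (size (upd (herm i) k)).-1.
    move=> mk; rewrite /upd; case: eqP => [_|/eqP km]; first by have [-> _] := size_hermite i.
    by apply: qH; rewrite ltn_neqAle eq_sym km.
  have [mK|mK] := boolP (2 <= m < K.+1)%N; last first.
    have := IH _ (updH 0%N).
    have E (S : nat -> {poly R} -> R) : \prod_(2 <= k < K.+1) S k (upd (herm 0) k) =
        \prod_(2 <= k < K.+1) S k (q k).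
      apply: eq_big_nat => k kK; rewrite /upd; case: eqP => // km.
      by rewrite km in kK; rewrite kK in mK.
    rewrite (E (fun _ p => gam p)); apply: cvg_trans; apply: near_eq_cvg; near=> n.
    by apply: eq_Ex => lam; rewrite (E (fun k p => p.[V k lam])).
  have [c] := hermite_basis (q m); move: (size (q m)) => d cE.
  have split (S : nat -> {poly R} -> R) p : \prod_(2 <= k < K.+1) S k (upd p k) =
      S m p * \prod_(2 <= k < K.+1 | k != m) S k (q k).
    rewrite (bigD1_seq m) //= ?iota_uniq ?mem_index_iota // /upd eqxx; congr (_ * _).
    by apply: eq_bigr => k /negPf ->.
  have updq k : q k = upd (q m) k by rewrite /upd; case: eqP => [->|].
  have -> : \prod_(2 <= k < K.+1) gam (q k) =
      \sum_(i < d) c i * \prod_(2 <= k < K.+1) gam (upd (herm i) k).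
    rewrite (eq_bigr (fun k => gam (upd (q m) k))); last by move=> k _; rewrite -updq.
    rewrite (split (fun _ => gam)) {1}cE gam_lin mulr_suml; apply: eq_bigr => i _.
    by rewrite (split (fun _ => gam)) mulrA.
  have h : (fun n => \sum_(i < d) c i *
      Ex (fun lam : intpart n => \prod_(2 <= k < K.+1) (upd (herm i) k).[V k lam])) @ \oo -->
      (\sum_(i < d) c i * \prod_(2 <= k < K.+1) gam (upd (herm i) k) : R).
    apply: (cvg_bigsum (u := fun i n => _)) => i; apply: cvgM; [exact: cvg_cst | exact: IH (updH _)].
  apply: cvg_trans h; apply: near_eq_cvg; near=> n.
  under eq_bigr do rewrite -ExZ.
  rewrite -(Ex_sum xpredT); apply: eq_Ex => lam.
  rewrite [RHS](eq_bigr (fun k => (upd (q m) k).[V k lam])); last by move=> k _; rewrite -updq.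
  rewrite (split (fun k p => p.[V k lam])) {1}cE horner_sum mulr_suml; apply: eq_bigr => i _.
  by rewrite (split (fun k p => p.[V k lam])) hornerZ mulrA.
(* Beyond K the polynomial is replaced by the constant Hermite polynomial, so that the general case
   applies with m = K + 1 and the product is unchanged. *)
pose q' k := if (k < K.+1)%N then q k else herm 0.
have := @gen_case K.+1 q' _.
have E (S : nat -> {poly R} -> R) : \prod_(2 <= k < K.+1) S k (q' k) =
    \prod_(2 <= k < K.+1) S k (q k).
  by apply: eq_big_nat => k /andP[_ kK]; rewrite /q' kK.
rewrite (E (fun _ => gam)) => h; apply: cvg_trans (h _).
  apply: near_eq_cvg; near=> n.
  by apply: eq_Ex => lam; rewrite (E (fun k p => p.[V k lam])).
move=> k kK; rewrite /q' ltnNge kK /=.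
by have [-> _] := size_hermite 0.
Unshelve. all: by end_near. Qed.

End HermiteLimit.

(** * The last letter order and partial traces *)

Section LastLetter.
Variables (n : nat) (lam : intpart n).
Implicit Types (T S : syt lam).

Lemma card_row_lt T (l : 'I_n) :
  #|[pred j : 'I_n | ((T j).1 == (T l).1) && (j < l)%N]| = (T l).2.
Proof.
have cl : #|[pred a : 'I_n | (a < (T l).2)%N]| = (T l).2.
  rewrite -sum1_card -[RHS]card_ord -sum1_card (big_ord_widen n (fun=> 1%N)) //.
  exact: ltnW.
rewrite -[RHS]cl -(card_in_imset (f := fun j => (T j).2)).
  apply: eq_card => a; apply/imsetP/idP => [[j]|].
    rewrite !inE => /andP[/eqP e jl] ->; rewrite ltnNge; apply/negP => h.
    by have := @syt_le _ _ T l j; rewrite e leqnn => /(_ isT h); lia.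
  rewrite inE => al.
  have [j Tj] : exists j : 'I_n, T j = ((T l).1, a).
    by apply: syt_onto; rewrite /in_diagram /=; exact: ltn_trans al (syt_diagram T l).
  exists j; last by rewrite Tj.
  by rewrite inE Tj eqxx /=; apply: (@syt_row _ _ T); rewrite Tj.
move=> j j'; rewrite !inE => /andP[/eqP e _] /andP[/eqP e' _] e2.
by apply: (@syt_inj _ _ T); rewrite [LHS]surjective_pairing [RHS]surjective_pairing e e' e2.
Qed.

Lemma card_row T (b : 'I_n) : #|[pred j : 'I_n | (T j).1 == b]| = part lam b.
Proof.
have cl : #|[pred a : 'I_n | (a < part lam b)%N]| = part lam b.
  rewrite -sum1_card -[RHS]card_ord -sum1_card (big_ord_widen n (fun=> 1%N)) //.
  exact: part_le.
rewrite -[RHS]cl -(card_in_imset (f := fun j => (T j).2)).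
  apply: eq_card => a; apply/imsetP/idP => [[j]|].
    by rewrite !inE => /eqP <- ->; exact: syt_diagram.
  rewrite inE => ab; have [j Tj] := @syt_onto _ _ T (b, a) ab.
  by exists j; rewrite ?inE Tj ?eqxx.
move=> j j'; rewrite !inE => /eqP e /eqP e' e2.
by apply: (@syt_inj _ _ T); rewrite [LHS]surjective_pairing [RHS]surjective_pairing e e' e2.
Qed.

Lemma card_row_split T (b : 'I_n) m :
  (#|[pred j : 'I_n | ((T j).1 == b) && (j < m)%N]| +
   #|[pred j : 'I_n | ((T j).1 == b) && (m <= j)%N]| = part lam b)%N.
Proof.
rewrite -(card_row T) -!sum1_card [RHS](bigID (fun j : 'I_n => (j < m)%N)) /=.
by congr (_ + _)%N; apply: eq_bigl => j; rewrite !inE // -leqNgt.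
Qed.

(** Rows suffice, because the column of l is the length of its row minus the number of entries at
    least l in that row. The order compares rows only, and this is how it recognizes blocks. *)
Lemma rows_agree m T S : (forall l : 'I_n, (m <= l)%N -> (T l).1 = (S l).1) -> agree m T S.
Proof.
move=> TS; apply/agreeP => l ml.
rewrite [LHS]surjective_pairing [RHS]surjective_pairing TS //; congr pair; apply: val_inj => /=.
rewrite -!card_row_lt; have := card_row_split T (T l).1 l; have := card_row_split S (S l).1 l.
rewrite (TS l ml).
suff -> : #|[pred j : 'I_n | ((T j).1 == (S l).1) && (l <= j)%N]| =
          #|[pred j : 'I_n | ((S j).1 == (S l).1) && (l <= j)%N]| by lia.
apply: eq_card => j; rewrite !inE; case: leqP => lj; rewrite ?andbF // TS //.
exact: leq_trans ml lj.
Qed.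

Lemma ll_ltP T S : reflect (exists k : 'I_n, ((S k).1 < (T k).1)%N /\
  forall l : 'I_n, (k < l)%N -> (T l).1 = (S l).1) (ll_lt T S).
Proof.
apply: (iffP existsP) => -[k].
  by case/andP=> h1 /forallP h2; exists k; split => // l kl; apply/eqP; exact: (implyP (h2 l)).
by case=> h1 h2; exists k; rewrite h1; apply/forallP => l; apply/implyP => /h2 ->.
Qed.

Lemma ll_lt_trans T S U : ll_lt T S -> ll_lt S U -> ll_lt T U.
Proof.
move=> /ll_ltP[k [h1 h2]] /ll_ltP[k' [h1' h2']]; apply/ll_ltP.
case: (ltngtP k k') => [kk|kk|/val_inj kk].
- by exists k'; rewrite h2 //; split => // l kl; rewrite h2 ?h2' //; lia.
- by exists k; rewrite -h2' //; split => // l kl; rewrite h2 ?h2' //; lia.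
- subst k'; exists k; split; first exact: ltn_trans h1' h1.
  by move=> l kl; rewrite h2 ?h2'.
Qed.

Lemma ll_lt_irr T : ~~ ll_lt T T.
Proof. by apply/ll_ltP => -[k []]; rewrite ltnn. Qed.

Lemma ll_lt_total T S : [|| T == S, ll_lt T S | ll_lt S T].
Proof.
have [E|E] := boolP [forall k, (T k).1 == (S k).1].
  have /agreeP TS : agree 0 T S by apply: rows_agree => l _; apply/eqP/(forallP E).
  by rewrite (_ : T = S) ?eqxx //; apply/val_inj/ffunP => l; exact: TS.
have [k0 k0P] : exists k, (T k).1 != (S k).1 by apply/existsP; rewrite -negb_forall.
pose k := [arg max_(k > k0 | (T k).1 != (S k).1) (k : nat)].
have [kP kmax] : (T k).1 != (S k).1 /\ forall l : 'I_n, (k < l)%N -> (T l).1 = (S l).1.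
  rewrite /k; case: arg_maxnP => // j jP jmax; split => // l jl; apply/eqP/negPn/negP => h.
  by have := jmax l h; lia.
have : ((S k).1 < (T k).1)%N || ((T k).1 < (S k).1)%N.
  by rewrite -neq_ltn eq_sym.
case/orP => h; apply/orP; right; apply/orP; [left|right]; apply/ll_ltP; exists k; split => //.
by move=> l /kmax ->.
Qed.

Lemma ll_le_trans : transitive (@ll_le n lam).
Proof.
move=> S T U; rewrite /ll_le => /orP[/eqP-> //|TS] /orP[/eqP<-|SU].
  by rewrite TS orbT.
by rewrite (ll_lt_trans TS SU) orbT.
Qed.

Lemma ll_le_total : total (@ll_le n lam).
Proof.
move=> T S; rewrite /ll_le; have := ll_lt_total T S.
by case/or3P => ->; rewrite ?orbT // ?orTb.
Qed.

Lemma ll_lt_idx T S : ll_lt T S -> (syt_idx T < syt_idx S)%N.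
Proof.
move=> TS; rewrite ltnNge; apply/negP => ST.
have srt : sorted (@ll_le n lam) (syt_enum lam) by apply: sort_sorted; exact: ll_le_total.
have : ll_le (tnth (syt_enum lam) (syt_idx S)) (tnth (syt_enum lam) (syt_idx T)).
  rewrite !(tnth_nth S); apply: (sorted_leq_nth ll_le_trans _ _ srt) => //.
  - by move=> U; rewrite /ll_le eqxx.
  - by rewrite inE size_tuple.
  - by rewrite inE size_tuple.
rewrite !syt_idxK /ll_le => /orP[/eqP e|h].
  by move: TS; rewrite e (negPf (ll_lt_irr _)).
by have := ll_lt_trans TS h; rewrite (negPf (ll_lt_irr _)).
Qed.

Lemma agree_row m T S (l : 'I_n) : agree m T S -> (m <= l)%N -> (T l).1 = (S l).1.
Proof. by move=> /agreeP TS ml; rewrite TS. Qed.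

(** Tableaux of different blocks are separated by an entry not below m, and its row is common to
    each block; so whole blocks are ordered, and each is an interval. *)
Lemma ll_lt_block m T S T' S' : ~~ agree m T S -> agree m T T' -> agree m S S' ->
  ll_lt T S -> ll_lt T' S'.
Proof.
move=> nTS TT' SS' /ll_ltP[k [h1 h2]]; apply/ll_ltP; exists k.
have mk : (m <= k)%N.
  rewrite leqNgt; apply: contra nTS => km; apply: rows_agree => l ml; apply: h2.
  exact: leq_trans ml.
rewrite -(agree_row SS' mk) -(agree_row TT' mk); split => // l kl.
have ml : (m <= l)%N by lia.
by rewrite -(agree_row SS' ml) -(agree_row TT' ml) h2.
Qed.

Lemma row_le T (k : 'I_n) : ((T k).1 <= k)%N.
Proof.
move: {2}(val (T k).1) (leqnn (T k).1) => b; elim: b k => [|b IH] k bk; first by move: bk => /=; lia.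
have [lt|e] : ((T k).1 <= b)%N \/ (T k).1 = b.+1 :> nat by lia.
  exact: IH.
have bn : (b < n)%N by have := ltn_ord (T k).1; lia.
have [j Tj] : exists j : 'I_n, T j = (Ordinal bn, (T k).2).
  apply: syt_onto; rewrite /in_diagram /=.
  by have := syt_diagram T k; rewrite /in_diagram => /leq_trans; apply; apply: part_anti; lia.
have jk : (j < k)%N by apply: (@syt_col _ _ T); rewrite Tj //= e.
by have := IH j; rewrite Tj /= => /(_ (leqnn _)); lia.
Qed.

Lemma col_le T (k : 'I_n) : ((T k).2 <= k)%N.
Proof.
rewrite -card_row_lt; apply: (@leq_trans #|[pred j : 'I_n | (j < k)%N]|).
  by apply: subset_leq_card; apply/fintype.subsetP => j; rewrite !inE => /andP[].
rewrite -sum1_card -[leqRHS]card_ord -sum1_card [leqRHS](big_ord_widen n (fun=> 1%N)) //.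
exact: ltnW.
Qed.

(** * Restriction of a tableau to its smallest entries *)

Section Restriction.
Variables (m : nat) (T : syt lam).
Hypothesis mn : (m <= n)%N.

Definition rcount S (b : nat) : nat := #|[pred j : 'I_n | ((S j).1 == b :> nat) && (j < m)%N]|.

Lemma rcount_agree S b : agree m T S -> rcount S b = rcount T b.
Proof.
move=> TS; have [bn|nb] := ltnP b n; last first.
  by rewrite /rcount !eq_card0 // => j; rewrite !inE; apply/negbTE; rewrite negb_and;
    apply/orP; left; rewrite neq_ltn (leq_trans (ltn_ord _) nb).
have := card_row_split T (Ordinal bn) m; have := card_row_split S (Ordinal bn) m.
have -> : #|[pred j : 'I_n | ((S j).1 == Ordinal bn) && (m <= j)%N]| =
          #|[pred j : 'I_n | ((T j).1 == Ordinal bn) && (m <= j)%N]|.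
  apply: eq_card => j; rewrite !inE; case: leqP => mj; rewrite ?andbF //.
  by rewrite (agree_row TS mj).
have e U : rcount U b = #|[pred j : 'I_n | ((U j).1 == Ordinal bn) && (j < m)%N]| by [].
rewrite !e; lia.
Qed.

Lemma rcount_le b : (rcount T b <= m)%N.
Proof.
apply: (@leq_trans #|[pred j : 'I_n | (j < m)%N]|).
  by apply: subset_leq_card; apply/fintype.subsetP => j; rewrite !inE => /andP[].
by rewrite -sum1_card -[leqRHS]card_ord -sum1_card [leqRHS](big_ord_widen n (fun=> 1%N)).
Qed.

Lemma rcount_part (b : 'I_n) : (rcount T b <= part lam b)%N.
Proof. by rewrite -(card_row_split T b m) leq_addr. Qed.

(** Moving up a column decreases the entry, so every column met by small entries in row c is also
    met by small entries in row b. *)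
Lemma rcount_anti (b c : nat) : (b <= c)%N -> (rcount T c <= rcount T b)%N.
Proof.
move=> bc; have [cn|nc] := ltnP c n; last first.
  rewrite /rcount (@eq_card0 _ [pred j : 'I_n | ((T j).1 == c :> nat) && _]) // => j.
  by rewrite !inE; apply/negbTE; rewrite negb_and neq_ltn (leq_trans (ltn_ord _) nc).
have bn : (b < n)%N by lia.
have inj (e : nat) : {in [pred j : 'I_n | ((T j).1 == e :> nat) && (j < m)%N] &,
    injective (fun j => (T j).2)}.
  move=> j j'; rewrite !inE => /andP[/eqP e1 _] /andP[/eqP e2 _] e3.
  by apply: (@syt_eq2 _ _ T); rewrite ?e1 ?e2 ?e3.
rewrite /rcount -(card_in_imset (@inj b)) -(card_in_imset (@inj c)).
apply: subset_leq_card; apply/fintype.subsetP => _ /imsetP[j jP ->].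
move: jP; rewrite inE => /andP[/eqP jc jm].
have [i Ti] : exists i : 'I_n, T i = (Ordinal bn, (T j).2).
  apply: syt_onto; rewrite /in_diagram /=.
  by have := syt_diagram T j; rewrite /in_diagram jc => /leq_trans; apply; exact: part_anti.
apply/imsetP; exists i; last by rewrite Ti.
rewrite inE Ti eqxx /=; apply: leq_ltn_trans jm; apply: (@syt_le _ _ T); rewrite Ti //= jc.
exact: bc.
Qed.

Definition rtuple : m.-tuple 'I_m.+1 := [tuple (inord (rcount T b) : 'I_m.+1) | b < m].

Lemma rtuple_nth b : (b < m)%N -> nth 0%N (map val rtuple) b = rcount T b.
Proof.
move=> bm; rewrite (nth_map ord0) ?size_tuple // -[b]/(val (Ordinal bm)) -tnth_nth tnth_mktuple.
by rewrite /= inordK // ltnS rcount_le.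
Qed.

Lemma rshape_subproof : sorted geq (map val rtuple) && (sumn (map val rtuple) == m).
Proof.
apply/andP; split.
  apply: (path_sorted (x := m)); apply/(pathP 0%N) => i; rewrite size_map size_tuple => im.
  case: i im => [|i] im /=; first by rewrite (rtuple_nth im) rcount_le.
  by rewrite (rtuple_nth (ltnW im)) (rtuple_nth im) rcount_anti.
rewrite sumnE (big_nth 0%N) size_map size_tuple big_mkord; apply/eqP.
rewrite (eq_bigr (fun b : 'I_m => rcount T b)); last by move=> b _; rewrite rtuple_nth.
transitivity #|[pred j : 'I_n | (j < m)%N]|; last first.
  by rewrite -sum1_card -[RHS]card_ord -sum1_card [RHS](big_ord_widen n (fun=> 1%N)).
have rm (j : 'I_n) : (j < m)%N -> ((T j).1 < m)%N by move=> jm; have := row_le T j; lia.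
transitivity (\sum_(b < m) \sum_(j < n) if ((T j).1 == b :> nat) && (j < m)%N then 1 else 0)%N.
  by apply: eq_bigr => b _; rewrite /rcount -sum1_card big_mkcond.
rewrite exchange_big /= -sum1_card [RHS]big_mkcond; apply: eq_bigr => j _; rewrite inE.
case: ifP => jm; last by rewrite big1 // => b _; rewrite andbF.
rewrite (bigD1 (Ordinal (rm j jm))) //= eqxx big1 ?addn0 // => b bne.
rewrite andbT; case: eqP => // e; case/eqP: bne; exact: val_inj.
Qed.

Definition rshape : intpart m := IntPart rshape_subproof.

Lemma rshape_part b : part rshape b = if (b < m)%N then rcount T b else 0%N.
Proof.
have -> : part rshape b = nth 0%N (map val rtuple) b by [].
case: ifP => bm; first exact: rtuple_nth.
by rewrite nth_default // size_map size_tuple leqNgt bm.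
Qed.

Lemma rshape_sub : part_sub rshape lam.
Proof.
apply/forallP => b; rewrite rshape_part ltn_ord.
exact: (rcount_part (widen_ord mn b)).
Qed.

Let wd (k : 'I_m) : 'I_n := widen_ord mn k.

Lemma rrow_lt S (k : 'I_m) : ((S (wd k)).1 < m)%N.
Proof. by have := row_le S (wd k); have := ltn_ord k; rewrite /=; lia. Qed.

Lemma rcol_lt S (k : 'I_m) : ((S (wd k)).2 < m)%N.
Proof. by have := col_le S (wd k); have := ltn_ord k; rewrite /=; lia. Qed.

Definition rfill S : {ffun 'I_m -> 'I_m * 'I_m} :=
  [ffun k => (Ordinal (rrow_lt S k), Ordinal (rcol_lt S k))].

Lemma rfill_standard S : agree m T S -> standard rshape (rfill S).
Proof.
move=> TS; apply/and4P; split.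
- apply/injectiveP => k l; rewrite !ffunE => -[e1 e2].
  by have := syt_eq2 e1 e2 => /(congr1 val) /= e; exact: val_inj.
- apply/forallP => k; rewrite ffunE /in_diagram /= rshape_part rrow_lt -(rcount_agree _ TS).
  rewrite -card_row_lt; apply: proper_card; rewrite properE; apply/andP; split.
    apply/fintype.subsetP => j; rewrite !inE => /andP[/eqP -> jk]; rewrite eqxx /=.
    exact: ltn_trans jk (ltn_ord k).
  apply/fintype.subsetPn; exists (wd k); first by rewrite inE eqxx /= ltn_ord.
  by rewrite inE eqxx ltnn.
- apply/forallP => k; apply/forallP => l; apply/implyP; rewrite !ffunE => /andP[/eqP[e] /= lt].
  have := @syt_row _ _ S (wd k) (wd l); apply => //; exact: val_inj.
- apply/forallP => k; apply/forallP => l; apply/implyP; rewrite !ffunE => /andP[/eqP[e] /= lt].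
  have := @syt_col _ _ S (wd k) (wd l); apply => //; exact: val_inj.
Qed.

(** Restriction to the entries below m is injective on a block, as its tableaux share the other
    entries. The restricted shape is contained in lam, so the hypothesis on dimension ratios bounds
    block sizes. *)
Lemma bsize_le_dim : (bsize m T <= Defs.dim rshape)%N.
Proof.
have inj : {in [pred S | agree m T S] &, injective rfill}.
  move=> S U; rewrite !inE => TS TU /ffunP e; apply/val_inj/ffunP => j.
  have [mj|jm] := leqP m j.
    by move: TS TU => /agreeP TS /agreeP TU; rewrite -[val S j]/(S j) -TS // TU.
  have := e (Ordinal jm); rewrite !ffunE => -[e1 e2].
  have -> : j = wd (Ordinal jm) by apply: val_inj.
  rewrite -[LHS]/(S _) -[RHS]/(U _) [LHS]surjective_pairing [RHS]surjective_pairing.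
  by congr pair; exact: val_inj.
rewrite /bsize -(card_in_imset inj) /Defs.dim -(card_imset _ (@val_inj _ _ (syt rshape))).
apply: subset_leq_card; apply/fintype.subsetP => _ /imsetP[S SP ->]; move: SP; rewrite inE => TS.
by apply/imsetP; exists (Syt (rfill_standard TS)).
Qed.

End Restriction.
End LastLetter.

(** * Partial traces compared with block averages *)

Section PartialTrace.
Variables (R : realType) (n : nat) (lam : intpart n).
Implicit Types (T S : syt lam).

Lemma nchar_le1 g : `|nchar R lam g| <= 1.
Proof.
have d0 : 0 < (Defs.dim lam)%:R :> R by rewrite ltr0n dim_gt0.
rewrite /nchar normrM normfV [`|_%:R|]ger0_norm // ler_pdivrMr // mul1r.
apply: le_trans (ler_norm_sum _ _ _) _.
apply: (@le_trans _ _ (\sum_(i < Defs.dim lam) 1)); last by rewrite sumr_const card_ord.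
by apply: ler_sum => i _; exact: young_rep_le1.
Qed.

Lemma count_initial (d : nat) (x : R) : 0 <= x <= d%:R ->
  #|[pred i : 'I_d | i.+1%:R <= x]|%:R <= x < #|[pred i : 'I_d | i.+1%:R <= x]|%:R + 1.
Proof.
move=> /andP[x0 xd]; set c := #|_|; have tx := truncn_itv x0.
set k := Num.truncn x in tx.
have kd : (k <= d)%N by rewrite -(ler_nat R); apply: le_trans xd; case/andP: tx.
have -> : c = k.
  rewrite /c -[RHS]card_ord -!sum1_card (big_ord_widen d (fun=> 1%N)) //.
  apply: eq_bigl => i; rewrite inE; apply/idP/idP => h.
    have : i.+1%:R < k.+1%:R :> R by apply: le_lt_trans h _; case/andP: tx.
    by rewrite ltr_nat.
  by apply: (@le_trans _ _ k%:R); [rewrite ler_nat | case/andP: tx].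
by rewrite natr1.
Qed.

Lemma sum_bchar_full m g (F : pred (syt lam)) :
  (forall T S, agree m T S -> F T -> F S) ->
  \sum_(T | F T) bchar R m T g = \sum_(T | F T) young_rep lam g (syt_idx T) (syt_idx T).
Proof.
move=> FA; have FE T S : agree m T S -> F T = F S.
  by move=> TS; apply/idP/idP; apply: FA; rewrite // agree_sym.
transitivity (\sum_(T : syt lam | F T) \sum_(S : syt lam | F S)
    (if agree m T S then young_rep lam g (syt_idx S) (syt_idx S) / (bsize m S)%:R else 0 : R)).
  apply: eq_bigr => T FT; rewrite /bchar /btrace mulr_suml big_mkcond [RHS]big_mkcond.
  apply: eq_bigr => S _; case: ifP => TS; last by case: ifP.
  rewrite -(FE _ _ TS) FT; congr (_ / _%:R); apply: eq_card => U; rewrite !inE.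
  by apply/idP/idP => h; [rewrite agree_sym in TS; exact: agree_trans h | exact: agree_trans h].
rewrite exchange_big /=; apply: eq_bigr => S FS; rewrite -big_mkcondr /=.
rewrite (eq_bigl (fun T => agree m S T)); last first.
  by move=> T; rewrite agree_sym; apply/andP/idP => [[]//|ST]; rewrite -(FE _ _ ST).
rewrite sumr_const -[LHS]mulr_natr -[#|_|]/(bsize m S) divfK // pnatr_eq0 -lt0n.
exact: bsize_gt0.
Qed.

Definition bdev m g : R :=
  (\sum_(T : syt lam) `|bchar R m T g - nchar R lam g|) / (Defs.dim lam)%:R.

(* Replacing bchar by nchar costs bdev on the complete blocks below u dim lambda;
   the one incomplete block and the rounding cost at most 3c. *)
Lemma partial_trace_dev (m : nat) (g : 'S_n) (u c : R) : (m <= n)%N -> perm_on (low n m) g ->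
  0 <= u <= 1 -> (forall T : syt lam, (bsize m T)%:R / (Defs.dim lam)%:R <= c) ->
  `|partial_trace lam u g - u * nchar R lam g| <= bdev m g + 3 * c.
Proof.
move=> mn gm /andP[u0 u1] bc.
have d0 : 0 < (Defs.dim lam)%:R :> R by rewrite ltr0n dim_gt0.
pose x : R := u * (Defs.dim lam)%:R.
have xI : 0 <= x <= (Defs.dim lam)%:R.
  by rewrite mulr_ge0 // ?ler_piMl // ltW.
pose I := [pred T : syt lam | ((syt_idx T).+1%:R : R) <= x].
have := count_initial xI; set cI := #|_| => /= /andP[cI1 cI2].
have cIE : #|I| = cI.
  rewrite /cI -!sum1_card [RHS](reindex (@syt_idx _ lam)) //=.
  by exists (tnth (syt_enum lam)) => i _; [exact: syt_idxK | exact: tnth_syt_idx].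
have Idown T S : ll_lt T S -> S \in I -> T \in I.
  rewrite !inE => /ll_lt_idx TS; apply: le_trans; rewrite ler_nat; lia.
(* I is an initial segment of the last letter order; F gathers the blocks contained in I, and J
   below is what remains of I. *)
pose F := [pred T : syt lam | [forall S, agree m T S ==> (S \in I)]].
have FI T : T \in F -> T \in I by rewrite inE => /forallP/(_ T)/implyP; apply; exact: agree_refl.
have FA T S : agree m T S -> F T -> F S.
  move=> TS /forallP FT; apply/forallP => U; apply/implyP => SU.
  by apply: (implyP (FT U)); exact: agree_trans SU.
(* Of two different blocks meeting I, one precedes the other entirely and thus lies in the initial
   segment; so at most one block is cut. *)
have IF T S : T \in I -> T \notin F -> S \in I -> S \notin F -> agree m T S.
  move=> TI; rewrite inE negb_forall => /existsP[T']; rewrite negb_imply => /andP[TT' T'I].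
  move=> SI; rewrite inE negb_forall => /existsP[S']; rewrite negb_imply => /andP[SS' S'I].
  apply/negPn/negP => nTS; have := ll_lt_total T S; case/or3P => [/eqP e|lt|lt].
  - by move: nTS; rewrite e agree_refl.
  - have := ll_lt_block nTS TT' (agree_refl m S) lt => /Idown/(_ SI) h.
    by rewrite h in T'I.
  - have nST : ~~ agree m S T by rewrite agree_sym.
    have := ll_lt_block nST SS' (agree_refl m T) lt => /Idown/(_ TI) h.
    by rewrite h in S'I.
pose J := [pred T | (T \in I) && (T \notin F)].
have cF : (#|F| + #|J| = cI)%N.
  rewrite -cIE -!sum1_card [RHS](bigID (mem F)) /=; congr (_ + _)%N.
  by apply: eq_bigl => T; apply/idP/andP => [TF|[]//]; split; rewrite ?FI.
have c1 : (Defs.dim lam)%:R^-1 <= c.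
  have [T _] : exists T : syt lam, true.
    by have /card_gt0P[T _] := dim_gt0 lam; exists T.
  apply: le_trans (bc T); rewrite -[leLHS]mul1r; apply: ler_wpM2r; first by rewrite invr_ge0 ltW.
  by rewrite ler1n bsize_gt0.
have cJ : #|J|%:R / (Defs.dim lam)%:R <= c.
  have [T TJ|J0] := pickP J; last by rewrite (eq_card0 J0) mul0r; apply: le_trans c1; rewrite invr_ge0 ltW.
  apply: le_trans (bc T); apply: ler_wpM2r; first by rewrite invr_ge0 ltW.
  rewrite ler_nat; apply: subset_leq_card; apply/fintype.subsetP => S.
  by move: TJ; rewrite !inE -!/(_ \in F) => /andP[TI TF] /andP[SI SF]; exact: IF.
have ptE : partial_trace lam u g = (\sum_(T | T \in I) young_rep lam g (syt_idx T) (syt_idx T)) / (Defs.dim lam)%:R.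
  rewrite /partial_trace -mulr_suml; congr (_ / _).
  rewrite (reindex (@syt_idx _ lam)) //=.
  by exists (tnth (syt_enum lam)) => i _; [exact: syt_idxK | exact: tnth_syt_idx].
have split : \sum_(T | T \in I) young_rep lam g (syt_idx T) (syt_idx T) =
    \sum_(T | T \in F) (bchar R m T g - nchar R lam g) + #|F|%:R * nchar R lam g +
    \sum_(T | T \in J) young_rep lam g (syt_idx T) (syt_idx T).
  have s1 : \sum_(T | T \in I) young_rep lam g (syt_idx T) (syt_idx T) =
      \sum_(T | T \in F) young_rep lam g (syt_idx T) (syt_idx T) +
      \sum_(T | T \in J) young_rep lam g (syt_idx T) (syt_idx T) :> R.
    rewrite (bigID (mem F)) /=; congr +%R; apply: eq_bigl => T.
    by apply/andP/idP => [[]//|TF]; split; rewrite ?FI.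
  rewrite s1 -(@sum_bchar_full m g (mem F)); last by move=> T S TS; exact: FA TS.
  by rewrite sumrB sumr_const mulr_natl subrK.
have e : partial_trace lam u g - u * nchar R lam g =
    (\sum_(T | T \in F) (bchar R m T g - nchar R lam g)) / (Defs.dim lam)%:R +
    ((#|F|%:R - x) * nchar R lam g) / (Defs.dim lam)%:R +
    (\sum_(T | T \in J) young_rep lam g (syt_idx T) (syt_idx T)) / (Defs.dim lam)%:R.
  rewrite ptE split /x; have := lt0r_neq0 d0.
  move: ((Defs.dim lam)%:R : R) (#|F|%:R : R) => D f D0; field; exact: D0.
rewrite e -/(bdev _ _); apply: le_trans (ler_normD _ _) _.
have nd y : `|y / (Defs.dim lam)%:R| = `|y| / (Defs.dim lam)%:R :> R.
  by rewrite normrM normfV [`|_%:R|]ger0_norm // ltW.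
have p1 : `|(\sum_(T | T \in J) young_rep lam g (syt_idx T) (syt_idx T)) / (Defs.dim lam)%:R| <= c.
  rewrite nd; apply: le_trans cJ; apply: ler_wpM2r; first by rewrite invr_ge0 ltW.
  apply: le_trans (ler_norm_sum _ _ _) _; rewrite -sumr_const.
  by apply: ler_sum => T _; exact: young_rep_le1.
(* One c pays for the elements of J, fewer than one block, and the other for rounding u dim lambda
   to an integer. *)
have p2 : `|((#|F|%:R - x) * nchar R lam g) / (Defs.dim lam)%:R| <= c + c.
  rewrite nd normrM; apply: (@le_trans _ _ ((#|J|%:R + 1) / (Defs.dim lam)%:R)).
    apply: ler_wpM2r; first by rewrite invr_ge0 ltW.
    rewrite -[leRHS]mulr1; apply: ler_pM => //; last exact: nchar_le1.
    have : cI%:R = #|F|%:R + #|J|%:R :> R by rewrite -natrD cF.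
    move=> cIs; rewrite ler_norml; have : 0 <= #|J|%:R :> R by exact: ler0n.
    by move: cI1 cI2; rewrite cIs => h1 h2 h3; apply/andP; split; lra.
  by rewrite mulrDl mul1r; apply: lerD.
have p3 : `|(\sum_(T | T \in F) (bchar R m T g - nchar R lam g)) / (Defs.dim lam)%:R| <= bdev m g.
  rewrite nd /bdev; apply: ler_wpM2r; first by rewrite invr_ge0 ltW.
  apply: le_trans (ler_norm_sum _ _ _) _; rewrite [leLHS]big_mkcond; apply: ler_sum => T _.
  by case: ifP.
have := ler_normD ((\sum_(T | T \in F) (bchar R m T g - nchar R lam g)) / (Defs.dim lam)%:R)
  (((#|F|%:R - x) * nchar R lam g) / (Defs.dim lam)%:R).
move: p1 p2 p3; set a := `|_|; set b := `|_|; set b' := `|_|; set b'' := `|_ + _|; lra.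
Qed.

End PartialTrace.

(** * Gaussian moments and Hermite polynomials *)

Section Moments.
Variable R : realType.
Local Notation herm := (@hermite R).

(* The moments of the standard Gaussian distribution. *)
Fixpoint gmom (m : nat) : R :=
  match m with
  | 0%N => 1
  | 1%N => 0
  | (m'.+1 as p).+1 => p%:R * gmom m'
  end.

Lemma gmomS m : gmom m.+1 = m%:R * gmom m.-1.
Proof. by case: m => [|m] //=; rewrite mul0r. Qed.

Definition gam (p : {poly R}) : R := \sum_(i < size p) p`_i * gmom i.

Lemma gamE m (p : {poly R}) : (size p <= m)%N -> gam p = \sum_(i < m) p`_i * gmom i.
Proof.
move=> pm; rewrite /gam (big_ord_widen m (fun i => p`_i * gmom i) pm) big_mkcond.
by apply: eq_bigr => i _; case: ltnP => // /leq_sizeP -> //; rewrite mul0r.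
Qed.

Lemma gamD p q : gam (p + q) = gam p + gam q.
Proof.
rewrite (@gamE (maxn (size p) (size q)) (p + q)) ?size_polyD //.
rewrite (@gamE _ p (leq_maxl (size p) (size q))) (@gamE _ q (leq_maxr (size p) (size q))).
by rewrite -big_split; apply: eq_bigr => i _; rewrite coefD mulrDl.
Qed.

Lemma gamZ c p : gam (c *: p) = c * gam p.
Proof.
rewrite (@gamE (size p) (c *: p)) ?size_scale_leq // mulr_sumr.
by apply: eq_bigr => i _; rewrite coefZ mulrA.
Qed.

Lemma gam0 : gam 0 = 0. Proof. by rewrite /gam size_poly0 big_ord0. Qed.

Lemma gam1 : gam 1 = 1.
Proof. by rewrite /gam size_poly1 big_ord1 coefC mulr1. Qed.

Lemma gamB p q : gam (p - q) = gam p - gam q.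
Proof. by rewrite -scaleN1r gamD gamZ mulN1r. Qed.

Lemma gam_lin (c : nat -> R) (p : nat -> {poly R}) m :
  gam (\sum_(i < m) c i *: p i) = \sum_(i < m) c i * gam (p i).
Proof.
by elim: m => [|m IH]; rewrite ?big_ord0 ?gam0 // !big_ord_recr /= gamD gamZ IH.
Qed.

(** Stein's identity, which on monomials is exactly the recurrence defining [gmom]. *)
Lemma gam_stein p : gam ('X * p) = gam p^`().
Proof.
rewrite mulrC (@gamE (size p).+2 (p * 'X)); last first.
  by apply: leq_trans (size_polyMleq _ _) _; rewrite size_polyX addn2.
rewrite (@gamE (size p) p^`()); last first.
  by have [->|p0] := eqVneq p 0; rewrite ?deriv0 // ltnW // lt_size_deriv.
rewrite big_ord_recl coefMX mul0r add0r.
rewrite (eq_bigr (fun i : 'I_(size p).+1 => p`_i * i%:R * gmom i.-1)); last first.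
  by move=> i _; rewrite lift0 coefMX /= -mulrA -gmomS.
rewrite big_ord_recl mulr0 mul0r add0r; apply: eq_bigr => i _.
by rewrite lift0 coef_deriv mulr_natr.
Qed.

Lemma deriv_hermite m : (herm m)^`() = m%:R *: herm m.-1.
Proof.
elim/ltn_ind: m => -[|m] IH; first by rewrite derivC scale0r.
rewrite hermiteS derivB derivM derivX mul1r derivZ !IH //; last by case: (m).
case: m IH => [|m] IH; first by rewrite !scale0r mulr0 addr0 subr0 scale1r.
rewrite [m.+2.-1]/= [m.+1.-1]/= hermiteS -scalerAr scalerA [m.+2%:R]mulrS scalerDl scale1r.
by rewrite scalerBr scalerA -addrA.
Qed.

(** The recurrence reads H_(m+1) = X H_m - H_m', whose mean is 0 by Stein's identity. *)
Lemma gam_hermite m : gam (herm m) = (m == 0%N)%:R.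
Proof.
case: m => [|m]; first exact: gam1.
by rewrite hermiteS gamB gam_stein deriv_hermite gamZ subrr.
Qed.

End Moments.

(** * Variance of the block traces *)

Section Close.
Variable R : realType.
Local Notation X := (X R).

Lemma cvg_expn (f : nat -> R) (l : R) m : f @ \oo --> l -> (fun n => f n ^+ m) @ \oo --> l ^+ m.
Proof.
move=> fl; elim: m => [|m IH]; first by under eq_fun do rewrite expr0; rewrite expr0; exact: cvg_cst.
by under eq_fun do rewrite exprS; rewrite exprS; apply: cvgM.
Qed.

Lemma probE n (A : pred (intpart n)) : plancherel_prob A = Ex (fun lam => (A lam)%:R) :> R.
Proof.
rewrite /plancherel_prob /Ex big_mkcond; apply: eq_bigr => lam _.
by case: (A lam); rewrite ?mulr1 ?mulr0.
Qed.

Lemma prob_ge0 n (A : pred (intpart n)) : 0 <= plancherel_prob A :> R.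
Proof. by apply: sumr_ge0 => lam _; exact: plancherel_ge0. Qed.

Lemma prob_markov n (A : pred (intpart n)) (F : intpart n -> R) : (forall lam, 0 <= F lam) ->
  (forall lam, A lam -> 1 <= F lam) -> plancherel_prob A <= Ex F.
Proof.
move=> F0 AF; rewrite probE; apply: Ex_le => lam.
by case: (boolP (A lam)) => // /AF.
Qed.

Lemma prob_le2 n (A B C : pred (intpart n)) : (forall lam, A lam -> B lam || C lam) ->
  plancherel_prob A <= plancherel_prob B + plancherel_prob C :> R.
Proof.
move=> ABC; rewrite !probE -ExD; apply: Ex_le => lam.
by rewrite -natrD ler_nat; have := ABC lam; case: (A lam) => // /(_ isT); case: (B lam); case: (C lam).
Qed.

Lemma dim_mul n (lam : intpart n) (c : R) : (Defs.dim lam)%:R * c = \sum_(T : syt lam) c.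
Proof. by rewrite sumr_const mulr_natl. Qed.

(** The variance of the block character at a uniform tableau: by [sum_bchar] its mean over the
    tableaux is the full normalized character. *)
Definition D2 n m (g : 'S_n) (lam : intpart n) : R :=
  (\sum_(T : syt lam) (bchar R m T g - nchar R lam g) ^+ 2) / (Defs.dim lam)%:R.

Lemma D2_ge0 n m (g : 'S_n) lam : 0 <= D2 m g lam.
Proof. by apply: divr_ge0 => //; apply: sumr_ge0 => T _; exact: sqr_ge0. Qed.

Lemma sum_nchar2 n (g : 'S_n) (lam : intpart n) :
  (\sum_(T : syt lam) bchar R n T g ^+ 2) / (Defs.dim lam)%:R = nchar R lam g ^+ 2.
Proof.
have d0 : (Defs.dim lam)%:R != 0 :> R by rewrite pnatr_eq0 -lt0n dim_gt0.
rewrite (eq_bigr (fun=> nchar R lam g ^+ 2)); last by move=> T _; rewrite bchar_all.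
by rewrite sumr_const -[_ *+ _]mulr_natr mulfK.
Qed.

Lemma D2E n m (g : 'S_n) (lam : intpart n) :
  D2 m g lam = (\sum_(T : syt lam) bchar R m T g ^+ 2) / (Defs.dim lam)%:R - nchar R lam g ^+ 2.
Proof.
have d0 : (Defs.dim lam)%:R != 0 :> R by rewrite pnatr_eq0 -lt0n dim_gt0.
rewrite /D2; set c := nchar R lam g.
have -> : \sum_(T : syt lam) (bchar R m T g - c) ^+ 2 =
    \sum_(T : syt lam) bchar R m T g ^+ 2 - 2 * c * \sum_(T : syt lam) bchar R m T g +
    (Defs.dim lam)%:R * c ^+ 2.
  rewrite mulr_sumr -sumrB dim_mul -big_split /=.
  by apply: eq_bigr => T _; ring.
have -> : \sum_(T : syt lam) bchar R m T g = (Defs.dim lam)%:R * c.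
  by rewrite sum_bchar /c /nchar mulrC divfK.
move: d0; move: ((Defs.dim lam)%:R : R) => d d0; by field.
Qed.

Lemma Ex_D2 n m (g : 'S_n) : (m <= n)%N -> perm_on (low n m) g ->
  Ex (D2 m g) = inv_prob R m g - inv_prob R n g.
Proof.
move=> mn gm; rewrite -(Ex_bchar2 R mn gm) -(Ex_bchar2 R (leqnn n) (perm_on_all g)) -ExB.
by apply: eq_Ex => lam; rewrite D2E sum_nchar2.
Qed.

Lemma Ex_nchar2 n (g : 'S_n) : Ex (fun lam => nchar R lam g ^+ 2) = inv_prob R n g.
Proof.
by rewrite -(Ex_bchar2 R (leqnn n) (perm_on_all g)); apply: eq_Ex => lam; rewrite sum_nchar2.
Qed.

Lemma extend_extend r m n (s : 'S_r) : (r <= m)%N -> (m <= n)%N ->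
  extend n (extend m s) = extend n s.
Proof.
move=> rm mn; have rn := leq_trans rm mn; apply/permP => i.
have [[j ->]|ri] := widen_or rn i.
  have -> : widen_ord rn j = widen_ord mn (widen_ord rm j) by exact: val_inj.
  rewrite !extend_widen; have -> : widen_ord mn (widen_ord rm j) = widen_ord rn j by exact: val_inj.
  by rewrite extend_widen; exact: val_inj.
have [[j ij]|mi] := widen_or mn i; last by rewrite !extend_out.
rewrite ij extend_widen extend_out //; last by move: ri; rewrite ij.
by rewrite -ij extend_out //; move: ri; rewrite ij.
Qed.

Lemma extend_low_le r m n (s : 'S_r) : (r <= m)%N -> (m <= n)%N -> perm_on (low n m) (extend n s).
Proof. by move=> rm mn; rewrite -(extend_extend s rm mn); exact: extend_low. Qed.

(** Conjugators in S_m see only the first m points, so the probability is that of S_m itself. *)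
Lemma inv_prob_extend r m n (s : 'S_r) : (r <= m)%N -> (m <= n)%N ->
  inv_prob R m (extend n s) = inv_prob R m (extend m s).
Proof.
move=> rm mn; rewrite /inv_prob; congr (_%:R / _).
rewrite -(extend_extend s rm mn) -[RHS](card_imset _ (extend_inj mn)); apply: eq_card => x.
apply/idP/imsetP => [|[y]].
  rewrite !inE => /andP[xm]; have [y <-] := low_perm_extend mn xm => e; exists y => //.
  rewrite inE perm_on_all /=; move: e; rewrite !conjgE -!extendV // -!extendM //.
  by rewrite (inj_eq (extend_inj mn)).
rewrite !inE => /andP[_ e] ->; rewrite extend_low //= !conjgE -!extendV // -!extendM //.
by apply/eqP; congr (extend n _); rewrite -conjgE (eqP e) extendV.
Qed.

Lemma has_type_cycle K r (s : 'S_r) : (r <= K)%N ->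
  has_type K (fun j => multiplicity j (cycle_type s)) s.
Proof.
move=> rK j j2; rewrite orbit_pts_cycle_type; case: leqP => // Kj.
apply/eqP; rewrite muln_eq0; apply/orP; right; apply/eqP/count_memPn/negP => js.
have := sumn_cycle_type s; have : (j <= sumn (cycle_type s))%N; last by lia.
by elim: (cycle_type s) js => //= b l IH; rewrite inE => /orP[/eqP->|/IH]; lia.
Qed.

(** The existence of the limit is the point; its value will cancel in a difference. The square of
    X_s is compared with the square of the Hermite product, whose mean converges by
    [poly_moments]. *)
Lemma Ex_X2_cvg r (s : 'S_r) :
  exists L, (fun n => Ex (fun lam : intpart n => X s lam ^+ 2)) @ \oo --> (L : R).
Proof.
pose a j := multiplicity j (cycle_type s).
have sT : has_type r a s by exact: has_type_cycle.
have g1 := X_hermite_type R sT.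
have g2 : gen (@zseq R) (fun n lam => (X s lam - Hm R r a lam) * (X s lam + Hm R r a lam)).
  apply: gen_mul g1 _; first exact: ideal_zseq.
  by apply: gen_add; [exact: gen_X1 | exact: gen_Hm].
pose q k : {poly R} := (Num.sqrt k%:R ^+ a k) ^+ 2 *: hermite (a k) ^+ 2.
have h : (fun n => Ex (fun lam : intpart n => (X s lam - Hm R r a lam) * (X s lam + Hm R r a lam)) +
    Ex (fun lam : intpart n => \prod_(2 <= k < r.+1) (q k).[V R k lam])) @ \oo -->
    (0 + \prod_(2 <= k < r.+1) gam (q k) : R).
  by apply: cvgD; [exact: gen_small_Ex | apply: poly_moments; [exact: gam_lin | exact: gam_hermite]].
exists (0 + \prod_(2 <= k < r.+1) gam (q k)).
apply: cvg_trans h; apply: near_eq_cvg; near=> n; rewrite -ExD; apply: eq_Ex => lam.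
rewrite -subr_sqr; have -> : \prod_(2 <= k < r.+1) (q k).[V R k lam] = Hm R r a lam ^+ 2; last by ring.
rewrite /Hm -prodrXl; apply: eq_bigr => k _.
by rewrite /q hornerZ horner_exp /Hfac exprMn.
Unshelve. all: by end_near.
Qed.

(** The mean variance is the difference of the inversion probabilities in S_(n-s) and in S_n.
    Multiplied by the w-th power of the respective size, each is the second moment of X_g and tends
    to the same limit; the ratio of these powers tends to 1, so the scaled difference tends to 0. *)
Lemma Ex_D2_cvg r (g : 'S_r) (s : nat) :
  (fun n => sq R n ^+ (2 * #|psupp g|) * Ex (D2 (n - s) (extend n g))) @ \oo --> (0 : R).
Proof.
have [L hL] := Ex_X2_cvg g.
pose w := #|psupp g|.
pose I n : R := n%:R ^+ w * inv_prob R n (extend n g).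
have IL : I @ \oo --> L.
  apply: cvg_trans hL; apply: near_eq_cvg; near=> n.
  rewrite /I -Ex_nchar2 -sqr_sq -exprM -ExZ; apply: eq_Ex => lam.
  by rewrite /X exprMn -exprM mulnC.
have ratio : (fun n => (n%:R / (n - s)%:R) ^+ w) @ \oo --> (1 : R).
  have h : (fun n => (1 + s%:R * ((n - s)%:R)^-1) ^+ w) @ \oo --> ((1 + s%:R * 0) ^+ w : R).
    apply: cvg_expn; apply: cvgD; first exact: cvg_cst.
    apply: cvgMl_tmp; rewrite -(cvg_shiftn s) /=; under eq_fun do rewrite addnK.
    exact: cvg_invn.
  rewrite mulr0 addr0 expr1n in h; apply: cvg_trans h; apply: near_eq_cvg.
  exists s.+1 => // n /= sn; have ns : (n - s)%:R != 0 :> R by rewrite pnatr_eq0; lia.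
  have nE : n%:R = s%:R + (n - s)%:R :> R by rewrite -natrD subnKC // ltnW.
  by congr (_ ^+ _); apply: (mulIf ns); rewrite mulrDl !divfK // mul1r nE addrC.
have IsL : (fun n => I (n - s)%N) @ \oo --> L.
  by rewrite -(cvg_shiftn s) /=; under eq_fun do rewrite addnK.
have h : (fun n => (n%:R / (n - s)%:R) ^+ w * I (n - s)%N - I n) @ \oo --> (1 * L - L).
  by apply: cvgB => //; apply: cvgM.
rewrite mul1r subrr in h; apply: cvg_trans h; apply: near_eq_cvg.
exists (r + s).+1 => // n /= rsn.
have ns : (0 < (n - s)%:R :> R) by rewrite ltr0n; lia.
rewrite Ex_D2 ?leq_subr //; last by apply: extend_low_le; lia.
rewrite exprM sqr_sq /I mulrBr expr_div_n mulrA mulfVK ?expf_neq0 ?gt_eqF //.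
by rewrite -(@inv_prob_extend r (n - s) n) //; lia.
Unshelve. all: by end_near.
Qed.

(** Termwise |x| <= x^2 / e + e, used in place of the Cauchy-Schwarz inequality; e is a free
    parameter. *)
Lemma bdev_le n m (g : 'S_n) (lam : intpart n) (e : R) : 0 < e ->
  bdev R lam m g <= D2 m g lam / e + e.
Proof.
move=> e0; have d0 : 0 < (Defs.dim lam)%:R :> R by rewrite ltr0n dim_gt0.
rewrite /bdev /D2 ler_pdivrMr // mulrDl [_ / e * _]mulrAC divfK ?gt_eqF //.
rewrite mulr_suml [e * _]mulrC dim_mul -big_split /=.
apply: ler_sum => T _; set x := _ - _; rewrite -[x ^+ 2]real_normK ?num_real //.
move: `|x| (normr_ge0 x) => y y0.
rewrite -(ler_pM2r e0) mulrDl divfK ?gt_eqF //; nra.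
Qed.

Lemma bsize_ratio n s (lam : intpart n) (T : syt lam) :
  (bsize (n - s) T)%:R / (Defs.dim lam)%:R <= max_dim_ratio s lam :> R.
Proof.
have mn : (n - s <= n)%N by exact: leq_subr.
have h1 : (bsize (n - s) T)%:R / (Defs.dim lam)%:R <= (Defs.dim (rshape T mn))%:R / (Defs.dim lam)%:R :> R.
  by rewrite ler_wpM2r ?invr_ge0 // ler_nat bsize_le_dim.
apply: le_trans h1 _.
by rewrite /max_dim_ratio; apply: (@le_bigmax_cond _ _ _ _ _ _ (fun mu : intpart (n - s) => (Defs.dim mu)%:R / (Defs.dim lam)%:R)); exact: rshape_sub.
Qed.

Lemma PT_close (alpha : R) r (g : 'S_r) (u e : R) : 0 < alpha ->
  (forall s : nat, (1 <= s)%N ->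
        (fun n : nat => plancherel_prob (fun lam : intpart n =>
           (n%:R : R) `^ (- (alpha * s%:R)) < max_dim_ratio s lam) : R)
          @ \oo --> (0 : R)) ->
  0 <= u <= 1 -> 0 < e ->
  (fun n => plancherel_prob (fun lam : intpart n =>
     e < `|sq R n ^+ #|psupp g| * (partial_trace lam u (extend n g) - u * nchar R lam (extend n g))|))
   @ \oo --> (0 : R).
Proof.
move=> a0 hdim u01 e0; set w := #|psupp g|.
(* This many entries are removed so that n^(w/2) n^(-alpha s) <= 1/n: the cut block stays negligible
   after scaling. *)
have [s s1 sw] : exists2 s : nat, (1 <= s)%N & w%:R / 2 + 1 <= alpha * s%:R.
  exists (Num.truncn ((w%:R / 2 + 1) / alpha)).+1 => //.
  by rewrite [alpha * _]mulrC -ler_pdivrMr // ltW // truncnS_gt.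
pose A n (lam : intpart n) := (n%:R : R) `^ (- (alpha * s%:R)) < max_dim_ratio s lam.
(* With the parameter of [bdev_le] equal to e/4 divided by n^(w/2), this threshold makes each of its
   two terms at most e/4 after scaling; the remaining e/2 absorbs 3/n. *)
pose B n (lam : intpart n) := e ^+ 2 / 16 < sq R n ^+ (2 * w) * D2 (n - s) (extend n g) lam.
have pB : (fun n => plancherel_prob (@B n) : R) @ \oo --> (0 : R).
  have h : (fun n => 16 / e ^+ 2 * (sq R n ^+ (2 * w) * Ex (D2 (n - s) (extend n g)))) @ \oo -->
    (16 / e ^+ 2 * 0 : R) by apply: cvgMl_tmp; exact: Ex_D2_cvg.
  rewrite mulr0 in h; apply: squeeze_cvgr (cvg_cst 0) h; near=> n; rewrite prob_ge0 /=.
  rewrite mulrA -ExZ; apply: prob_markov => lam.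
    by rewrite mulr_ge0 ?D2_ge0 // mulr_ge0 ?exprn_ge0 ?sqrtr_ge0 // divr_ge0 // exprn_ge0 // ltW.
  rewrite /B ltr_pdivrMr // => /ltW h.
  rewrite (_ : _ * _ = sq R n ^+ (2 * w) * D2 (n - s) (extend n g) lam * 16 / e ^+ 2); last by ring.
  by rewrite ler_pdivlMr ?exprn_gt0 ?mul1r.
have h : (fun n => plancherel_prob (@A n) + plancherel_prob (@B n) : R) @ \oo --> (0 + 0 : R).
  by apply: cvgD => //; exact: hdim.
rewrite addr0 in h; apply: squeeze_cvgr (cvg_cst 0) h; near=> n; rewrite prob_ge0 /=.
have n0 : (0 < n)%N by near: n; exists 1%N.
have sn : (s <= n)%N by near: n; exists s.
have rn : (r + s <= n)%N by near: n; exists (r + s)%N.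
have n3 : 3 / n%:R <= e / 2.
  near: n; have h3 : (fun n => 3 * (n%:R)^-1) @ \oo --> (3 * 0 : R).
    by apply: cvgMl_tmp; exact: cvg_invn.
  rewrite mulr0 in h3; have e2 : 0 < e / 2 by rewrite divr_gt0.
  have /cvgr0_norm_le /(_ _ e2) := h3.
  by apply: filterS => n; apply: le_trans; exact: ler_norm.
apply: prob_le2 => lam eW; case: (boolP (A n lam)) => //=; rewrite /A -leNgt => hA; case: (boolP (B n lam)) => //; rewrite /B -leNgt => hB.
move: eW; apply: contraTT => _; rewrite -leNgt normrM [X in X * _]ger0_norm ?exprn_ge0 ?sqrtr_ge0 //.
have qw : 0 < sq R n ^+ w by rewrite exprn_gt0 // sq_gt0.
have := @partial_trace_dev R n lam (n - s) (extend n g) u (max_dim_ratio s lam).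
move=> /(_ (leq_subr _ _) _ u01 (@bsize_ratio n s lam)) dev.
have gl : perm_on (low n (n - s)) (extend n g) by apply: extend_low_le; rewrite ?leq_subr // leq_subRL // addnC.
apply: le_trans (ler_wpM2l (ltW qw) (dev gl)) _.
have bd := @bdev_le n (n - s) (extend n g) lam (e / 4 / sq R n ^+ w).
have d0 : 0 < e / 4 / sq R n ^+ w by rewrite !divr_gt0.
have c3 : sq R n ^+ w * max_dim_ratio s lam <= n%:R^-1.
  apply: le_trans (ler_wpM2l (ltW qw) hA) _.
  have -> : sq R n ^+ w = n%:R `^ (w%:R / 2).
    by rewrite mulrC powRrM powR12_sqrt // powR_mulrn // sqrtr_ge0.
  rewrite -powRD; last by rewrite pnatr_eq0 -lt0n n0 implybT.
  rewrite -(@powR_inv1 R n%:R) //; apply: ler_powR; first by rewrite ler1n.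
  by move: sw; lra.
have {}bd := ler_wpM2l (ltW qw) (bd d0).
rewrite mulrDr; apply: le_trans (lerD bd (_ : _ <= 3 / n%:R)) _.
  by rewrite mulrCA ler_wpM2l.
move: hB; rewrite mulnC exprM; move: (D2 _ _ _) qw n3; move: (sq R n ^+ w) => q D q0 n3 hB.
rewrite invf_div mulrDr [q * (_ / _ / q)]mulrC divfK ?gt_eqF //.
have : q * (D * (q / (e / 4))) <= e / 4; last by lra.
have -> : q * (D * (q / (e / 4))) = (q ^+ 2 * D) * (4 / e) by field; rewrite gt_eqF.
apply: le_trans (ler_wpM2r _ hB) _; first by rewrite divr_ge0 // ltW.
by have -> : e ^+ 2 / 16 * (4 / e) = e / 4 by field; rewrite gt_eqF.
Unshelve. all: by end_near.
Qed.

End Close.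

(** * Gaussian integrals and polynomial approximation *)

Section GaussianIntegral.
Variable R : realType.
Local Notation mu := (@lebesgue_measure R).
Local Notation g := (@normal_pdf R 0 1).

Lemma gaussE x : g x = normal_peak (1 : R) * expR (- (x ^+ 2 / 2)).
Proof.
by rewrite normal_pdfE ?oner_neq0 // /normal_fun subr0 expr1n mulr2n mulNr.
Qed.

(** A Gaussian of variance 2 up to a constant: still integrable, and it dominates any polynomial
    times the standard density. *)
Definition e4 (x : R) : R := expR (- (x ^+ 2 / 4)).

Lemma integrable_e4 : mu.-integrable [set: R] (EFin \o e4).
Proof.
have s0 : Num.sqrt (2 : R) != 0 by rewrite gt_eqF // sqrtr_gt0.
have -> : EFin \o e4 = fun x => ((normal_peak (Num.sqrt (2 : R)))^-1%:E * (normal_pdf 0 (Num.sqrt 2) x)%:E)%E.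
  apply/funext => x /=; rewrite -EFinM normal_pdfE // mulKf ?gt_eqF ?normal_peak_gt0 //.
  rewrite /normal_fun /e4 subr0 sqr_sqrtr // mulNr; congr (EFin (expR (- (_ / _)))).
  by rewrite mulr2n -natrD.
by apply: integrableZl => //; exact: integrable_normal_pdf.
Qed.

(** The constant comes from y^(m+1) / (m+1)! <= exp y at y = x^2 / 4, together with |x|^m <= 1 +
    x^(2m+2). *)
Definition powC (m : nat) : R := normal_peak (1 : R) * (1 + 4 ^+ m.+1 * m.+1`!%:R).

Lemma pow_gauss_le m x : `|x ^+ m * g x| <= powC m * e4 x.
Proof.
rewrite normrM [`|g x|]ger0_norm ?normal_pdf_ge0 // gaussE /powC.
set c := normal_peak _; have c0 : 0 <= c by exact: normal_peak_ge0.
have -> : expR (- (x ^+ 2 / 2)) = e4 x * e4 x by rewrite -expRD; congr expR; field.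
rewrite mulrCA -[leRHS]mulrA ler_wpM2l // mulrA ler_wpM2r ?expR_ge0 //.
have e0 : 0 < expR (x ^+ 2 / 4) by exact: expR_gt0.
rewrite /e4 expRN ler_pdivrMr // normrX.
have y0 : 0 <= x ^+ 2 / 4 by rewrite divr_ge0 // sqr_ge0.
have h := expR_ge1Dxn m y0.
have f0 : 0 < m.+1`!%:R :> R by rewrite ltr0n fact_gt0.
have h1 : x ^+ 2 ^+ m.+1 <= 4 ^+ m.+1 * m.+1`!%:R * expR (x ^+ 2 / 4).
  rewrite -ler_pdivrMl ?mulr_gt0 ?exprn_gt0 //; apply: le_trans h.
  by rewrite invfM -[leLHS]mulrA mulrCA mulrC expr_div_n [_^-1 * _]mulrC -[leLHS]add0r lerD2r.
have h2 : `|x| ^+ m <= 1 + x ^+ 2 ^+ m.+1.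
  have [x1|x1] := lerP `|x| 1.
    by apply: (@le_trans _ _ 1); [rewrite exprn_ile1 | rewrite lerDl exprn_ge0 // sqr_ge0].
  rewrite -real_normK ?num_real // -exprM; apply: (@le_trans _ _ (`|x| ^+ (2 * m.+1))).
    by rewrite ler_eXn2l // ?ltW //; lia.
  by rewrite lerDr.
have e1 : 1 <= expR (x ^+ 2 / 4) by rewrite -[leLHS]expR0 ler_expR.
by apply: le_trans h2 _; rewrite mulrDl mul1r lerD.
Qed.

Lemma measurable_gauss : measurable_fun [set: R] g.
Proof. exact: measurable_normal_pdf. Qed.

Lemma integrable_pow m : mu.-integrable [set: R] (EFin \o (fun x => x ^+ m * g x)).
Proof.
apply: (@le_integrable _ _ _ mu _ measurableT _ (fun x => ((powC m)%:E * (e4 x)%:E)%E)).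
- apply/measurable_EFinP; apply: measurable_funM; last exact: measurable_gauss.
  by apply: measurable_funX; exact: measurable_id.
- move=> x _ /=; rewrite lee_fin; apply: le_trans (pow_gauss_le m x) _; exact: ler_norm.
- by apply: integrableZl => //; exact: integrable_e4.
Qed.

Definition G (f : R -> R) : R := \int[mu]_x (f x * g x).

Lemma horner_gauss_sum (p : {poly R}) : (fun x => p.[x] * g x) = (fun x => \sum_(i < size p) p`_i * (x ^+ i * g x)).
Proof.
by apply/funext => x; rewrite horner_coef mulr_suml; apply: eq_bigr => i _; rewrite mulrA.
Qed.

Lemma integrable_poly (p : {poly R}) : mu.-integrable [set: R] (EFin \o (fun x => p.[x] * g x)).
Proof.
rewrite horner_gauss_sum (_ : EFin \o _ = (fun x => \sum_(i < size p) ((p`_i)%:E * (x ^+ i * g x)%R%:E))%E); last first.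
  by apply/funext => x /=; rewrite -sumEFin.
apply: integrable_sum => // i _; apply: integrableZl => //; exact: integrable_pow.
Qed.

Lemma RintegralE d (T : measurableType d) (nu : {measure set T -> \bar R}) (f : T -> R) :
  nu.-integrable [set: T] (EFin \o f) -> (\int[nu]_x (f x)%:E = (\int[nu]_x f x)%:E)%E.
Proof. by move=> /integral_fune_fin_num h; rewrite /Rintegral fineK // h. Qed.

Lemma Rdominated d (T : measurableType d) (nu : {measure set T -> \bar R}) (f_ : nat -> T -> R) (f h : T -> R) :
  (forall n, measurable_fun [set: T] (f_ n)) -> measurable_fun [set: T] f ->
  {ae nu, forall x, f_ ^~ x @ \oo --> f x} ->
  nu.-integrable [set: T] (EFin \o h) -> (forall n x, `|f_ n x| <= h x) ->
  (fun n => \int[nu]_x f_ n x) @ \oo --> \int[nu]_x f x.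
Proof.
move=> mf_ mf ff ih fh.
have [] := @dominated_convergence _ _ _ nu _ measurableT (fun n => EFin \o f_ n) (EFin \o f) (EFin \o h).
- by move=> n; exact/measurable_EFinP.
- exact/measurable_EFinP.
- by apply: filterS ff => x fx _; apply/fine_cvgP; split; [exact: nearW | exact: fx].
- exact: ih.
- by apply/aeW => x n _ /=; rewrite lee_fin.
move=> intf _ h3.
have intn n : nu.-integrable [set: T] (EFin \o f_ n).
  apply: (@le_integrable _ _ _ nu _ measurableT _ (EFin \o h)) => //; first exact/measurable_EFinP.
  by move=> x _ /=; rewrite lee_fin; apply: le_trans (fh n x) (ler_norm _).
rewrite RintegralE // in h3; apply: (fine_cvg h3).
Qed.

Lemma gauss_derive (p : {poly R}) (x : R) :
  is_derive x 1 (fun x => p.[x] * g x) (p^`().[x] * g x - ('X * p).[x] * g x).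
Proof.
pose q : {poly R} := (- 2^-1) *: 'X^2.
have gE : g = (normal_peak (1 : R) *: (expR \o horner q)).
  apply/funext => y; rewrite gaussE; apply: congr1; rewrite /q /= hornerZ hornerXn.
  by congr expR; ring.
have dq : is_derive x 1 (horner q) (- x).
  have := is_derive_poly q x; rewrite /q derivZ derivXn hornerZ hornerMn hornerXn /=.
  by rewrite (_ : - 2^-1 * _ = - x) //; field.
have dg : is_derive x 1 g (g x * - x).
  have de := is_derive_expR (horner q x).
  have dc := is_derive1_comp de dq.
  rewrite {1}gE; have := is_deriveZ (normal_peak (1 : R)) dc.
  by rewrite [in g x]gE /= scalerAl.
have := is_deriveM (is_derive_poly p x) dg.
by rewrite (_ : _ + _ = p^`().[x] * g x - ('X * p).[x] * g x) // hornerM hornerX /GRing.scale /=; ring.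
Qed.

Lemma e4_le n : (0 < n)%N -> e4 n%:R <= 4 * n%:R^-1.
Proof.
move=> n0; have n1 : 1 <= n%:R :> R by rewrite ler1n.
have n0R : 0 < n%:R :> R by exact: lt_le_trans n1.
rewrite /e4 expRN -[4]invrK -invfM lef_pV2 ?posrE ?expR_gt0 //; last by rewrite mulr_gt0 // invr_gt0.
apply: le_trans (expR_ge1Dx _).
have : n%:R <= n%:R ^+ 2 :> R by rewrite expr2 ler_peMl // ltW.
lra.
Qed.

Lemma poly_gauss_le (p : {poly R}) : exists C, forall x, `|p.[x] * g x| <= C * e4 x.
Proof.
exists (\sum_(i < size p) `|p`_i| * powC i) => x.
rewrite (congr1 (@^~ x) (horner_gauss_sum p)) mulr_suml; apply: le_trans (ler_norm_sum _ _ _) _.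
apply: ler_sum => i _; rewrite normrM -mulrA ler_wpM2l //; exact: pow_gauss_le.
Qed.

Lemma gauss_flux (p : {poly R}) : (fun n => p.[n%:R] * g n%:R - p.[- n%:R] * g (- n%:R)) @ \oo --> (0 : R).
Proof.
have [C hC] := poly_gauss_le p.
have h : (fun n => (2 * `|C| * 4) * (n%:R)^-1) @ \oo --> (2 * `|C| * 4 * 0 : R).
  by apply: cvgMl_tmp; exact: cvg_invn.
rewrite mulr0 in h; apply/norm_cvg0P.
apply: squeeze_cvgr (cvg_cst 0) h; exists 1%N => // n /= n0; rewrite normr_ge0 /=.
apply: le_trans (ler_normB _ _) _; apply: le_trans (lerD (hC _) (hC _)) _.
have -> : e4 (- n%:R) = e4 n%:R by rewrite /e4 sqrrN.
have -> : 2 * `|C| * 4 / n%:R = `|C| * (4 * n%:R^-1) + `|C| * (4 * n%:R^-1) by ring.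
have h1 : C * e4 n%:R <= `|C| * (4 * n%:R^-1).
  apply: (@le_trans _ _ (`|C| * e4 n%:R)); first by rewrite ler_wpM2r ?expR_ge0 // ler_norm.
  by rewrite ler_wpM2l //; exact: e4_le.
exact: lerD.
Qed.

(** The difference of the two integrands is the derivative of p times the density. Its integral over
    [-n, n] is a boundary term tending to 0 by [gauss_flux], and it tends to the full integral by
    dominated convergence. *)
Lemma G_stein (p : {poly R}) : G (horner ('X * p)) = G (horner p^`()).
Proof.
pose f (x : R) := p^`().[x] * g x - ('X * p).[x] * g x.
have intf : mu.-integrable [set: R] (EFin \o f).
  exact: (integrableB measurableT (integrable_poly p^`()) (integrable_poly ('X * p))).
have mf : measurable_fun [set: R] f by apply/measurable_EFinP; exact: measurable_int intf.
have h1 : (fun n => \int[mu]_x (f \_ `[- n%:R, n%:R]) x) @ \oo --> \int[mu]_x f x.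
  apply: (@Rdominated _ _ mu (fun n => f \_ `[- n%:R, n%:R]) f (fun x => `|f x|)).
  - move=> n; apply: (iffLR (measurable_restrictT _ (measurable_itv _))); exact: measurable_funTS.
  - exact: mf.
  - apply/aeW => x; apply: cvg_near_cst; near=> n; rewrite patchE ifT // inE /= in_itv /=.
    rewrite -ler_norml; near: n; exists (Num.truncn `|x|).+1 => // n /= xn.
    by apply: (@le_trans _ _ (Num.truncn `|x|).+1%:R); rewrite ?ler_nat // ltW // truncnS_gt.
  - exact: integrable_norm.
  - by move=> n x; rewrite patchE; case: ifP; rewrite ?normr0.
have h2 : (fun n => \int[mu]_x (f \_ `[- n%:R, n%:R]) x) @ \oo --> (0 : R).
  apply: cvg_trans (gauss_flux p); apply: near_eq_cvg; exists 1%N => // n /= n0.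
  have nn : - n%:R < n%:R :> R by have : 0 < n%:R :> R by [rewrite ltr0n]; lra.
  rewrite -Rintegral_mkcond /Rintegral (@continuous_FTC2 _ f (fun x => p.[x] * g x)) //.
  - by apply: continuous_subspaceT => x; apply: cvgB; apply: cvgM; solve [exact: continuous_horner | exact: (continuous_normal_pdf (oner_neq0 _))].
  - split; first by move=> x _; have [] := gauss_derive p x.
      by apply: cvg_at_right_filter; apply: cvgM; solve [exact: continuous_horner | exact: (continuous_normal_pdf (oner_neq0 _))].
    by apply: cvg_at_left_filter; apply: cvgM; solve [exact: continuous_horner | exact: (continuous_normal_pdf (oner_neq0 _))].
  - by move=> x _; rewrite derive1E; apply: derive_val; exact: gauss_derive.
have h : \int[mu]_x f x = 0 by exact: cvg_unique h1 h2.
apply/esym/eqP; rewrite -subr_eq0 -RintegralB //; [exact/eqP | |]; exact: integrable_poly.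
Unshelve. all: by end_near.
Qed.

Lemma G_lin (p q : {poly R}) (c : R) : G (horner (c *: p + q)) = c * G (horner p) + G (horner q).
Proof.
have ip := integrable_poly p; have iq := integrable_poly q.
rewrite /G -RintegralZl // -RintegralD //; last first.
  by apply: (@integrableZl _ _ _ mu _ measurableT c _ ip).
by apply: eq_Rintegral => x _; rewrite hornerD hornerZ; ring.
Qed.

Lemma G1 : G (fun=> 1) = 1.
Proof. by rewrite /G; under eq_Rintegral do rewrite mul1r; rewrite /Rintegral integral_normal_pdf. Qed.

Lemma G_gmom m : G (horner 'X^m) = gmom R m.
Proof.
elim/ltn_ind: m => -[|m] IH.
  by rewrite expr0 -[RHS]G1; congr G; apply/funext => x; rewrite hornerC.
rewrite exprS G_stein gmomS; case: m IH => [|m] IH.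
  rewrite expr0 derivC mul0r /G; under eq_Rintegral do rewrite horner0 mul0r.
  by rewrite /Rintegral integral0.
have -> : ('X^(m.+1))^`() = (m.+1%:R : R) *: 'X^m + 0 by rewrite derivXn addr0 scaler_nat.
rewrite G_lin IH; last by lia.
rewrite [X in _ + X](_ : _ = 0) ?addr0 //.
by rewrite /G; under eq_Rintegral do rewrite horner0 mul0r; rewrite /Rintegral integral0.
Qed.

Lemma G_poly (p : {poly R}) : G (horner p) = gam p.
Proof.
have G0 : G (horner (0 : {poly R})) = 0.
  by rewrite /G; under eq_Rintegral do rewrite horner0 mul0r; rewrite /Rintegral integral0.
rewrite -{1}[p]coefK poly_def /gam.
elim: (size p) => [|n IH]; first by rewrite !big_ord0.
by rewrite !big_ord_recr /= addrC G_lin IH G_gmom addrC.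
Qed.

End GaussianIntegral.

(** * Alternating Taylor bounds for the cosine *)

Section Taylor.
Variable R : realType.

Definition tcos (N : nat) : {poly R} := \sum_(i < N) ((-1) ^+ i / (2 * i)`!%:R) *: 'X^(2 * i).
Definition tsin (N : nat) : {poly R} := \sum_(i < N) ((-1) ^+ i / (2 * i).+1`!%:R) *: 'X^((2 * i).+1).

Lemma deriv_tsin N : (tsin N)^`() = tcos N.
Proof.
rewrite /tsin raddf_sum; apply: eq_bigr => i _; rewrite /= derivZ derivXn /= -['X^(2 * i) *+ _]scaler_nat scalerA factS natrM; congr (_ *: _).
have := fact_neq0 R (2 * i); move: (_`!%:R) => f f0; have : (2 * i).+1%:R != 0 :> R by rewrite pnatr_eq0.
by move: ((2 * i).+1%:R) => k k0; field; rewrite f0.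
Qed.

Lemma deriv_tcos N : (tcos N.+1)^`() = - tsin N.
Proof.
rewrite /tcos raddf_sum big_ord_recl /= derivZ derivXn scaler0 add0r /tsin -sumrN; apply: eq_bigr => i _.
rewrite derivZ derivXn /bump leq0n add1n (_ : (2 * i.+1 = (2 * i).+2)%N) ?mulnS //= -['X^((2 * i).+1) *+ _]scaler_nat scalerA [(2 * i).+2`!]factS natrM exprS -scaleNr; congr (_ *: _).
have := fact_neq0 R (2 * i).+1; move: (_`!%:R) => f f0; have : (2 * i).+2%:R != 0 :> R by rewrite pnatr_eq0.
by move: ((2 * i).+2%:R) => k k0; field; rewrite f0.
Qed.

Lemma tcos0 N : (tcos N.+1).[0] = 1.
Proof.
rewrite /tcos big_ord_recl hornerD hornerZ hornerXn expr0 divr1 mul1r horner_sum big1 ?addr0 // => i _.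
by rewrite hornerZ hornerXn lift0 mulnS expr0n mulr0.
Qed.

Lemma tsin0 N : (tsin N).[0] = 0.
Proof.
by rewrite /tsin horner_sum big1 // => i _; rewrite hornerZ hornerXn expr0n mulr0.
Qed.

Lemma ge0_of_derive (f f' : R -> R) : (forall x : R, is_derive x 1 f (f' x)) -> f 0 = 0 ->
  (forall x, 0 <= x -> 0 <= f' x) -> forall x, 0 <= x -> 0 <= f x.
Proof.
move=> df f0 f'0 x x0; rewrite -f0; apply: (@ger0_derive1_ndecr _ f 0 x).
- by move=> z _; have [] := df z.
- by move=> z; rewrite in_itv /= => /andP[z0 _]; rewrite derive1E; have [_ ->] := df z; rewrite f'0 // ltW.
- by apply: continuous_subspaceT => z; apply/differentiable_continuous/derivable1_diffP; have [] := df z.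
- by [].
- by [].
- by [].
Qed.

(* Integrating alternately, the Taylor remainders of cos and sin have alternating
   signs on [0, oo[. *)
Lemma cos_sin_rem N y : 0 <= y ->
  0 <= (-1) ^+ N.+1 * (cos y - (tcos N.+1).[y]) /\ 0 <= (-1) ^+ N.+1 * (sin y - (tsin N.+1).[y]).
Proof.
have dC M (x : R) : is_derive x 1 (fun x : R => (-1) ^+ M.+1 * (cos x - (tcos M.+1).[x])) ((-1) ^+ M * (sin x - (tsin M).[x])).
  have := is_deriveZ ((-1) ^+ M.+1) (is_deriveB (is_derive_cos x) (is_derive_poly (tcos M.+1) x)).
  by rewrite deriv_tcos hornerN (_ : _ *: _ = (-1) ^+ M * (sin x - (tsin M).[x])) // exprS /GRing.scale /=; ring.
have dS M (x : R) : is_derive x 1 (fun x : R => (-1) ^+ M * (sin x - (tsin M).[x])) ((-1) ^+ M * (cos x - (tcos M).[x])).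
  have := is_deriveZ ((-1) ^+ M) (is_deriveB (is_derive_sin x) (is_derive_poly (tsin M) x)).
  by rewrite deriv_tsin.
have c0 M : (-1) ^+ M.+1 * (cos 0 - (tcos M.+1).[0]) = 0 :> R by rewrite cos0 tcos0 subrr mulr0.
have s0 M : (-1) ^+ M * (sin 0 - (tsin M).[0]) = 0 :> R by rewrite sin0 tsin0 subrr mulr0.
have cs M : (forall z, 0 <= z -> 0 <= (-1) ^+ M.+1 * (cos z - (tcos M.+1).[z])) ->
    forall z, 0 <= z -> 0 <= (-1) ^+ M.+1 * (sin z - (tsin M.+1).[z]).
  by move=> h; apply: (ge0_of_derive (dS M.+1) (s0 M.+1)).
move: y; suff h : forall z, 0 <= z -> 0 <= (-1) ^+ N.+1 * (cos z - (tcos N.+1).[z]).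
  by move=> y y0; split; [exact: h | exact: cs].
elim: N => [|N IH] z z0; last by apply: (ge0_of_derive (dC N.+1) (c0 N.+1)) z0; exact: cs.
by rewrite /tcos big_ord1 hornerZ hornerXn !expr0 divr1 mul1r expr1 mulN1r opprB subr_ge0 cos_le1.
Qed.

(** Consecutive remainders have opposite signs and differ by one Taylor term, so the remainder is
    bounded by the first omitted term. *)
Lemma cos_taylor N y : `|cos y - (tcos N.+1).[y]| <= y ^+ (2 * N.+1) / (2 * N.+1)`!%:R.
Proof.
wlog y0 : y / 0 <= y.
  move=> h; have [/h //|/ltW] := leP 0 y; rewrite -oppr_ge0 => /h; rewrite cosN.
  have -> : (tcos N.+1).[- y] = (tcos N.+1).[y].
    by rewrite /tcos !horner_sum; apply: eq_bigr => i _; rewrite !hornerZ !hornerXn !exprM sqrrN.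
  by rewrite !exprM sqrrN.
have [a0 _] := cos_sin_rem N y0; have [b0 _] := cos_sin_rem N.+1 y0.
have e : (-1) ^+ N.+1 * (cos y - (tcos N.+1).[y]) =
    y ^+ (2 * N.+1) / (2 * N.+1)`!%:R - (-1) ^+ N.+2 * (cos y - (tcos N.+2).[y]).
  rewrite {2}/tcos big_ord_recr -/(tcos N.+1) /= hornerD hornerZ hornerXn.
  have s2 : (-1) ^+ N.+1 * (-1) ^+ N.+1 = 1 :> R by rewrite -exprMn mulrNN mulr1 expr1n.
  rewrite [(-1) ^+ N.+2]exprS; move: s2; move: ((-1) ^+ N.+1) => s s2.
  rewrite mulN1r mulNr opprK; have -> : forall a b c : R, s * (a - (b + s / c * y ^+ (2 * N.+1))) = s * (a - b) - (s * s) * (y ^+ (2 * N.+1) / c) by move=> a b c; ring.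
  by rewrite s2 mul1r addrCA subrr addr0.
have -> : `|cos y - (tcos N.+1).[y]| = (-1) ^+ N.+1 * (cos y - (tcos N.+1).[y]).
  by rewrite -[RHS]ger0_norm // normrM normrX normrN1 expr1n mul1r.
by rewrite e lerBlDr lerDl.
Qed.

End Taylor.

(** * Functions squeezed between polynomials in Gaussian mean *)

Section PolyApprox.
Variable R : realType.
Local Notation gam := (@gam R).
Local Notation G := (@G R).
Local Notation mu := (@lebesgue_measure R).
Local Notation g := (@normal_pdf R 0 1).

Lemma gam_X (m : nat) : gam 'X^m = gmom R m.
Proof. by rewrite -G_poly G_gmom. Qed.

Lemma gam_C (c : R) : gam c%:P = c.
Proof. by rewrite -[c%:P]mulr1 mul_polyC gamZ gam1 mulr1. Qed.

Lemma gmom_even N : gmom R (2 * N) * (2 ^+ N * N`!%:R) = (2 * N)`!%:R.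
Proof.
elim: N => [|N IH]; first by rewrite mulr1 mul1r.
rewrite (_ : (2 * N.+1 = (2 * N).+2)%N) ?mulnS // gmomS /= [(2 * N).+2`!]factS [(2 * N).+1`!]factS [N.+1`!]factS.
rewrite !natrM -IH exprS (_ : (2 * N).+2%:R = 2 * N.+1%:R :> R); first by ring.
by rewrite -natrM mulnS.
Qed.

Lemma G_approx (f : R -> R) (p q : {poly R}) : measurable_fun [set: R] f ->
  (forall x, `|f x - p.[x]| <= q.[x]) -> `|G f - gam p| <= gam q.
Proof.
move=> mf fpq; have ip := integrable_poly p; have iq := integrable_poly q.
have mp : measurable_fun [set: R] (horner p) by apply: continuous_measurable_fun; exact: continuous_horner.
have id : mu.-integrable [set: R] (EFin \o (fun x => (f x - p.[x]) * g x)).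
  apply: (@le_integrable _ _ _ mu _ measurableT _ (EFin \o (fun x => q.[x] * g x))) => //.
    by apply/measurable_EFinP; apply: measurable_funM; [exact: measurable_funB | exact: measurable_gauss].
  move=> x _ /=; rewrite lee_fin !normrM ler_wpM2r //.
  by apply: le_trans (fpq x) _; exact: ler_norm.
have -> : G f - gam p = \int[mu]_x ((f x - p.[x]) * g x).
  have -> : G f = \int[mu]_x ((f x - p.[x]) * g x + p.[x] * g x).
    by apply: eq_Rintegral => x _; ring.
  by rewrite RintegralD // -(G_poly p) addrK.
apply: le_trans (le_normr_Rintegral measurableT id) _.
rewrite -G_poly; apply: le_Rintegral => //; first exact: integrable_norm.
move=> x _; rewrite normrM [`|g x|]ger0_norm ?normal_pdf_ge0 //.
by rewrite ler_wpM2r ?normal_pdf_ge0.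
Qed.

Lemma gam_ge0 (q : {poly R}) : (forall x, 0 <= q.[x]) -> 0 <= gam q.
Proof.
move=> q0; apply: le_trans (normr_ge0 (G (fun=> 0) - gam 0)) _.
by apply: G_approx => [|x]; [exact: measurable_cst | rewrite horner0 subrr normr0].
Qed.

(* Functions to which convergence of moments transfers: up to any e, they lie
   between the polynomials p - q and p + q, with q of Gaussian mean at most e. *)
Definition poly_approx (f : R -> R) := forall e : R, 0 < e -> exists p q : {poly R},
  (forall x, `|f x - p.[x]| <= q.[x]) /\ gam q <= e.

Lemma poly_approx_add f h : poly_approx f -> poly_approx h -> poly_approx (fun x => f x + h x).
Proof.
move=> Mf Mh e e0; have e2 : 0 < e / 2 by rewrite divr_gt0.
have [p [q [pq qe]]] := Mf _ e2; have [p' [q' [pq' qe']]] := Mh _ e2.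
exists (p + p'), (q + q'); split; last by rewrite gamD [e]splitr lerD.
move=> x; rewrite !hornerD; have -> : f x + h x - (p.[x] + p'.[x]) = (f x - p.[x]) + (h x - p'.[x]) by ring.
by apply: le_trans (ler_normD _ _) (lerD _ _).
Qed.

Lemma poly_approx_scale c f : poly_approx f -> poly_approx (fun x => c * f x).
Proof.
move=> Mf e e0; have c1 : 0 < 1 + `|c| by have := normr_ge0 c; lra.
have [p [q [pq qe]]] := Mf _ (divr_gt0 e0 c1).
exists (c *: p), (`|c| *: q); split => [x|].
  by rewrite !hornerZ -mulrBr normrM ler_wpM2l.
rewrite gamZ; apply: (@le_trans _ _ (`|c| * (e / (1 + `|c|)))); first by rewrite ler_wpM2l.
rewrite mulrA ler_pdivrMr // mulrC ler_wpM2l ?ltW //; have := normr_ge0 c; lra.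
Qed.

Lemma add_exp_even_le (a b : R) N : (a + b) ^+ (2 * N) <= 4 ^+ N * (a ^+ (2 * N) + b ^+ (2 * N)).
Proof.
wlog ab : a b / `|b| <= `|a|.
  by move=> h; have [/h //|/ltW/h] := leP `|b| `|a|; rewrite addrC [b ^+ _ + _]addrC.
apply: (@le_trans _ _ (4 ^+ N * a ^+ (2 * N))); last first.
  by rewrite ler_wpM2l ?exprn_ge0 // lerDl exprM exprn_ge0 // sqr_ge0.
rewrite !exprM -exprMn; apply: lerXn2r; [by rewrite nnegrE sqr_ge0 | by apply: mulr_ge0 => //; exact: sqr_ge0 |].
rewrite -[(a + b) ^+ 2]real_normK ?num_real // -[a ^+ 2]real_normK ?num_real //.
have h := ler_normD a b; have := normr_ge0 (a + b); nra.
Qed.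

(** This is where the Gaussian is determined by its moments. Its moment of order 2N is (2N)! / (2^N
    N!), so the Taylor error with 2N factors of t x + th has mean at most (2 t^2)^N / N! + (4
    th^2)^N / N!, general terms of exponential series. *)
Lemma poly_approx_cos t th : poly_approx (fun x => cos (t * x + th)).
Proof.
move=> e e0.
have h : (fun N => exp_coeff (2 * t ^+ 2) N + exp_coeff (4 * th ^+ 2) N) @ \oo --> (0 + 0 : R).
  by apply: cvgD; exact: cvg_exp_coeff.
rewrite addr0 in h; have /cvgr0_norm_le /(_ _ e0) [N _ hN] := h.
have {hN} := hN N.+1 (leqnSn N); rewrite /exp_coeff /= => hN.
exists (tcos R N.+1 \Po (t *: 'X + th%:P)).
exists ((4 ^+ N.+1 / (2 * N.+1)`!%:R) *: (t ^+ (2 * N.+1) *: 'X^(2 * N.+1) + (th ^+ (2 * N.+1))%:P)); split.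
  move=> x; rewrite horner_comp hornerZ !(hornerD, hornerZ, hornerC, hornerX, hornerXn).
  apply: le_trans (cos_taylor _ _) _; rewrite -exprMn mulrAC ler_wpM2r ?invr_ge0 //.
  exact: add_exp_even_le.
rewrite gamZ gamD gamZ gam_X gam_C.
apply: le_trans (le_trans _ (ler_norm _)) hN.
have f0 : 0 < (2 * N.+1)`!%:R :> R by rewrite ltr0n fact_gt0.
have k0 : 0 < N.+1`!%:R :> R by rewrite ltr0n fact_gt0.
have fk : N.+1`!%:R <= (2 * N.+1)`!%:R :> R by rewrite ler_nat leq_fact // leq_pmull.
rewrite mulrDr lerD //.
  rewrite le_eqVlt; apply/orP; left; apply/eqP.
  rewrite -(gmom_even N.+1) exprMn !exprM -[4](_ : 2 ^+ 2 = 4 :> R); last by rewrite -natrX.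
  have t0 : 2 ^+ N.+1 != 0 :> R by rewrite expf_neq0.
  move: f0; rewrite -(gmom_even N.+1) pmulr_lgt0 ?mulr_gt0 ?exprn_gt0 // => m0.
  rewrite [2 ^+ 2 ^+ N.+1]exprAC.
  move: (2 ^+ N.+1) t0 (gmom R _) m0 (_`!%:R) k0 (t ^+ 2 ^+ N.+1) => a a0 b b0 c c0 d.
  by field; rewrite a0 !gt_eqF.
rewrite exprM [4 ^+ _ / _ * _]mulrAC -exprMn ler_wpM2l ?lef_pV2 ?posrE //.
by rewrite exprn_ge0 // mulr_ge0 // sqr_ge0.
Qed.

(** Phases are allowed in the cosines so that sines belong to the class and products of generators
    become sums of generators. *)
Inductive trig : (R -> R) -> Prop :=
| trig_cos t th : trig (fun x => cos (t * x + th))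
| trig_add f h : trig f -> trig h -> trig (fun x => f x + h x)
| trig_scale c f : trig f -> trig (fun x => c * f x).

Lemma trig_eq f h : trig f -> (forall x, h x = f x) -> trig h.
Proof. by move=> tf fh; rewrite (_ : h = f) //; exact/funext. Qed.

Lemma trig_cst c : trig (fun=> c).
Proof.
by apply: (trig_eq (trig_scale c (trig_cos 0 0))) => x; rewrite mul0r add0r cos0 mulr1.
Qed.

Lemma trig_mul f h : trig f -> trig h -> trig (fun x => f x * h x).
Proof.
move=> tf; elim=> [t th|h1 h2 _ IH1 _ IH2|c h1 _ IH].
- elim: tf => [s sh|f1 f2 _ IH1 _ IH2|c f1 _ IH].
  + apply: (trig_eq (trig_add (trig_scale 2^-1 (trig_cos (s + t) (sh + th)))
      (trig_scale 2^-1 (trig_cos (s - t) (sh - th))))) => x.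
    rewrite (_ : (s + t) * x + (sh + th) = (s * x + sh) + (t * x + th)); last by ring.
    rewrite (_ : (s - t) * x + (sh - th) = (s * x + sh) - (t * x + th)); last by ring.
    by move: (s * x + sh) (t * x + th) => a b; rewrite cosD cosB; field.
  + by apply: (trig_eq (trig_add IH1 IH2)) => x; rewrite mulrDl.
  + by apply: (trig_eq (trig_scale c IH)) => x; rewrite mulrA.
- by apply: (trig_eq (trig_add IH1 IH2)) => x; rewrite mulrDr.
- by apply: (trig_eq (trig_scale c IH)) => x; rewrite mulrCA.
Qed.

Lemma trig_exp f n : trig f -> trig (fun x => f x ^+ n).
Proof.
move=> tf; elim: n => [|n IH]; first by apply: (trig_eq (trig_cst 1)).
by apply: (trig_eq (trig_mul tf IH)) => x; rewrite exprS.
Qed.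

Lemma trig_approx f : trig f -> poly_approx f.
Proof.
by elim=> [t th|f1 f2 _ h1 _ h2|c f1 _ h1]; [exact: poly_approx_cos | exact: poly_approx_add | exact: poly_approx_scale].
Qed.

Lemma trig_continuous f : trig f -> continuous f.
Proof.
elim=> [t th|f1 f2 _ h1 _ h2|c f1 _ h1] x.
- apply: continuous_comp; last exact: continuous_cos.
  by apply: cvgD; [apply: cvgMl_tmp; exact: cvg_id | exact: cvg_cst].
- by apply: cvgD; [exact: h1 | exact: h2].
- by apply: cvgMl_tmp; exact: h1.
Qed.

Lemma trig_measurable f : trig f -> measurable_fun [set: R] f.
Proof. by move=> /trig_continuous; exact: continuous_measurable_fun. Qed.

(** The error may be dominated by a trigonometric part w, small near-jump bumps for instance, plus a
    polynomial part q that controls large x. Replacing s and w by polynomials costs e/5 in each of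
    five places: [qs], [G w], [qw] twice, and q. *)
Lemma poly_approx_dom f : (forall e : R, 0 < e -> exists s w (q : {poly R}),
    [/\ trig s, trig w, forall x, `|f x - s x| <= w x + q.[x], G w <= e & gam q <= e]) -> poly_approx f.
Proof.
move=> H e e0; have e4 : 0 < e / 5 by rewrite divr_gt0.
have [s [w [q [ts tw fsw Gw gq]]]] := H _ e4.
have [ps [qs [psE qsE]]] := trig_approx ts e4.
have [pw [qw [pwE qwE]]] := trig_approx tw e4.
exists ps, (qs + (pw + qw) + q); split.
  move=> x; rewrite !hornerD; have -> : f x - ps.[x] = (s x - ps.[x]) + (f x - s x) by ring.
  apply: le_trans (ler_normD _ _) _; rewrite -addrA lerD //; apply: le_trans (fsw x) _; rewrite lerD2r.
  by have := pwE x; rewrite ler_norml => /andP[_]; lra.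
rewrite !gamD; have := G_approx (trig_measurable tw) pwE; rewrite ler_norml => /andP[h _].
by lra.
Qed.

End PolyApprox.

Lemma integrable_le (R : realType) d (T : measurableType d) (nu : {measure set T -> \bar R}) (f h : T -> R) :
  measurable_fun [set: T] f -> (forall x, `|f x| <= h x) ->
  nu.-integrable [set: T] (EFin \o h) -> nu.-integrable [set: T] (EFin \o f).
Proof.
move=> mf fh; apply: le_integrable => //; first exact/measurable_EFinP.
by move=> x _ /=; rewrite lee_fin; apply: le_trans (fh x) (ler_norm _).
Qed.

(** * Polynomial approximation of a step on the unit interval *)

Section StepPoly.
Variable R : realType.

Lemma bernoulli_le (t : R) k : 0 <= t <= 1 -> 1 - k%:R * t <= (1 - t) ^+ k.
Proof.
move=> /andP[t0 t1]; elim: k => [|k IH]; first by rewrite mul0r subr0 expr0.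
rewrite exprS; apply: (@le_trans _ _ ((1 - t) * (1 - k%:R * t))); last by rewrite ler_wpM2l // subr_ge0.
by rewrite -[k.+1]addn1 natrD; have : 0 <= k%:R * t * t by [rewrite !mulr_ge0]; lra.
Qed.

Lemma bernoulli_ge (t : R) k : 0 <= t <= 1 -> (1 - t) ^+ k * (1 + k%:R * t) <= 1.
Proof.
move=> /andP[t0 t1]; elim: k => [|k IH]; first by rewrite mul0r addr0 expr0 mulr1.
apply: le_trans IH; rewrite exprSr -mulrA ler_wpM2l ?exprn_ge0 ?subr_ge0 //.
by rewrite -[k.+1]addn1 natrD; have : 0 <= k%:R * t * t by [rewrite !mulr_ge0]; have := mulr_ge0 t0 t0; lra.
Qed.

(* As n grows this tends to 1 for v < 1/2 and to 0 for v > 1/2, exponentially fast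
   away from 1/2 by Bernoulli's inequality. *)
Definition step (n : nat) (v : R) : R := (1 - v ^+ n) ^+ (2 ^ n).

Lemma step_itv n v : 0 <= v <= 1 -> 0 <= step n v <= 1.
Proof.
move=> /andP[v0 v1]; have t1 : v ^+ n <= 1 by rewrite exprn_ile1.
rewrite /step exprn_ge0 ?subr_ge0 //= exprn_ile1 ?subr_ge0 //.
by rewrite lerBlDr lerDl exprn_ge0.
Qed.

Lemma step_high n v d : 0 <= d -> v <= 1 -> 2^-1 + d <= v -> step n v <= ((1 + 2 * d) ^+ n)^-1.
Proof.
move=> d0 v1 dv; have v0 : 0 <= v by lra.
have t01 : 0 <= v ^+ n <= 1 by rewrite exprn_ge0 // exprn_ile1.
have := bernoulli_ge (2 ^ n) t01; rewrite -/(step n v) natrX -exprMn => h.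
have p0 : 0 < (1 + 2 * d) ^+ n by rewrite exprn_gt0 //; lra.
have p1 : (1 + 2 * d) ^+ n <= (2 * v) ^+ n.
  by apply: lerXn2r; rewrite ?nnegrE; lra.
have /andP[s0 _] := step_itv n (introT andP (conj v0 v1)).
rewrite -[leRHS]mul1r ler_pdivlMr //; apply: le_trans h; rewrite ler_wpM2l //.
by apply: le_trans p1 _; rewrite lerDr.
Qed.

Lemma step_low n v d : 0 <= d -> 0 <= v -> v <= 2^-1 - d -> 1 - step n v <= ((1 + 2 * d) ^+ n)^-1.
Proof.
move=> d0 v0 vd; have v1 : v <= 1 by lra.
have t01 : 0 <= v ^+ n <= 1 by rewrite exprn_ge0 // exprn_ile1.
have := bernoulli_le (2 ^ n) t01; rewrite -/(step n v) natrX -exprMn => h.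
have p0 : 0 < (1 + 2 * d) ^+ n by rewrite exprn_gt0 //; lra.
apply: (@le_trans _ _ ((2 * v) ^+ n)); first by lra.
rewrite -[leRHS]mul1r ler_pdivlMr // -exprMn exprn_ile1 //; first by apply: mulr_ge0; lra.
have : 2 * v * (1 + 2 * d) <= (1 - 2 * d) * (1 + 2 * d) by rewrite ler_wpM2r; lra.
by have := mulr_ge0 d0 d0; lra.
Qed.

End StepPoly.

(** * Indicators of half-lines *)

Section Indicator.
Variable R : realType.
Local Notation gam := (@gam R).
Local Notation G := (@G R).
Local Notation mu := (@lebesgue_measure R).
Local Notation g := (@normal_pdf R 0 1).

Lemma sin_low (d z : R) : 0 <= d -> d <= z <= 1 -> sin d <= sin z.
Proof.
move=> d0 /andP[dz z1]; have p1 := pihalf_ge1 R.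
have : d <= z by []; rewrite le_eqVlt => /orP[/eqP-> //|dz'].
by apply/ltW; rewrite ltr_sin ?in_itv /=; try (apply/andP; split); lra.
Qed.

Lemma cos_lt1 (z : R) : z != 0 -> `|z| <= 1 -> cos z < 1.
Proof.
wlog z0 : z / 0 <= z.
  by move=> h; have [/h //|/ltW] := leP 0 z; rewrite -oppr_ge0 -normrN -oppr_eq0 -cosN; exact: h.
move=> zn; rewrite ger0_norm // => z1; rewrite lt_neqAle cos_le1 andbT; apply/eqP => c1.
have := @sin2_gt0 R z; rewrite cos1sin0 ?c1 ?normr1 //.
rewrite lt_neqAle eq_sym zn z0 /= ltxx => h; suff : false by []; apply: h.
by apply: le_lt_trans z1 _; rewrite ltr1n.
Qed.

Variable a : R.

(* Powers of wind concentrate at a, and composing step with wave approximates the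
   indicator of x <= a on the window |x - a| <= L. *)
Definition wind (L : R) (x : R) : R := (1 + cos ((x - a) / L)) / 2.
Definition wave (L : R) (x : R) : R := (1 + sin ((x - a) / L)) / 2.

Lemma wind_itv L x : 0 <= wind L x <= 1.
Proof. by rewrite /wind; have := cos_geN1 ((x - a) / L); have := cos_le1 ((x - a) / L); lra. Qed.

Lemma wave_itv L x : 0 <= wave L x <= 1.
Proof. by rewrite /wave; have := sin_geN1 ((x - a) / L); have := sin_le1 ((x - a) / L); lra. Qed.

Lemma trig_wind L : trig (wind L).
Proof.
apply: (trig_eq (trig_scale 2^-1 (trig_add (trig_cst 1) (trig_cos L^-1 (- a / L))))) => x.
by rewrite /wind mulrC; congr (_ * (_ + cos _)); ring.
Qed.

Lemma trig_wave L : trig (wave L).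
Proof.
apply: (trig_eq (trig_scale 2^-1 (trig_add (trig_cst 1) (trig_cos L^-1 (- a / L - pi / 2))))) => x.
rewrite /wave mulrC -cosBpihalf; congr (_ * (_ + cos _)); ring.
Qed.

(** Inside the window the powers of [wind] tend to 0 almost everywhere and dominated convergence
    applies; outside, where periodicity brings [wind] back to 1, they are at most 1 and q takes
    over. The factor 2 keeps the bump at least 1 around a. *)
Lemma wind_small (L e : R) (q : {poly R}) : 0 < L -> 0 < e -> gam q <= e ->
  (forall x, 0 <= q.[x]) -> (forall x, L < `|x - a| -> 1 <= q.[x]) ->
  exists m, G (fun x => 2 * wind L x ^+ m) <= 4 * e.
Proof.
move=> L0 e0 qe q0 q1.
pose f (m : nat) (x : R) : R := if `|x - a| <= L then wind L x ^+ m * g x else 0.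
have mw m : measurable_fun [set: R] (fun x => wind L x ^+ m * g x).
  by apply: measurable_funM; [apply: trig_measurable; apply: trig_exp; exact: trig_wind | exact: measurable_gauss].
have mf m : measurable_fun [set: R] (f m).
  have -> : f m = (fun x => wind L x ^+ m * g x) \_ `[a - L, a + L].
    apply/funext => x; rewrite patchE mem_setE in_itv /= /f ler_norml lerBrDl lerBlDr.
    by rewrite lerBlDl.
  by apply: (iffLR (measurable_restrictT _ (measurable_itv _))); exact: measurable_funTS.
have w1 m x : 0 <= wind L x ^+ m <= 1.
  by have /andP[w0 w1] := wind_itv L x; rewrite exprn_ge0 //= exprn_ile1.
have ig : mu.-integrable [set: R] (EFin \o g) by exact: integrable_normal_pdf.
have fg m x : `|f m x| <= g x.
  rewrite /f; case: ifP => _; last by rewrite normr0 normal_pdf_ge0.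
  have /andP[h0 h1] := w1 m x; rewrite ger0_norm ?mulr_ge0 ?normal_pdf_ge0 //.
  by rewrite -[leRHS]mul1r ler_wpM2r ?normal_pdf_ge0.
have lim : (fun m => \int[mu]_x f m x) @ \oo --> \int[mu]_x (0 : R).
  apply: (@Rdominated _ _ _ mu f (fun=> 0) g) => //.
  (* Inside the window [wind] equals 1 only at a, and a point is a null set. *)
  exists [set a]; split; [exact: measurable_set1 | exact: lebesgue_measure_set1|].
  move=> x /= h; apply: contrapT => /eqP xa; apply: h.
  have [xL|xL] := leP `|x - a| L; last first.
    rewrite (_ : f ^~ x = fun=> 0); first exact: cvg_cst.
    by apply/funext => m; rewrite /f leNgt xL.
  rewrite (_ : f ^~ x = fun m => wind L x ^+ m * g x); last by apply/funext => m; rewrite /f xL.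
  have w0 : (fun m => wind L x ^+ m * g x) @ \oo --> (0 * g x : R).
    apply: cvgMr_tmp; apply: cvg_expr; have /andP[h0 h1] := wind_itv L x; rewrite ger0_norm //.
    have nz : (x - a) / L != 0.
      by rewrite mulf_neq0 ?subr_eq0 // invr_neq0 // gt_eqF.
    have := cos_lt1 nz; rewrite normf_div [`|L|]gtr0_norm // ler_pdivrMr // mul1r => /(_ xL).
    by rewrite /wind; lra.
  by rewrite mul0r in w0.
rewrite (_ : \int[mu]_x 0 = 0) in lim; last by rewrite /Rintegral integral0.
have /cvgr0_norm_le /(_ _ e0) [m _ hm] := lim.
exists m; have {hm} := hm m (leqnn m) => /= /(le_trans (ler_norm _)) hm.
have iF : mu.-integrable [set: R] (EFin \o f m) by apply: (@integrable_le R _ _ mu (f m) g); [exact: mf | exact: fg | exact: ig].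
have iW : mu.-integrable [set: R] (EFin \o (fun x => wind L x ^+ m * g x)).
  apply: (@integrable_le R _ _ mu _ g); [exact: mw | move=> x | exact: ig]; have /andP[h0 h1] := w1 m x.
  by rewrite ger0_norm ?mulr_ge0 ?normal_pdf_ge0 // -[leRHS]mul1r ler_wpM2r ?normal_pdf_ge0.
have iq := integrable_poly q.
have -> : G (fun x => 2 * wind L x ^+ m) = 2 * \int[mu]_x (wind L x ^+ m * g x).
  by rewrite -RintegralZl //; apply: eq_Rintegral => x _; rewrite mulrA.
rewrite (_ : 4 * e = 2 * (2 * e)); last by ring.
rewrite ler_wpM2l //; apply: (@le_trans _ _ (\int[mu]_x (f m x + q.[x] * g x))).
  apply: le_Rintegral => //; first exact: (integrableD measurableT iF iq).
  move=> x _; rewrite /f; case: ifPn => [_|]; first by rewrite lerDl mulr_ge0 ?normal_pdf_ge0.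
  rewrite -ltNge => xn; rewrite add0r ler_wpM2r ?normal_pdf_ge0 //.
  by have /andP[h0 h1] := w1 m x; apply: le_trans h1 _; apply: q1.
rewrite RintegralD //; have := G_poly q; rewrite /G => ->; rewrite mulr_natl mulr2n; exact: lerD.
Qed.

(** The trivial error bound 1 is paid by the bump [2 * wind L x ^+ m] close to a and by q beyond the
    window. In between, the sine is monotone and bounded away from 0, so [wave] stays away from 1/2
    and [step] is within e of the indicator. *)
Lemma indicator_approx : poly_approx (fun x : R => (x <= a)%R%:R).
Proof.
apply: poly_approx_dom => e0 e00.
have [e e1 e0E] : exists2 e : R, 0 < e & 4 * e + e <= e0 by exists (e0 / 5); lra.
pose k := gam (('X - a%:P) ^+ 2).
have k0 : 0 <= k by apply: gam_ge0 => x; rewrite horner_exp sqr_ge0.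
(* Chebyshev's inequality: q below has mean k / L^2, which this L makes at most e. *)
pose L := 1 + k / e.
have L1 : 1 <= L by rewrite lerDl divr_ge0 // ltW.
have L0 : 0 < L by lra.
pose q : {poly R} := (L ^+ 2)^-1 *: ('X - a%:P) ^+ 2.
have qE x : q.[x] = ((x - a) / L) ^+ 2 by rewrite /q hornerZ horner_exp hornerXsubC expr_div_n mulrC.
have q0 x : 0 <= q.[x] by rewrite qE sqr_ge0.
have q1 x : L < `|x - a| -> 1 <= q.[x].
  move=> h; rewrite qE -real_normK ?num_real // exprn_ege1 //.
  by rewrite normf_div [`|L|]gtr0_norm // ler_pdivlMr // mul1r ltW.
have gq : gam q <= e.
  rewrite gamZ -/k mulrC ler_pdivrMr ?exprn_gt0 // expr2.
  have : e * L = e + k by rewrite /L mulrDr mulr1 mulrCA divff ?gt_eqF // mulr1.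
  move=> eL; rewrite mulrA eL; apply: (@le_trans _ _ (e + k)); first by lra.
  by rewrite ler_peMr //; lra.
have [m Gm] := wind_small L0 e1 gq q0 q1.
have [d d0 hd] : exists2 d : R, 0 < d <= L & forall x, `|x - a| < d -> 1 <= 2 * wind L x ^+ m.
  have wa : wind L a ^+ m = 1 by rewrite /wind subrr mul0r cos0 -[1 + 1]/(2 : R) divff ?expr1n.
  have := @trig_continuous _ _ (trig_exp m (trig_wind L)) a.
  rewrite /continuous_at wa => /cvgrPdist_lt /(_ 2^-1).
  rewrite invr_gt0 ltr0n => /(_ isT) /nbhs_ballP [d /= d0 hd].
  exists (Num.min d L); first by rewrite lt_min d0 L0 ge_min lexx orbT.
  move=> x; rewrite lt_min => /andP[xd _]; have := hd x; rewrite /ball /= distrC => /(_ xd).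
  by rewrite ltr_norml => /andP[_]; lra.
have [dp dL] := andP d0.
have sp : 0 < sin (d / L).
  rewrite sin2_gt0 // divr_gt0 //=; apply: (@le_lt_trans _ _ 1); last by rewrite ltr1n.
  by rewrite ler_pdivrMr // mul1r.
have [n hn] : exists n, ((1 + 2 * (sin (d / L) / 2)) ^+ n)^-1 <= e.
  have z1 : `|(1 + 2 * (sin (d / L) / 2))^-1| < 1.
    by rewrite ger0_norm ?invr_ge0 ?invf_lt1; lra.
  have /cvgr0_norm_le /(_ _ e1) [n _ hn] := cvg_expr z1.
  by exists n; have := hn n (leqnn n); rewrite /= exprVn => /(le_trans (ler_norm _)).
exists (fun x => step n (wave L x)), (fun x => 2 * wind L x ^+ m), (q + e%:P); split.
- apply: (trig_eq (trig_exp (2 ^ n) (trig_add (trig_cst 1) (trig_scale (-1) (trig_exp n (trig_wave L)))))) => x.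
  by rewrite /step mulN1r.
- by apply: trig_scale; apply: trig_exp; exact: trig_wind.
- move=> x; rewrite hornerD hornerC; have /andP[v0 v1] := wave_itv L x; have /andP[w0 w1] := wind_itv L x.
  have /andP[s0 s1] := step_itv n (wave_itv L x).
  have wm0 : 0 <= 2 * wind L x ^+ m by rewrite mulr_ge0 // exprn_ge0.
  have f1 : `|(x <= a)%R%:R - step n (wave L x)| <= 1.
    by case: (x <= a); rewrite ler_norml /=; lra.
  have [xd|xd] := ltP `|x - a| d.
    by apply: le_trans f1 _; have := hd x xd; have := q0 x; lra.
  have [xL|xL] := ltP L `|x - a|; first by apply: le_trans f1 _; have := q1 x xL; lra.
  apply: (@le_trans _ _ e); last by have := q0 x; lra.
  have sd : 0 <= sin (d / L) / 2 by rewrite divr_ge0 // ltW.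
  have zd : d / L <= `|(x - a) / L| <= 1.
    by rewrite normf_div [`|L|]gtr0_norm // ler_pdivrMr // divfK ?gt_eqF // xd ler_pdivrMr // mul1r.
  have dL0 : 0 <= d / L by rewrite divr_ge0 ?ltW.
  have := sin_low dL0 zd; have [xa|xa] := leP x a.
    rewrite ler0_norm ?pmulr_lle0 ?invr_gt0 ?subr_le0 // sinN => hs.
    rewrite ger0_norm ?subr_ge0 //; apply: le_trans hn; apply: step_low => //.
    by rewrite /wave; lra.
  have xa0 : 0 <= (x - a) / L by rewrite divr_ge0 ?subr_ge0 // ltW.
  rewrite [`|_ / L|]ger0_norm // => hs.
  rewrite sub0r normrN ger0_norm //; apply: le_trans hn; apply: step_high => //.
  by rewrite /wave; lra.
- by apply: le_trans Gm _; lra.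
- by rewrite gamD gam_C; lra.
Qed.

End Indicator.

(** * The limit law of the cycle variables *)

Section BoxLimit.
Variable R : realType.
Local Notation gam := (@gam R).
Local Notation G := (@G R).
Local Notation mu := (@lebesgue_measure R).
Local Notation V := (V R).

(* With |a| <= 1 no bound on b is needed: all error terms are products of the c. *)
Lemma prod_diff_le (I : Type) (l : seq I) (a b c : I -> R) :
  (forall k, `|a k| <= 1) -> (forall k, `|a k - b k| <= c k) ->
  `|\prod_(k <- l) a k - \prod_(k <- l) b k| <= \prod_(k <- l) (1 + c k) - 1.
Proof.
move=> a1 abc; have A1 (s : seq I) : `|\prod_(k <- s) a k| <= 1.
  elim: s => [|k s IH]; rewrite ?big_nil ?normr1 // big_cons normrM.
  by rewrite -[leRHS]mulr1 ler_pM.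
elim: l => [|k l IH]; first by rewrite !big_nil !subrr normr0.
rewrite !big_cons; have ck : 0 <= c k by apply: le_trans (abc k).
have := A1 l; move: IH; move: (\prod_(j <- l) a j) (\prod_(j <- l) b j) (\prod_(j <- l) (1 + c j)) => A B C IH hA.
have -> : a k * A - b k * B = a k * (A - B) + (a k - b k) * B by ring.
apply: le_trans (ler_normD _ _) _; rewrite !normrM.
have BC : `|B| <= C.
  have -> : B = A - (A - B) by ring.
  by apply: le_trans (ler_normB _ _) _; lra.
have h1 : `|a k| * `|A - B| <= 1 * (C - 1) by apply: ler_pM.
have h2 : `|a k - b k| * `|B| <= c k * C by apply: ler_pM.
lra.
Qed.

Lemma pow1D_le (e : R) N : 0 <= e <= 1 -> (1 + e) ^+ N <= 1 + e * 3 ^+ N.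
Proof.
move=> /andP[e0 e1]; elim: N => [|N IH]; first by rewrite !expr0 mulr1 lerDl.
rewrite !exprS; apply: (@le_trans _ _ ((1 + e) * (1 + e * 3 ^+ N))).
  by rewrite ler_wpM2l //; lra.
have t1 : 1 <= 3 ^+ N :> R by rewrite exprn_ege1 // ler1n.
by move: (3 ^+ N) t1 => t t1; have := ler_wpM2l e0 t1; have := ler_wpM2r (mulr_ge0 e0 (le_trans ler01 t1)) e1; lra.
Qed.

(** Each factor is replaced by a polynomial [p k]. The pointwise error is at most the product of the
    1 + q k, minus 1; this is polynomial in the V_k too, so its mean converges to a small Gaussian
    mean. The index k stands for cycle length k + 2. *)
Lemma Ex_prod_limit d (phi : 'I_d -> R -> R) : (forall k, poly_approx (phi k)) ->
  (forall k, measurable_fun [set: R] (phi k)) -> (forall k x, `|phi k x| <= 1) ->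
  (fun n => Ex (fun lam : intpart n => \prod_(k < d) phi k (V k.+2 lam))) @ \oo -->
  \prod_(k < d) G (phi k).
Proof.
move=> Mphi mphi phi1.
have moments (q : 'I_d -> {poly R}) :
    (fun n => Ex (fun lam : intpart n => \prod_(k < d) (q k).[V k.+2 lam])) @ \oo --> \prod_(k < d) gam (q k).
  pose q' (k : nat) : {poly R} := if insub (k - 2)%N is Some i then q i else 0.
  have qE (i : 'I_d) : q' i.+2 = q i by rewrite /q' -[i.+2]addn2 addnK valK.
  have := @poly_moments R gam (@gam_lin R) (@gam_hermite R) d.+1 q'.
  rewrite (big_addn 0 d.+2 2) !subSS subn0 big_mkord.
  under eq_bigr => i _ do rewrite addn2 qE.
  apply: cvg_trans; apply: near_eq_cvg; near=> n; apply: eq_Ex => lam.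
  rewrite (big_addn 0 d.+2 2) !subSS subn0 big_mkord.
  by apply: eq_bigr => i _; rewrite addn2 qE.
apply/cvgrPdist_le => eps eps0.
(* By [pow1D_le] this makes (1 + e)^d - 1 at most eps/4. *)
pose e := Num.min 1 (eps / 4 / 3 ^+ d).
have e0 : 0 < e by rewrite lt_min ltr01 !divr_gt0 ?exprn_gt0.
have e1 : e <= 1 by rewrite ge_min lexx.
have eE : (1 + e) ^+ d - 1 <= eps / 4.
  rewrite lerBlDl; apply: le_trans (pow1D_le d _) _; first by rewrite ltW.
  by rewrite lerD2l -ler_pdivlMr ?exprn_gt0 // ge_min lexx orbT.
have /choice [pq pqE] : forall k, exists pq : {poly R} * {poly R},
    (forall x, `|phi k x - pq.1.[x]| <= pq.2.[x]) /\ gam pq.2 <= e.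
  by move=> k; have [p [q h]] := Mphi k e e0; exists (p, q).
pose p k := (pq k).1; pose q k := (pq k).2.
have q0 k x : 0 <= (q k).[x] by apply: le_trans ((pqE k).1 x).
have gq : \prod_(k < d) (1 + gam (q k)) - 1 <= eps / 4.
  apply: le_trans eE; rewrite lerD2r -[X in _ ^+ X](card_ord d) -prodr_const.
  apply: ler_prod => k _; have := (pqE k).2; have := gam_ge0 (q0 k); rewrite -/(q k); lra.
have h1 := moments p; have h2 := moments (fun k => 1 + q k).
have gE : \prod_(k < d) gam (1 + q k) = \prod_(k < d) (1 + gam (q k)).
  by apply: eq_bigr => k _; rewrite gamD gam1.
rewrite gE in h2.
have G1 k : `|G (phi k)| <= 1.
  have := @G_approx R (phi k) 0 1 (mphi k); rewrite gam0 gam1 subr0; apply => x.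
  by rewrite horner0 subr0 hornerC.
have hG : `|\prod_(k < d) G (phi k) - \prod_(k < d) gam (p k)| <= eps / 4.
  apply: le_trans gq; apply: prod_diff_le => // k; exact: (G_approx (mphi k) (pqE k).1).
have e4 : 0 < eps / 4 by rewrite divr_gt0.
have /cvgrPdist_le /(_ _ e4) n1 := h1; have /cvgrPdist_le /(_ _ e4) n2 := h2.
near=> n.
have m1 : `|\prod_(k < d) gam (p k) - Ex (fun lam : intpart n => \prod_(k < d) (p k).[V k.+2 lam])| <= eps / 4 by near: n.
have m2 : `|\prod_(k < d) (1 + gam (q k)) - Ex (fun lam : intpart n => \prod_(k < d) (1 + q k).[V k.+2 lam])| <= eps / 4 by near: n.
have m3 : `|Ex (fun lam : intpart n => \prod_(k < d) phi k (V k.+2 lam)) -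
    Ex (fun lam : intpart n => \prod_(k < d) (p k).[V k.+2 lam])| <=
    Ex (fun lam : intpart n => \prod_(k < d) (1 + q k).[V k.+2 lam]) - 1.
  rewrite [leRHS](_ : _ = Ex (fun lam : intpart n => \prod_(k < d) (1 + q k).[V k.+2 lam] - 1)); last by rewrite ExB Ex1.
  rewrite -ExB; apply: le_trans (Ex_norm _) _; apply: Ex_le => lam.
  under [X in _ <= X - 1]eq_bigr => k _ do rewrite hornerD hornerC.
  by apply: prod_diff_le => // k; exact: (pqE k).1.
move: m1 m2 m3 hG gq; rewrite !ler_norml.
move=> /andP[? ?] /andP[? ?] /andP[? ?] /andP[? ?] ?; apply/andP; split; lra.
Unshelve. all: by end_near.
Qed.

Lemma indic_cell (a b x : R) : a <= b -> \1_`]a, b] x = (x <= b)%R%:R - (x <= a)%R%:R :> R.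
Proof.
move=> ab; rewrite indicE mem_setE in_itv /= ltNge.
by have [xa|xa] /= := leP x a; rewrite ?(le_trans xa ab) ?subrr ?subr0.
Qed.

Lemma cell_approx (a b : R) : a <= b -> poly_approx (\1_`]a, b] : R -> R).
Proof.
move=> ab; have := poly_approx_add (indicator_approx b) (poly_approx_scale (-1) (indicator_approx a)).
by congr (poly_approx _); apply/funext => x; rewrite indic_cell // mulN1r.
Qed.

Lemma G_indic (A : set R) : measurable A -> G (\1_A) = fine (normal_prob 0 1 A).
Proof.
move=> mA; rewrite /normal_prob -[RHS]/(\int[mu]_(x in A) normal_pdf 0 1 x) Rintegral_mkcond.
by apply: eq_Rintegral => x _; rewrite patchE indicE; case: (x \in A); rewrite ?mul1r ?mul0r.
Qed.

End BoxLimit.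

(** * Step functions on grids *)

Section Grid.
Variable R : realType.

Lemma indic01 (A : set R) (x : R) : 0 <= (\1_A x : R) <= 1.
Proof. by rewrite indicE; case: (x \in A); rewrite /= ?lexx ?ler01. Qed.

Lemma norm_indic_le1 (A : set R) (x : R) : `|\1_A x : R| <= 1.
Proof. by have /andP[h0 h1] := indic01 A x; rewrite ger0_norm. Qed.

Lemma prod_indic01 d (A : 'I_d -> set R) (x : 'I_d -> R) : 0 <= \prod_(i < d) (\1_(A i) (x i) : R) <= 1.
Proof.
apply/andP; split; first by apply: prodr_ge0 => i _; have /andP[] := indic01 (A i) (x i).
by apply: prodr_ile1 => i _; exact: indic01.
Qed.

(* The values of F at the upper corners of the cells of a grid on ]-B, B]^d. *)
Lemma grid_approx d (F : ('I_d -> R) -> R) (M B e : R) : 0 < B -> 0 <= e -> (forall x, `|F x| <= M) ->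
  (exists2 dl : R, 0 < dl & forall x y, (forall i, `|x i| <= B) -> (forall i, `|x i - y i| < dl) ->
     `|F x - F y| <= e) ->
  exists N (c : {ffun 'I_d -> 'I_N} -> R) (A : 'I_N -> set R),
    [/\ forall j, measurable (A j), forall j, poly_approx (\1_(A j) : R -> R) &
      forall x, `|F x - \sum_v c v * \prod_(i < d) \1_(A (v i)) (x i)| <=
        e + M * (1 - \prod_(i < d) \1_`]-B, B] (x i))].
Proof.
move=> B0 e0 FM [dl dl0 hF].
(* Chosen so that the mesh 2B / N is smaller than the modulus [dl]. *)
pose N := (Num.truncn (2 * B / dl)).+1; pose h := 2 * B / N%:R.
have N0 : 0 < N%:R :> R by rewrite ltr0n.
have h0 : 0 < h by rewrite divr_gt0 // mulr_gt0.
have hd : h < dl by rewrite ltr_pdivrMr // [dl * _]mulrC -ltr_pdivrMr // truncnS_gt.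
pose t (j : nat) : R := - B + j%:R * h.
have tS j : t j <= t j.+1 by rewrite /t -[j.+1]addn1 natrD mulrDl mul1r lerD2l lerDl ltW.
have tD j : t j.+1 = t j + h by rewrite /t -[j.+1]addn1 natrD mulrDl mul1r addrA.
have t0 : t 0%N = - B by rewrite /t mul0r addr0.
have tN : t N = B by rewrite /t /h mulrC divfK ?gt_eqF //; ring.
pose A (j : 'I_N) : set R := [set` `]t j, t j.+1]].
have sumA x : \sum_(j < N) (\1_(A j) x : R) = \1_`]-B, B] x.
  rewrite (eq_bigr (fun j : 'I_N => (x <= t j.+1)%R%:R - (x <= t j)%R%:R)); last first.
    by move=> j _; rewrite /A indic_cell.
  rewrite -(big_mkord xpredT (fun j => (x <= t j.+1)%R%:R - (x <= t j)%R%:R)) telescope_sumr //.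
  by rewrite indic_cell ?t0 ?tN //; lra.
have M0 : 0 <= M by apply: le_trans (FM (fun=> 0)).
exists N, (fun v : {ffun 'I_d -> 'I_N} => F (fun i => t (v i).+1)), A; split.
- by move=> j; exact: measurable_itv.
- by move=> j; exact: cell_approx.
move=> x; have SE : \prod_(i < d) (\1_`]-B, B] (x i) : R) = \sum_(v : {ffun 'I_d -> 'I_N}) \prod_(i < d) \1_(A (v i)) (x i).
  by rewrite -(bigA_distr_bigA (fun i j => \1_(A j) (x i) : R)); apply: eq_bigr => i _; rewrite sumA.
set S := \prod_(i < d) \1_`]-B, B] (x i) in SE *.
have /andP[S0 S1] : 0 <= S <= 1 by exact: prod_indic01.
(* The cells tile the box, so their indicators sum to S; the part outside the box and the
   oscillation inside the cells are then bounded separately. *)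
have -> : F x - \sum_(v : {ffun 'I_d -> 'I_N}) F (fun i => t (v i).+1) * \prod_(i < d) \1_(A (v i)) (x i) =
    F x * (1 - S) + \sum_(v : {ffun 'I_d -> 'I_N}) (F x - F (fun i => t (v i).+1)) * \prod_(i < d) (\1_(A (v i)) (x i) : R).
  under [in RHS]eq_bigr => v _ do rewrite mulrBl.
  by rewrite sumrB -mulr_sumr -SE; ring.
apply: le_trans (ler_normD _ _) _; rewrite [e + _]addrC lerD //.
  by rewrite normrM ler_pM // ger0_norm ?subr_ge0.
apply: (@le_trans _ _ (e * S)); last by rewrite -[leRHS]mulr1 ler_wpM2l.
apply: le_trans (ler_norm_sum _ _ _) _; rewrite SE mulr_sumr; apply: ler_sum => v _.
rewrite normrM; have /andP[p0 p1] := prod_indic01 (fun i => A (v i)) x.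
rewrite [X in _ * X <= _]ger0_norm //.
have [->|pn] := eqVneq (\prod_(i < d) (\1_(A (v i)) (x i) : R)) 0; first by rewrite !mulr0.
rewrite ler_wpM2r //.
have xA i : t (v i) < x i <= t (v i).+1.
  have := pn; rewrite (bigD1 i) //= mulf_eq0 negb_or => /andP[+ _].
  by rewrite indicE mem_setE in_itv /= pnatr_eq0 eqb0 negbK.
apply: hF => i; have /andP[x1 x2] := xA i.
  have a1 : - B <= t (v i) by rewrite /t lerDl mulr_ge0 // ltW.
  have a2 : t (v i).+1 <= B.
    by rewrite -tN /t lerD2l ler_wpM2r ?(ltW h0) // ler_nat.
  by rewrite ler_norml; apply/andP; split; lra.
by rewrite distrC ger0_norm ?subr_ge0 // tD; lra.
Qed.

End Grid.

(** * Weak convergence of the cycle variables to Gaussians *)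

Section VectorLimit.
Variables (R : realType) (dsp : measure_display) (T : measurableType dsp) (P : probability T R).
Variable xi : nat -> {RV P >-> R}.
Hypothesis hgauss : forall k : nat, (2 <= k)%N -> standard_gaussian (xi k).
Hypothesis hindep : mutually_independent [set k : nat | (2 <= k)%N] xi.
Local Notation G := (@G R).

Lemma Rintegral_sum (I : Type) (l : seq I) (f : I -> T -> R) :
  (forall v, P.-integrable [set: T] (EFin \o f v)) ->
  \int[P]_w (\sum_(v <- l) f v w) = \sum_(v <- l) \int[P]_w f v w.
Proof.
move=> fi; elim: l => [|v l IH].
  by rewrite big_nil; under eq_Rintegral do rewrite big_nil; rewrite /Rintegral integral0.
rewrite big_cons -IH -RintegralD //; first by apply: eq_Rintegral => w _; rewrite big_cons.
have := @integrable_sum _ _ _ P _ measurableT _ l xpredT (fun v => EFin \o f v) (fun v _ => fi v).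
by congr (P.-integrable _ _); apply/funext => w /=; rewrite -sumEFin.
Qed.

Lemma measurable_cell d (A : 'I_d -> set R) : (forall i, measurable (A i)) ->
  measurable_fun [set: T] (fun w => \prod_(i < d) (\1_(A i) (xi i.+2 w) : R)).
Proof.
move=> mA; apply: measurable_prod => i _.
apply: measurableT_comp; last exact: measurable_funPT.
exact: measurable_indic.
Qed.

Lemma E_indep d (A : 'I_d -> set R) : (forall i, measurable (A i)) ->
  \int[P]_w \prod_(i < d) (\1_(A i) (xi i.+2 w) : R) = \prod_(i < d) G (\1_(A i)).
Proof.
move=> mA; pose B (k : nat) : set R := if insub (k - 2)%N is Some i then A i else [set: R].
have BE (i : 'I_d) : B i.+2 = A i by rewrite /B -[i.+2]addn2 addnK valK.
have mB k : measurable (B k) by rewrite /B; case: insub => [i|] //; exact: mA.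
pose J := iota 2 d.
have JE : J = [seq k.+2 | k <- iota 0 d] by rewrite /J -[2%N]addn0 iotaDl.
pose E := \bigcap_(k in [set` J]) (xi k @^-1` B k).
have mE : measurable E.
  by apply: bigcap_measurableType => k _; apply: measurable_funPTI.
have -> : (fun w => \prod_(i < d) (\1_(A i) (xi i.+2 w) : R)) = \1_E.
  apply/funext => w; rewrite indicE; have [wE|wE] := boolP (w \in E).
    rewrite big1 // => i _; rewrite indicE -BE.
    move: wE; rewrite inE => /(_ i.+2); rewrite /= => h; rewrite mem_set //; apply: h.
    by rewrite JE; apply: map_f; rewrite mem_iota add0n ltn_ord.
  move: wE; rewrite notin_setE => /existsNP[k] /not_implyP[kJ wk].
  move: kJ; rewrite /= JE => /mapP[j]; rewrite mem_iota add0n => /andP[_ jd] kE.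
  rewrite (bigD1 (Ordinal jd)) //= indicE memNset ?mul0r // -BE -kE.
  exact: wk.
rewrite /Rintegral integral_indic // setIT -[RHS]/(fine (\prod_(i < d) G (\1_(A i)))%:E).
have J2 : [set` J] `<=` [set k : nat | (2 <= k)%N] by move=> k; rewrite /= mem_iota => /andP[].
congr fine; apply: (etrans (hindep (iota_uniq 2 d) J2 mB)).
rewrite -/J JE big_map (_ : iota 0 d = index_iota 0 d) ?big_mkord; last by rewrite /index_iota subn0.
rewrite -prodEFin; apply: eq_bigr => i _; rewrite BE G_indic // -(hgauss (isT : (2 <= i.+2)%N)) //.
by rewrite fineK // fin_num_measure.
Qed.

(** Up to eps m + M (1 - S m), with S m the indicator of the m-th box, F is a grid function, for
    which convergence is known. The mean of 1 - S m is small under the Gaussian law for large m and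
    then, by [S_lim], under the Plancherel measure for large n. *)
Lemma vector_limit d (F : ('I_d -> R) -> R) (M : R) : (forall x, `|F x| <= M) ->
  (forall B e : R, 0 < e -> exists2 dl : R, 0 < dl & forall x y, (forall i, `|x i| <= B) ->
     (forall i, `|x i - y i| < dl) -> `|F x - F y| <= e) ->
  (fun n => Ex (fun lam : intpart n => F (fun i => V R i.+2 lam))) @ \oo -->
    \int[P]_w F (fun i => xi i.+2 w).
Proof.
move=> FM hF; pose eps (m : nat) : R := m.+1%:R^-1; pose B (m : nat) : R := m.+1%:R.
have eps0 m : 0 < eps m by rewrite invr_gt0.
have B0 m : 0 < B m by rewrite ltr0n.
have M0 : 0 <= M by apply: le_trans (FM (fun=> 0)).
have epsl : eps @ \oo --> (0 : R) by exact: cvg_harmonic.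
pose S m (x : 'I_d -> R) : R := \prod_(i < d) \1_`]- B m, B m] (x i).
have S01 m x : 0 <= S m x <= 1 by exact: prod_indic01.
have S_lim m : (fun n => Ex (fun lam : intpart n => S m (fun i => V R i.+2 lam))) @ \oo -->
    \int[P]_w S m (fun i => xi i.+2 w).
  rewrite E_indep; last by move=> i; exact: measurable_itv.
  apply: Ex_prod_limit => i; [apply: cell_approx | exact: measurable_indic | exact: norm_indic_le1].
  by have := B0 m; lra.
pose good m (h : ('I_d -> R) -> R) :=
    [/\ measurable_fun [set: T] (fun w => h (fun i => xi i.+2 w)),
        forall x, `|F x - h x| <= eps m + M * (1 - S m x) &
        (fun n => Ex (fun lam : intpart n => h (fun i => V R i.+2 lam))) @ \oo -->
          \int[P]_w h (fun i => xi i.+2 w)].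
have /choice [st stP] : forall m, exists h, good m h.
  move=> m.
  have [N [c [A [mA pA hA]]]] := grid_approx (B0 m) (ltW (eps0 m)) FM (hF (B m) (eps m) (eps0 m)).
  exists (fun x => \sum_v c v * \prod_(i < d) \1_(A (v i)) (x i)).
  have mc (v : {ffun 'I_d -> 'I_N}) : measurable_fun [set: T] (fun w => \prod_(i < d) (\1_(A (v i)) (xi i.+2 w) : R)).
    by apply: (@measurable_cell d (fun i => A (v i))).
  have ic (v : {ffun 'I_d -> 'I_N}) : P.-integrable [set: T] (EFin \o (fun w => \prod_(i < d) (\1_(A (v i)) (xi i.+2 w) : R))).
    apply: (@integrable_le R _ _ P _ (fun=> 1)); [exact: mc | move=> w | exact: finite_measure_integrable_cst].
    by have /andP[h0 h1] := prod_indic01 (fun i => A (v i)) (fun i => xi i.+2 w); rewrite ger0_norm.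
  split=> //.
    by apply: measurable_sum => v; apply: measurable_funM => //; exact: measurable_cst.
  have -> : \int[P]_w (\sum_v c v * \prod_(i < d) \1_(A (v i)) (xi i.+2 w)) =
      \sum_v c v * \prod_(i < d) G (\1_(A (v i))).
    transitivity (\sum_(v : {ffun 'I_d -> 'I_N}) \int[P]_w (c v * \prod_(i < d) \1_(A (v i)) (xi i.+2 w))); last first.
      by apply: eq_bigr => v _; rewrite RintegralZl // E_indep.
    by rewrite Rintegral_sum // => v; apply: (@integrableZl _ _ _ P _ measurableT (c v) _ (ic v)).
  under eq_fun => n do rewrite Ex_sum.
  apply: cvg_bigsum => v; under eq_fun => n do rewrite ExZ; apply: cvgMl_tmp.
  apply: Ex_prod_limit => i; [exact: pA | exact: measurable_indic | exact: norm_indic_le1].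
have S_cvg x : (fun m => S m x) @ \oo --> (1 : R).
  apply: cvg_near_cst; exists (\max_(i < d) (Num.truncn `|x i|).+1)%N => // m /= mx.
  rewrite /S big1 // => i _; rewrite indicE mem_set //= in_itv /=.
  have h : `|x i| < B m.
    apply: lt_le_trans (truncnS_gt _) _; rewrite ler_nat; apply: leq_trans (leqW mx).
    exact: (@leq_bigmax _ (fun i => (Num.truncn `|x i|).+1)).
  by move: h; rewrite ltr_norml => /andP[-> /ltW].
have st_cvg x : (fun m => st m x) @ \oo --> F x.
  apply/cvgrPdist_le => e e0.
  have h : (fun m => eps m + M * (1 - S m x)) @ \oo --> (0 + M * (1 - 1) : R).
    by apply: cvgD => //; apply: cvgMl_tmp; apply: cvgB; [exact: cvg_cst | exact: S_cvg].
  rewrite subrr mulr0 addr0 in h; have /cvgr0_norm_le /(_ _ e0) := h.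
  by apply: filterS => m /(le_trans (ler_norm _)); apply: le_trans; have [_ + _] := stP m; exact.
(* F is a function on a bare function space, so measurability is obtained from the grid functions,
   which converge to it pointwise. *)
have mF : measurable_fun [set: T] (fun w => F (fun i => xi i.+2 w)).
  apply: (@measurable_fun_cvg _ _ _ _ (fun m w => st m (fun i => xi i.+2 w))).
    by move=> m; have [] := stP m.
  by move=> w _; exact: st_cvg.
have lim1 : (fun m => \int[P]_w st m (fun i => xi i.+2 w)) @ \oo --> \int[P]_w F (fun i => xi i.+2 w).
  apply: (@Rdominated _ _ _ P _ _ (fun=> 2 * M + 1)).
  - by move=> m; have [] := stP m.
  - exact: mF.
  - by apply/aeW => w; exact: st_cvg.
  - exact: finite_measure_integrable_cst.
  - move=> m w; have [_ h _] := stP m; set x : 'I_d -> R := fun i => xi i.+2 w.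
    have := h x; have := FM x; have /andP[s0 s1] := S01 m x.
    have e1 : eps m <= 1 by rewrite invf_le1 ?ltr0n // ler1n.
    have : M * (1 - S m x) <= M by rewrite -[leRHS]mulr1 ler_wpM2l //; lra.
    move=> ? ? ?; have -> : st m x = F x - (F x - st m x) by ring.
    apply: le_trans (ler_normB _ _) _; lra.
have c1 : \int[P]_w (1 : R) = 1.
  by rewrite /Rintegral integral_cst // mul1e -[RHS]/(fine 1%E); congr fine; exact: probability_setT.
have lim2 : (fun m => \int[P]_w S m (fun i => xi i.+2 w)) @ \oo --> \int[P]_w (1 : R).
  apply: (@Rdominated _ _ _ P _ _ (fun=> 1)).
  - by move=> m; apply: (@measurable_cell d (fun=> [set` `]- B m, B m]])) => i; exact: measurable_itv.
  - exact: measurable_cst.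
  - by apply/aeW => w; exact: S_cvg.
  - exact: finite_measure_integrable_cst.
  - by move=> m w; have /andP[h0 h1] := S01 m (fun i => xi i.+2 w); rewrite ger0_norm.
rewrite c1 in lim2.
apply/cvgrPdist_le => e e0; have e4 : 0 < e / 8 by rewrite divr_gt0.
(* M + 1 instead of M keeps the tolerance positive when M = 0. *)
have eM : 0 < e / 8 / (M + 1) by rewrite divr_gt0 // ltr_wpDl.
have [m [m1 m2 m3]] : exists m, [/\ eps m <= e / 8,
    `|\int[P]_w F (fun i => xi i.+2 w) - \int[P]_w st m (fun i => xi i.+2 w)| <= e / 8 &
    `|1 - \int[P]_w S m (fun i => xi i.+2 w)| <= e / 8 / (M + 1)].
  have /cvgr0_norm_le /(_ _ e4) k1 := epsl; have /cvgrPdist_le /(_ _ e4) k2 := lim1.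
  have /cvgrPdist_le /(_ _ eM) k3 := lim2.
  have [m [h1 [h2 h3]]] : exists m, `|eps m| <= e / 8 /\
      `|\int[P]_w F (fun i => xi i.+2 w) - \int[P]_w st m (fun i => xi i.+2 w)| <= e / 8 /\
      `|1 - \int[P]_w S m (fun i => xi i.+2 w)| <= e / 8 / (M + 1).
    by apply: (@filter_ex _ \oo); near=> m; split; [near: m | split; near: m].
  by exists m; split=> //; exact: le_trans (ler_norm _) h1.
have [_ hst lst] := stP m.
have /cvgrPdist_le /(_ _ e4) n1 := lst; have /cvgrPdist_le /(_ _ eM) n2 := S_lim m.
near=> n.
have h1 : `|\int[P]_w st m (fun i => xi i.+2 w) - Ex (fun lam : intpart n => st m (fun i => V R i.+2 lam))| <= e / 8 by near: n.
have h2 : `|\int[P]_w S m (fun i => xi i.+2 w) - Ex (fun lam : intpart n => S m (fun i => V R i.+2 lam))| <= e / 8 / (M + 1) by near: n.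
have h3 : `|Ex (fun lam : intpart n => F (fun i => V R i.+2 lam)) - Ex (fun lam : intpart n => st m (fun i => V R i.+2 lam))| <=
    eps m + M * (1 - Ex (fun lam : intpart n => S m (fun i => V R i.+2 lam))).
  rewrite -ExB; apply: le_trans (Ex_norm _) _.
  have -> : eps m + M * (1 - Ex (fun lam : intpart n => S m (fun i => V R i.+2 lam))) =
      Ex (fun lam : intpart n => eps m + M * (1 - S m (fun i => V R i.+2 lam))).
    rewrite ExD ExZ ExB Ex1; congr (_ + _).
    by have := ExZ (eps m) (fun _ : intpart n => 1); rewrite Ex1 mulr1 => ->.
  by apply: Ex_le => lam; exact: hst.
set s := Ex _ in h2 h3; have h4 : M * (1 - s) <= e / 4.
  have t1 : 1 - s <= 2 * (e / 8 / (M + 1)).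
    by move: m3 h2; rewrite !ler_norml => /andP[_ ?] /andP[_ ?]; lra.
  apply: (@le_trans _ _ (M * (2 * (e / 8 / (M + 1))))); first by rewrite ler_wpM2l.
  rewrite mulrCA -[leRHS](_ : 2 * (e / 8) = _); last by field.
  rewrite ler_wpM2l // mulrA ler_pdivrMr ?ltr_wpDl // mulrC ler_wpM2l ?ltW //; lra.
move: m2 h1 h3; rewrite !ler_norml => /andP[? ?] /andP[? ?] /andP[? ?]; apply/andP; split; lra.
Unshelve. all: by end_near.
Qed.

End VectorLimit.

(** * Convergence of the partial traces *)

Section Rows.
Variable R : realType.

Lemma row_ball m (x y : 'rV[R]_m) (e : R) : 0 < e -> (forall j, `|x 0 j - y 0 j| < e) -> ball x e y.
Proof. by move=> e0 h; split=> // i j; rewrite ord1; exact: h. Qed.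

(** Compactness of the box gives one modulus for all its points x; y is not confined, since a
    perturbed point may leave the box. *)
Lemma uniform_on_box m (f : 'rV[R]_m -> R) (B e : R) : continuous f -> 0 < e ->
  exists2 dl : R, 0 < dl & forall x y : 'rV[R]_m, (forall j, `|x 0 j| <= B) ->
    (forall j, `|x 0 j - y 0 j| < dl) -> `|f x - f y| <= e.
Proof.
move=> cf e0; have e2 : 0 < e / 2 by rewrite divr_gt0.
pose K := [set v : 'rV[R]_m | forall j, [set` `[- B, B]] (v ord0 j)].
have cK : compact K by apply: (@rV_compact _ m (fun=> [set` `[- B, B]])) => j; exact: segment_compact.
have := iffLR (compact_near_coveringP K) cK R (0^'+) 
  (fun dl x => forall y : 'rV[R]_m, (forall j, `|x 0 j - y 0 j| < dl) -> `|f x - f y| <= e) _.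
case.
  move=> x Kx; have /cvgrPdist_lt /(_ _ e2) /nbhs_ballP [r /= r0 hr] := cf x.
  have r2 : 0 < r / 2 by rewrite divr_gt0.
  exists (ball x (r / 2), [set dl | dl < r / 2]) => /=.
    by split; [exact: nbhsx_ballx | exact: nbhs_right_lt].
  move=> [x' dl] /= [xx' dr] y x'y.
  have h1 : `|f x - f x'| < e / 2 by apply: hr; apply: le_ball xx'; lra.
  have h2 : `|f x - f y| < e / 2.
    apply: hr; apply: row_ball => // j; have [_ /(_ 0 j)] := xx'; rewrite /ball /= => h.
    have -> : x 0 j - y 0 j = (x 0 j - x' 0 j) + (x' 0 j - y 0 j) by ring.
    by apply: le_lt_trans (ler_normD _ _) _; have := x'y j; lra.
  have -> : f x' - f y = (f x - f y) - (f x - f x') by ring.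
  by apply: le_trans (ler_normB _ _) _; lra.
move=> dl /= dl0 hdl; exists (dl / 2); first by rewrite divr_gt0.
move=> x y xB xy; apply: (hdl (dl / 2)) xy => //=.
- by rewrite sub0r normrN gtr0_norm ?divr_gt0 // ltr_pdivrMr // ltr_pMr // ltr1n.
- by rewrite divr_gt0.
- by move=> j; rewrite /= in_itv /= -ler_norml; exact: xB.
Qed.

Lemma continuous_row (T : topologicalType) m (g : 'I_m -> T -> R) :
  (forall j, continuous (g j)) -> continuous (fun x => \row_j g j x : 'rV[R]_m).
Proof.
move=> cg x; apply/cvg_ballP => e e0.
have : \forall t \near x, forall j, `|g j x - g j t| < e.
  by apply: filter_forall => j; have /cvgrPdist_lt /(_ _ e0) := cg j x.
by apply: filterS => t h; apply: row_ball => // j; rewrite !mxE.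
Qed.

Lemma continuous_prodr (T : topologicalType) (I : Type) (l : seq I) (g : I -> T -> R) :
  (forall j, continuous (g j)) -> continuous (fun x => \prod_(j <- l) g j x).
Proof.
move=> cg x; elim: l => [|j l IH].
  by under eq_fun do rewrite big_nil; exact: cvg_cst.
have -> : (fun x => \prod_(i <- j :: l) g i x) = (fun x => g j x * \prod_(i <- l) g i x).
  by apply/funext => y; rewrite big_cons.
by apply: cvgM; [exact: cg | exact: IH].
Qed.

Lemma continuous_scale (T : topologicalType) (c : R) (g : T -> R) :
  continuous g -> continuous (fun x => c * g x).
Proof. by move=> cg x; apply: cvgMl_tmp; exact: cg. Qed.

End Rows.

(** * Perturbation of convergence in law *)

Section Slutsky.
Variable R : realType.

(* Since f is bounded, only its modulus of continuity on a large box matters. *)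
Lemma Ex_slutsky m (f : 'rV[R]_m -> R) (W U : forall n, intpart n -> 'rV[R]_m) :
  continuous f -> (exists M : R, forall x, `|f x| <= M) ->
  (forall j (e : R), 0 < e ->
     (fun n => plancherel_prob (fun lam : intpart n => e < `|W n lam 0 j - U n lam 0 j|) : R) @ \oo --> (0 : R)) ->
  (forall j, bseq (fun n => Ex (fun lam : intpart n => U n lam 0 j ^+ 2))) ->
  (fun n => Ex (fun lam => f (W n lam)) - Ex (fun lam => f (U n lam))) @ \oo --> (0 : R).
Proof.
move=> cf [M fM] WU UB.
have M0 : 0 <= M by apply: le_trans (fM 0).
have /choice [C hC] : forall j, exists C : R, \forall n \near \oo, `|Ex (fun lam : intpart n => U n lam 0 j ^+ 2)| <= C.
  exact: UB.
apply/cvgr0Pnorm_le => e e0; have e4 : 0 < e / 4 by rewrite divr_gt0.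
pose S := \sum_j `|C j|.
have S0 : 0 <= S by apply: sumr_ge0.
(* Large enough for Chebyshev's inequality: leaving the box contributes at most 2 M S / B^2 <=
   e/4. *)
pose B := 1 + 8 * M * S / e.
have B1 : 1 <= B by rewrite lerDl divr_ge0 ?mulr_ge0 // ltW.
have B0 : 0 < B by exact: lt_le_trans B1.
have BE : 2 * M * (S / B ^+ 2) <= e / 4.
  rewrite mulrA ler_pdivrMr ?exprn_gt0 // expr2 mulrA.
  have -> : e / 4 * B = e / 4 + 2 * M * S by rewrite /B; field; rewrite gt_eqF.
  have t : 0 <= 2 * M * S by rewrite !mulr_ge0.
  by apply: (@le_trans _ _ (e / 4 + 2 * M * S)); [lra | rewrite ler_peMr //; lra].
have [dl dl0 hdl] := uniform_on_box B cf e4.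
have d2 : 0 < dl / 2 by rewrite divr_gt0.
have h1 : (fun n => 2 * M * \sum_j plancherel_prob (fun lam : intpart n => dl / 2 < `|W n lam 0 j - U n lam 0 j|)) @ \oo
    --> (2 * M * (\sum_(j < m) 0) : R).
  by apply: cvgMl_tmp; apply: cvg_bigsum => j; exact: WU.
rewrite big1 // mulr0 in h1; have /cvgr0_norm_le /(_ _ e4) n1 := h1.
have n2 : \forall n \near \oo, forall j, `|Ex (fun lam : intpart n => U n lam 0 j ^+ 2)| <= C j.
  by apply: filter_forall.
near=> n.
have p1 : 2 * M * \sum_j plancherel_prob (fun lam : intpart n => dl / 2 < `|W n lam 0 j - U n lam 0 j|) <= e / 4.
  by apply: le_trans (ler_norm _) _; near: n.
have p2 : forall j, `|Ex (fun lam : intpart n => U n lam 0 j ^+ 2)| <= C j by near: n.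
rewrite -ExB; apply: le_trans (Ex_norm _) _.
(* At least 1 whenever some coordinate of W is far from U or U leaves the box, so that
   [2 * M * bad lam] then dominates the trivial bound 2M. *)
pose bad (lam : intpart n) : R := \sum_j (dl / 2 < `|W n lam 0 j - U n lam 0 j|)%R%:R + \sum_j U n lam 0 j ^+ 2 / B ^+ 2.
have pt lam : `|f (W n lam) - f (U n lam)| <= e / 4 + 2 * M * bad lam.
  have f2 : `|f (W n lam) - f (U n lam)| <= 2 * M.
    by apply: le_trans (ler_normB _ _) _; have := fM (W n lam); have := fM (U n lam); lra.
  have s1 : 0 <= \sum_j (dl / 2 < `|W n lam 0 j - U n lam 0 j|)%R%:R :> R by apply: sumr_ge0.
  have s2 : 0 <= \sum_j U n lam 0 j ^+ 2 / B ^+ 2.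
    by apply: sumr_ge0 => j _; rewrite divr_ge0 ?sqr_ge0.
  have big1 : 1 <= bad lam -> `|f (W n lam) - f (U n lam)| <= e / 4 + 2 * M * bad lam.
    move=> h; apply: le_trans f2 _; have : 2 * M * 1 <= 2 * M * bad lam by rewrite ler_wpM2l // mulr_ge0.
    by lra.
  have [/forallP hW|] := boolP [forall j, `|W n lam 0 j - U n lam 0 j| <= dl / 2]; last first.
    rewrite negb_forall => /existsP [j]; rewrite -ltNge => hj; apply: big1.
    rewrite /bad (bigD1 j) //= hj -addrA lerDl addr_ge0 //; exact: sumr_ge0.
  have [/forallP hU|] := boolP [forall j, `|U n lam 0 j| <= B]; last first.
    rewrite negb_forall => /existsP [j]; rewrite -ltNge => hj; apply: big1.
    rewrite /bad [X in _ + X](bigD1 j) //= addrCA; apply: (@le_trans _ _ (U n lam 0 j ^+ 2 / B ^+ 2)).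
      rewrite ler_pdivlMr ?exprn_gt0 // mul1r -[leRHS]real_normK ?num_real //.
      by apply: lerXn2r; rewrite ?nnegrE //; apply: ltW.
    by rewrite lerDl addr_ge0 // sumr_ge0 // => i _; rewrite divr_ge0 ?sqr_ge0.
  rewrite distrC; apply: (@le_trans _ _ (e / 4)); last by rewrite lerDl !mulr_ge0 // addr_ge0.
  apply: hdl => j; first exact: hU.
  by rewrite distrC; apply: le_lt_trans (hW j) _; lra.
apply: (@le_trans _ _ (Ex (fun lam => e / 4 * 1 + 2 * M * bad lam))).
  by apply: Ex_le => lam; rewrite mulr1.
rewrite ExD !ExZ Ex1 mulr1 /bad ExD !Ex_sum mulrDr.
have q1 : 2 * M * \sum_j Ex (fun lam : intpart n => (dl / 2 < `|W n lam 0 j - U n lam 0 j|)%R%:R) <= e / 4.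
  by apply: le_trans p1; rewrite ler_wpM2l ?mulr_ge0 //; apply: ler_sum => j _; rewrite probE.
have q2 : 2 * M * \sum_j Ex (fun lam : intpart n => U n lam 0 j ^+ 2 / B ^+ 2) <= e / 4.
  apply: le_trans BE; rewrite ler_wpM2l ?mulr_ge0 // /S mulr_suml; apply: ler_sum => j _.
  have -> : Ex (fun lam : intpart n => U n lam 0 j ^+ 2 / B ^+ 2) = (B ^+ 2)^-1 * Ex (fun lam : intpart n => U n lam 0 j ^+ 2).
    by rewrite -ExZ; apply: eq_Ex => lam; rewrite mulrC.
  rewrite mulrC ler_wpM2r ?invr_ge0 ?sqr_ge0 //.
  by apply: le_trans (ler_norm _) _; apply: le_trans (p2 j) _; exact: ler_norm.
lra.
Unshelve. all: by end_near.
Qed.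

End Slutsky.

(** * Scaled partial traces and Hermite products *)

Section Assembly.
Variable R : realType.

Lemma wt_psupp r (s : 'S_r) : wt (cycle_type s) = #|psupp s|.
Proof.
rewrite /wt sumn_cycle_type -[multiplicity 1 _]mul1n -orbit_pts_cycle_type.
by have := orbit_pts_sum s; rewrite card_ord; lia.
Qed.

Lemma powR_half n m : (n%:R : R) `^ (m%:R / 2) = Num.sqrt n%:R ^+ m.
Proof. by rewrite mulrC powRrM powR12_sqrt // powR_mulrn // sqrtr_ge0. Qed.

Lemma Hm_ord d a n (lam : intpart n) :
  Hm R d.+1 a lam = \prod_(i < d) Hfac i.+2 (a i.+2) (V R i.+2 lam).
Proof.
rewrite /Hm (big_addn 0 d.+2 2) !subSS subn0 big_mkord.
by apply: eq_bigr => i _; rewrite addn2.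
Qed.

Lemma Hm_sqr_bounded K a (u : R) : bseq (fun n => Ex (fun lam : intpart n => (u * Hm R K a lam) ^+ 2)).
Proof.
apply: gen_bdd_Ex; have g1 : gen (@bseq R) (fun n lam => Hm R K a lam * Hm R K a lam).
  by apply: gen_mul; [exact: ideal_bseq | exact: gen_Hm | exact: gen_Hm].
have g2 : gen (@bseq R) (fun n lam => u ^+ 2 * (Hm R K a lam * Hm R K a lam)).
  by apply: (gen_scale (b := fun=> u ^+ 2)) g1 => c bc; apply: bseqM => //; exact: bseq_cst.
by apply: gen_eq g2 _ => n lam; ring.
Qed.

(** The difference splits into the scaled deviation of the partial trace from u times the character,
    handled by [PT_close], and u (X_s - Hm), which is small in mean square because its square again
    has vanishing coefficients. *)
Lemma PT_hermite (alpha : R) K r (s : 'S_r) (u e : R) : 0 < alpha ->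
  (forall q : nat, (1 <= q)%N ->
        (fun n : nat => plancherel_prob (fun lam : intpart n =>
           (n%:R : R) `^ (- (alpha * q%:R)) < max_dim_ratio q lam) : R)
          @ \oo --> (0 : R)) ->
  (r <= K)%N -> 0 <= u <= 1 -> 0 < e ->
  (fun n => plancherel_prob (fun lam : intpart n =>
     e < `|(n%:R : R) `^ ((wt (cycle_type s))%:R / 2) * partial_trace lam u (extend n s) -
           u * Hm R K (fun k => multiplicity k (cycle_type s)) lam|)) @ \oo --> (0 : R).
Proof.
move=> a0 hdim rK u01 e0; pose a := fun k => multiplicity k (cycle_type s); rewrite -/a.
have e2 : 0 < e / 2 by rewrite divr_gt0.
have h1 := PT_close s a0 hdim u01 e2.
have g1 := X_hermite_type R (has_type_cycle s rK).
have g2 : gen (@zseq R) (fun n lam => (X R s lam - Hm R K a lam) * (X R s lam - Hm R K a lam)).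
  by apply: gen_mul g1 (gen_mono (@zseq_bseq R) g1); exact: ideal_zseq.
have h2 : (fun n => 4 / e ^+ 2 * Ex (fun lam : intpart n => (X R s lam - Hm R K a lam) * (X R s lam - Hm R K a lam)))
    @ \oo --> (4 / e ^+ 2 * 0 : R) by apply: cvgMl_tmp; exact: gen_small_Ex.
have h : (fun n => plancherel_prob (fun lam : intpart n => e / 2 < `|sq R n ^+ #|psupp s| *
      (partial_trace lam u (extend n s) - u * nchar R lam (extend n s))|) +
    4 / e ^+ 2 * Ex (fun lam : intpart n => (X R s lam - Hm R K a lam) * (X R s lam - Hm R K a lam)))
    @ \oo --> (0 + 4 / e ^+ 2 * 0 : R) by apply: cvgD.
rewrite mulr0 addr0 in h.
apply: squeeze_cvgr (cvg_cst 0) h; near=> n; rewrite prob_ge0 /=.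
pose A (lam : intpart n) := e / 2 < `|sq R n ^+ #|psupp s| * (partial_trace lam u (extend n s) - u * nchar R lam (extend n s))|.
pose B (lam : intpart n) := e / 2 < `|X R s lam - Hm R K a lam|.
apply: (@le_trans _ _ (plancherel_prob A + plancherel_prob B)).
  apply: prob_le2 => lam eW; case: (boolP (A lam)) => //=; rewrite /A -leNgt => hA.
  case: (boolP (B lam)) => //; rewrite /B -leNgt => hB.
  move: eW; apply: contraTT => _; rewrite -leNgt wt_psupp powR_half -/(sq R n).
  have -> : sq R n ^+ #|psupp s| * partial_trace lam u (extend n s) - u * Hm R K a lam =
    sq R n ^+ #|psupp s| * (partial_trace lam u (extend n s) - u * nchar R lam (extend n s)) +
      u * (X R s lam - Hm R K a lam) by rewrite /X; ring.
  apply: le_trans (ler_normD _ _) _; rewrite [e]splitr lerD // normrM.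
  have /andP[u0 u1] := u01; rewrite ger0_norm // -[leRHS]mul1r.
  by apply: ler_pM.
rewrite lerD2l -ExZ; apply: prob_markov => lam.
  by rewrite mulr_ge0 ?divr_ge0 ?sqr_ge0 // -expr2 sqr_ge0.
rewrite /B -expr2 -[(_ - _) ^+ 2]real_normK ?num_real // => h3.
have h4 : (e / 2) ^+ 2 <= `|X R s lam - Hm R K a lam| ^+ 2.
  by apply: lerXn2r; rewrite ?nnegrE //; apply: ltW.
rewrite mulrAC ler_pdivlMr ?exprn_gt0 // mul1r.
have -> : e ^+ 2 = 4 * (e / 2) ^+ 2 by field.
by rewrite ler_wpM2l.
Unshelve. all: by end_near.
Qed.

End Assembly.

Theorem proposition5p2 (R : realType)
    (hdim : exists2 alpha : R, 0 < alpha &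
      forall s : nat, (1 <= s)%N ->
        (fun n : nat => plancherel_prob (fun lam : intpart n =>
           (n%:R : R) `^ (- (alpha * s%:R)) < max_dim_ratio s lam) : R)
          @ \oo --> (0 : R))
    (r : nat -> nat) (sigma : forall i : nat, 'S_(r i))
    (rho : nat -> seq nat) (hrho : forall i, cycle_type (sigma i) = rho i)
    (u : nat -> R) (hu : forall i, 0 <= u i <= 1)
    (d : measure_display) (T : measurableType d) (P : probability T R)
    (xi : nat -> {RV P >-> R})
    (hgauss : forall k : nat, (2 <= k)%N -> standard_gaussian (xi k))
    (hindep : mutually_independent [set k : nat | (2 <= k)%N] xi) :
  plancherel_cvg_findim
    (fun i n (lam : intpart n) =>
       (n%:R : R) `^ ((wt (rho i))%:R / 2)
         * partial_trace lam (u i) (extend n (sigma i)))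
    P
    (fun i w =>
       u i * \prod_(2 <= k < (sumn (rho i)).+1)
               ((k%:R : R) `^ ((multiplicity k (rho i))%:R / 2)
                  * (hermite (multiplicity k (rho i))).[xi k w])).

Proof.
case: hdim => alpha a0 hdim m idx f cf fM.
pose a (j : 'I_m) (k : nat) := multiplicity k (rho (idx j)).
(* One bound on the cycle lengths of the finitely many permutations involved; the coordinates i < D
   stand for the lengths 2 to D + 1. *)
pose D := (\max_(j < m) r (idx j))%N.
have rd j : (r (idx j) <= D.+1)%N by apply: leqW; exact: (@leq_bigmax _ (fun j => r (idx j))).
pose Phi (x : 'I_D -> R) : 'rV[R]_m := \row_j (u (idx j) * \prod_(i < D) Hfac i.+2 (a j i.+2) (x i)).
pose U n (lam : intpart n) : 'rV[R]_m := Phi (fun i => V R i.+2 lam).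
have UE n (lam : intpart n) j : U n lam 0 j = u (idx j) * Hm R D.+1 (a j) lam by rewrite mxE Hm_ord.
have cPhi : continuous (fun x : 'rV[R]_D => Phi (fun i => x 0 i)).
  apply: continuous_row => j; apply: continuous_scale.
  apply: (@continuous_prodr R _ _ (index_enum 'I_D) (fun i (z : 'rV[R]_D) => Hfac i.+2 (a j i.+2) (z 0 i))) => i.
  apply: continuous_scale => y; apply: continuous_comp; first exact: coord_continuous.
  exact: continuous_horner.
have rowE (x : 'I_D -> R) : Phi (fun i => (\row_i x i : 'rV[R]_D) 0 i) = Phi x.
  by congr Phi; apply/funext => i; rewrite mxE.
have [M fM'] := fM.
have lim1 : (fun n => Ex (fun lam : intpart n => f (U n lam))) @ \oo --> (\int[P]_w f (Phi (fun i => xi i.+2 w)))%R.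
  apply: (vector_limit hgauss hindep (F := fun x => f (Phi x)) (M := M)) => [x|B e e0]; first exact: fM'.
  have cF : continuous (fun x : 'rV[R]_D => f (Phi (fun i => x 0 i))).
    by move=> x; apply: continuous_comp; [exact: cPhi | exact: cf].
  have [dl dl0 hdl] := uniform_on_box B cF e0.
  exists dl => // x y xB xy; have := hdl (\row_i x i) (\row_i y i); rewrite !rowE; apply.
    by move=> i; rewrite mxE.
  by move=> i; rewrite !mxE.
pose W n (lam : intpart n) : 'rV[R]_m := \row_j ((n%:R : R) `^ ((wt (rho (idx j)))%:R / 2) *
  partial_trace lam (u (idx j)) (extend n (sigma (idx j)))).
have lim2 : (fun n => Ex (fun lam : intpart n => f (W n lam)) - Ex (fun lam => f (U n lam))) @ \oo --> (0 : R).
  apply: Ex_slutsky => // [j e e0|j].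
    have := PT_hermite (sigma (idx j)) a0 hdim (rd j) (hu (idx j)) e0.
    apply: cvg_trans; apply: near_eq_cvg; near=> n; rewrite /plancherel_prob; apply: eq_bigl => lam.
    by rewrite UE mxE /a hrho.
  have := Hm_sqr_bounded D.+1 (a j) (u (idx j)).
  move=> [C hC]; exists C; apply: filterS hC => n; rewrite (eq_Ex (G := fun lam : intpart n => U n lam 0 j ^+ 2)) //.
  by move=> lam; rewrite UE.
have h : (fun n => (Ex (fun lam : intpart n => f (W n lam)) - Ex (fun lam => f (U n lam))) +
    Ex (fun lam : intpart n => f (U n lam))) @ \oo --> (0 + \int[P]_w f (Phi (fun i => xi i.+2 w)) : R).
  by apply: cvgD.
rewrite add0r in h.
have YE w : \row_j (u (idx j) * \prod_(2 <= k < (sumn (rho (idx j))).+1)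
    ((k%:R : R) `^ ((multiplicity k (rho (idx j)))%:R / 2) * (hermite (multiplicity k (rho (idx j)))).[xi k w])) =
    Phi (fun i => xi i.+2 w).
  apply/rowP => j; rewrite !mxE; congr (_ * _).
  have sr : (sumn (rho (idx j)) <= D.+1)%N by rewrite -hrho sumn_cycle_type.
  have -> : \prod_(i < D) Hfac i.+2 (a j i.+2) (xi i.+2 w) = \prod_(2 <= k < D.+2) Hfac k (a j k) (xi k w).
    by rewrite (big_addn 0 D.+2 2) !subSS subn0 big_mkord; apply: eq_bigr => i _; rewrite addn2.
  under eq_bigr => k _ do rewrite powR_half -/(Hfac k (a j k) (xi k w)).
  (* The product in the statement stops at the size of the partition; the factors added up to D + 1
     have multiplicity 0 and equal 1. *)
  rewrite (big_nat_widen _ _ D.+2) // big_mkcond; apply: eq_bigr => k _; case: ltnP => // ck.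
  rewrite /a (_ : multiplicity k (rho (idx j)) = 0%N); first by rewrite /Hfac expr0 hornerC mulr1.
  apply/count_memPn/negP => kr; have : (k <= sumn (rho (idx j)))%N; last by lia.
  by elim: (rho (idx j)) kr => //= b l IH; rewrite inE => /orP[/eqP->|/IH]; lia.
move: h; under eq_Rintegral => w _ do rewrite -YE.
apply: cvg_trans; apply: near_eq_cvg; near=> n; rewrite /= subrK; apply: eq_bigr => lam _.
by [].
Unshelve. all: by end_near.
Qed.
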